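(* Assume Rayleigh fading ($\mathsf g_{xy}\sim\mathrm{Exp}(1)$ i.i.d., independent of $\Phi_{\text t}$), $\alpha\in\{2,4\}$, $c>0$, $y_0\in\mathbb{R}^2\setminus\{0\}$, and the hypotheses on $F$ required for $A_\alpha(y_0,\beta(c+d^\alpha)+c)$. Let $x_0$ be a reference transmitter with $\|x_0-y_0\|=d>0$, let $\eta\ge0$ and $\beta>0$, and define the outage probability $$q(y_0):=\mathbb{P}\left(\frac{\mathsf g_{x_0y_0}}{\eta+(c+d^\alpha)\,\mathsf I(y_0)}<\beta\right),$$ where $\mathsf g_{x_0y_0}\sim\mathrm{Exp}(1)$ is independent of $\mathsf I(y_0)$. Then $$q(y_0)=1-\mathcal L_{\mathsf I(y_0)}\big(\beta(c+d^\alpha)\big)e^{-\beta\eta}=1-\exp\Big\{-\beta\eta-\lambda\beta(c+d^\alpha)A_\alpha\big(y_0,\beta(c+d^\alpha)+c\big)\Big\}.$$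
   Context: Network model: let $\lambda>0$ and let $F:[0,\infty)\to[0,\infty)$ satisfy $\max_{r\ge0}F(r)=1$, $F$ continuously differentiable with derivative $f$. $\Phi_{\text t}$ is a Poisson point process on $\mathbb{R}^2$ with intensity function $x\mapsto\lambda F(\|x\|)$ (the interferers other than $x_0$). Path loss $\ell(r):=(c+r^\alpha)^{-1}$. Interference $\mathsf I(y_0):=\sum_{\mathsf x\in\Phi_{\text t}}\mathsf g_{\mathsf xy_0}\ell(\|\mathsf x-y_0\|)$, with Laplace transform $\mathcal L_{\mathsf I(y_0)}(s)=\mathbb E[e^{-s\mathsf I(y_0)}]$. Write $\rho=\|y_0\|$ and let $b>0$. For $\alpha=2$ (assuming $\limsup_{r\to\infty}F(r)r^\nu<\infty$ for some $\nu>0$ and absolute convergence of the integral): $A_2(y_0,b):=\pi\big(F(0)\operatorname{arcsinh}\frac{\rho^2-b}{2\rho\sqrt b}+\int_0^\infty f(r)\operatorname{arcsinh}\frac{\rho^2-r^2-b}{2\rho\sqrt b}\mathrm dr\big)$. For $\alpha=4$ (assuming $\int_0^\infty|f|<\infty$): $A_4(y_0,b):=\frac{\pi}{2\sqrt b}\big(\lim_{r\to\infty}F(r)\Theta_b(r)-F(0)\Theta_b(0^+)-\int_0^\infty f(r)\Theta_b(r)\mathrm dr\big)$, where for $r>0$, $\Theta_b(r):=\arctan\frac{2\mathrm{Re}\{\kappa\}}{1-|\kappa|^2}$ with $\kappa=\kappa(r,b,\rho):=\frac{r^2-\rho^2-j\sqrt b}{\sqrt{(\sqrt b+j(r^2+\rho^2))^2+4r^2\rho^2}}$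 ($j=\sqrt{-1}$, principal square root, $\arctan$ valued in $(-\pi/2,\pi/2)$), and $\Theta_b(0^+):=\lim_{r\downarrow0}\Theta_b(r)$. *)

(* Defs.v *)
From HB Require Import structures.
From mathcomp Require Import all_boot all_order all_algebra.
From mathcomp Require Import all_classical all_reals all_analysis measurable_realfun.
Set Implicit Arguments. Unset Strict Implicit. Unset Printing Implicit Defensive.
Import Order.TTheory GRing.Theory Num.Theory.
Import numFieldNormedType.Exports.
Local Open Scope classical_set_scope.
Local Open Scope ring_scope.

Section defs.
Context {R : realType}.

Definition dist2 (x y : R * R) : R := Num.sqrt ((x.1 - y.1) ^+ 2 + (x.2 - y.2) ^+ 2).
Definition origin2 : R * R := (0, 0).

Definition leb2 := ((@lebesgue_measure R) \x (@lebesgue_measure R))%E.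

Definition pathloss (c : R) (alpha : nat) (r : R) : R := (c + r ^+ alpha)^-1.

(** Poisson pmf (correct also for rate 0) *)
Definition poisson_pmf0 (rate : R) (k : nat) : R :=
  rate ^+ k / k`!%:R * expR (- rate).

Definition exp1_cdf (t : R) : R := if t < 0 then 0 else 1 - expR (- t).

Definition intensity (lam : R) (F : R -> R) (B : set (R * R)) : \bar R :=
  (\int[leb2]_(x in B) (lam * F (dist2 x origin2))%:E)%E.

Variables (d : measure_display) (Omega : measurableType d).

(** The point process is given by a labelling of its points:
    X i w is the i-th point, present iff alive i w. *)
Definition count (X : nat -> Omega -> R * R) (alive : nat -> Omega -> bool)
  (w : Omega) (B : set (R * R)) : \bar R :=
  (\sum_(i <oo | alive i w) (X i w \in B)%:R%:E)%E.

Definition measurable_points (X : nat -> Omega -> R * R) (alive : nat -> Omega -> bool) :=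
  forall i, measurable_fun setT (X i) /\ measurable [set w | alive i w].

Definition is_PPP (P : probability Omega R) (X : nat -> Omega -> R * R)
  (alive : nat -> Omega -> bool) (lam : R) (F : R -> R) :=
  forall (n : nat) (B : 'I_n -> set (R * R)) (k : 'I_n -> nat),
    (forall j, measurable (B j)) ->
    (forall j, (intensity lam F (B j) < +oo)%E) ->
    (forall j1 j2, j1 != j2 -> B j1 `&` B j2 = set0) ->
    P (\bigcap_(j in [set: 'I_n]) [set w | count X alive w (B j) = (k j)%:R%:E]) =
    (\prod_(j < n) (poisson_pmf0 (fine (intensity lam F (B j))) (k j))%:E)%E.

Definition points_events (X : nat -> Omega -> R * R) (alive : nat -> Omega -> bool) :
  set (set Omega) :=
  <<s [set A | exists i, A = [set w | alive i w] \/
        exists B, measurable B /\ A = X i @^-1` B] >>.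

Definition iid_exp1_marks_indep (P : probability Omega R) (X : nat -> Omega -> R * R)
  (alive : nat -> Omega -> bool) (g : nat -> Omega -> R) :=
  (forall i, measurable_fun setT (g i)) /\
  forall (J : seq nat) (t : nat -> R) (E : set Omega),
    uniq J -> points_events X alive E ->
    P (E `&` \bigcap_(j in [set j | j \in J]) [set w | g j w <= t j]) =
    (P E * \prod_(j <- J) (exp1_cdf (t j))%:E)%E.

Definition interference (c : R) (alpha : nat) (X : nat -> Omega -> R * R)
  (alive : nat -> Omega -> bool) (g : nat -> Omega -> R) (y0 : R * R) (w : Omega) : \bar R :=
  (\sum_(i <oo | alive i w) (g i w * pathloss c alpha (dist2 (X i w) y0))%:E)%E.

Definition laplace (P : probability Omega R) (I : Omega -> \bar R) (s : R) : \bar R :=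
  (\int[P]_w expeR (- (s%:E * I w)))%E.

End defs.

Section closed_forms.
Context {R : realType}.

Definition arcsinh (x : R) : R := ln (x + Num.sqrt (x ^+ 2 + 1)).

(** A_2(y0,b), rho = ||y0|| *)
Definition A2 (F f : R -> R) (rho b : R) : R :=
  pi * (F 0 * arcsinh ((rho ^+ 2 - b) / (2 * rho * Num.sqrt b)) +
        fine (\int[lebesgue_measure]_(r in `[0%R, +oo[)
                (f r * arcsinh ((rho ^+ 2 - r ^+ 2 - b) / (2 * rho * Num.sqrt b)))%:E)%E).

(** minimal complex arithmetic on pairs (re, im) *)
Definition cmul (z w : R * R) : R * R := (z.1 * w.1 - z.2 * w.2, z.1 * w.2 + z.2 * w.1).
Definition cnorm2 (z : R * R) : R := z.1 ^+ 2 + z.2 ^+ 2.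
Definition cinv (z : R * R) : R * R := (z.1 / cnorm2 z, - z.2 / cnorm2 z).
Definition cdiv (z w : R * R) : R * R := cmul z (cinv w).
(** principal square root *)
Definition csqrt (z : R * R) : R * R :=
  let r := Num.sqrt (cnorm2 z) in
  (Num.sqrt ((r + z.1) / 2), (if z.2 == 0 then 1 else Num.sg z.2) * Num.sqrt ((r - z.1) / 2)).

Definition kappa (r b rho : R) : R * R :=
  let u := (Num.sqrt b, r ^+ 2 + rho ^+ 2) in
  let w := cmul u u in
  cdiv (r ^+ 2 - rho ^+ 2, - Num.sqrt b) (csqrt (w.1 + 4 * r ^+ 2 * rho ^+ 2, w.2)).

Definition Theta (b rho r : R) : R :=
  let k := kappa r b rho in atan (2 * k.1 / (1 - cnorm2 k)).

Definition A4 (F f : R -> R) (rho b : R) : R :=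
  pi / (2 * Num.sqrt b) *
  (lim ((fun r => F r * Theta b rho r) @ +oo) - F 0 * lim (Theta b rho @ 0^'+) -
   fine (\int[lebesgue_measure]_(r in `]0%R, +oo[) (f r * Theta b rho r)%:E)%E).

Definition A_alpha (alpha : nat) (F f : R -> R) (rho b : R) : R :=
  if alpha == 2%N then A2 F f rho b else A4 F f rho b.

Definition F_standing (F f : R -> R) :=
  (forall r, 0 <= r -> 0 <= F r <= 1) /\ (exists r0, 0 <= r0 /\ F r0 = 1) /\
  (forall r : R, 0 < r -> is_derive r 1 F (f r)) /\
  ((fun h => (F h - F 0) / h) @ 0^'+ --> f 0) /\
  {within `[0%R, +oo[ : set R, continuous f}.

Definition hyp_A2 (F f : R -> R) (rho b : R) :=
  (exists nu : R, 0 < nu /\ exists M : R, \forall r \near +oo%R, F r * r `^ nu <= M) /\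
  (lebesgue_measure.-integrable `[0%R, +oo[
     (fun r => (f r * arcsinh ((rho ^+ 2 - r ^+ 2 - b) / (2 * rho * Num.sqrt b)))%:E)).

Definition hyp_A4 (f : R -> R) :=
  lebesgue_measure.-integrable `[0%R, +oo[ (fun r => (f r)%:E).

End closed_forms.

(* Main.v *)
Require Import Defs.
From HB Require Import structures.
From mathcomp Require Import all_boot all_order all_algebra.
From mathcomp Require Import all_classical all_reals all_analysis measurable_realfun.
From mathcomp Require Import ring lra.
Set Implicit Arguments. Unset Strict Implicit. Unset Printing Implicit Defensive.
Import Order.TTheory GRing.Theory Num.Theory.
Import numFieldNormedType.Exports.
Local Open Scope classical_set_scope.
Local Open Scope ring_scope.

(** Conditionally on the interference I, the event {g0 < beta (eta + K I)}, with
    K = c + d^alpha, has probability 1 - exp(-beta (eta + K I)), which gives the first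
    equality with s = beta K.  For the Laplace transform of I, averaging the exponential
    marks one at a time turns each factor exp(-s g_i l(X_i)) into (1 + s l(X_i))^-1, and
    the Laplace functional of the Poisson process (step functions first, then monotone
    limits) turns the product over the points into exp(-lam s J), where J is the integral
    of F(|x|) / (s + c + |x - y0|^alpha) over the plane.  In polar coordinates the angular
    integral of the kernel is elementary; its radial primitive is a multiple of the arcsinh
    (alpha = 2) or of Theta_b (alpha = 4), and an integration by parts identifies J with
    A_alpha. *)

(** * Polar coordinates *)

(** The value [b = s + c] comes from 1 - (1 + s l(r))^-1 = s / (s + c + r^alpha). The angle is
    represented by its tangent [u], because the kernel on a circle is then a rational function of
    [u] and partial fractions apply. Two facts have to be earned on the way. First, J is not known
    beforehand to be finite: what is available is the integrability of [f] times the radial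
    primitive, so the integration by parts asks only for an upper bound on the boundary term,
    deduces finiteness from the sign of the integrand, and for alpha = 4 yields in this way the very
    existence of the limit of [F r * Theta b rho r]. Second, the marks are positive only almost
    surely, so on a null set the series I may have negative terms or fail to converge; hence the
    exponentials of extended reals, the measurability of [limn] without convergence, and the
    almost-sure equalities. The point process is known only through the laws of its counts on sets
    of finite intensity, which forces a truncation to boxes. *)

Definition image_measure d d' (T1 : measurableType d) (T2 : measurableType d')
    (R : realFieldType) (m : {measure set T1 -> \bar R}) (f : T1 -> T2)
    (mf : measurable_fun [set: T1] f) : {measure set T2 -> \bar R} :=
  measure_function_pushforward__canonical__measure_function_Measure m mf.

Lemma ge0_integral_image_measure d d' (T1 : measurableType d) (T2 : measurableType d')
    (R : realType) (m : {measure set T1 -> \bar R}) (f : T1 -> T2)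
    (mf : measurable_fun [set: T1] f) (h : T2 -> \bar R) :
  measurable_fun setT h -> (forall y, 0 <= h y)%E ->
  (\int[image_measure m mf]_y h y = \int[m]_x h (f x))%E.
Proof. by move=> mh h0; exact: ge0_integral_pushforward. Qed.

Section affine.
Context {R : realType}.
Local Notation mu := (@lebesgue_measure R).

Lemma measurable_affine (a b : R) :
  measurable_fun setT (fun x : measurableTypeR R => a * x + b : measurableTypeR R).
Proof. by apply: measurable_funD => //; exact: measurable_funM. Qed.

(** The scaled pushforward is again a measure, so agreement on half-open intervals suffices. For
    [a < 0] the preimage of such an interval is half-open on the other side, which leaves its length
    unchanged. *)
Lemma lebesgue_measure_affine (a b : R) (A : set R) : a != 0 -> measurable A ->
  mu A = (`|a|%:E * pushforward mu (fun x : R => (a * x + b)%R : measurableTypeR R) A)%E.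
Proof.
move=> a0 mA.
have na0 : 0 <= `|a| by [].
pose phi := (fun x : R => a * x + b : measurableTypeR R).
pose m := mscale (NngNum na0) (image_measure mu (measurable_affine a b)).
suff : mu A = m A by [].
apply: lebesgue_measure_unique => // _ [[p q]] _ <-.
change (mu `]p, q] = `|a|%:E * mu (phi @^-1` `]p, q]))%E.
have -> : phi @^-1` `]p, q] = if 0 < a then `](p - b) / a, (q - b) / a]%classic
     else `[(q - b) / a, (p - b) / a[%classic.
  apply/seteqP; split => x/=; case: ifP => ha; rewrite /= !in_itv/= /phi;
   try (have an : a < 0 by rewrite lt_neqAle a0 leNgt ha).
  - by rewrite ltr_pdivrMr// ler_pdivlMr// (mulrC x) ltrBlDr lerBrDr.
  - by rewrite ltr_ndivlMr// ler_ndivrMr// (mulrC x) ltrBlDr lerBrDr andbC.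
  - by rewrite ltr_pdivrMr// ler_pdivlMr// (mulrC x) ltrBlDr lerBrDr.
  - by rewrite ltr_ndivlMr// ler_ndivrMr// (mulrC x) ltrBlDr lerBrDr andbC.
case: ifP => ha; rewrite !lebesgue_measure_itv/= !lte_fin.
  rewrite ltr_pM2r ?invr_gt0// ltrD2r.
  case: ifP => pq; last by rewrite mule0.
  rewrite -!EFinB -EFinM gtr0_norm//; congr EFin; field; exact: a0.
have an : a < 0 by rewrite lt_neqAle a0 leNgt ha.
rewrite ltr_nM2r ?invr_lt0// ltrD2r.
case: ifP => pq; last by rewrite mule0.
rewrite -!EFinB -EFinM ltr0_norm//; congr EFin; field; exact: a0.
Qed.

Lemma ge0_integral_affine (a b : R) (f : R -> \bar R) : a != 0 ->
  measurable_fun setT f -> (forall x, 0 <= f x)%E ->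
  (\int[mu]_x f x = `|a|%:E * \int[mu]_x f (a * x + b)%R)%E.
Proof.
move=> a0 mf f0.
have na0 : 0 <= `|a| by [].
pose m := mscale (NngNum na0) (image_measure mu (measurable_affine a b)).
transitivity (\int[m]_x f x)%E.
  apply: eq_measure_integral => A mA _.
  exact: (lebesgue_measure_affine b a0 mA).
rewrite ge0_integral_mscale//; congr (_ * _)%E.
exact: ge0_integral_image_measure.
Qed.

End affine.

Section plane.
Context {R : realType}.
Local Notation mu := (@lebesgue_measure R).

Lemma ge0_integral_leb2 (H : R * R -> \bar R) :
  measurable_fun setT H -> (forall z, 0 <= H z)%E ->
  (\int[leb2]_z H z = \int[mu]_x \int[mu]_y H (x, y))%E.
Proof. by move=> mH H0; rewrite /leb2 fubini_tonelli1. Qed.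

Lemma ge0_integral_leb2_swap (H : R * R -> \bar R) :
  measurable_fun setT H -> (forall z, 0 <= H z)%E ->
  (\int[leb2]_z H z = \int[mu]_y \int[mu]_x H (x, y))%E.
Proof. by move=> mH H0; rewrite /leb2 fubini_tonelli2. Qed.

(** On each horizontal line the shear is a translation, so Tonelli reduces the claim to dimension
    one. *)
Lemma ge0_integral_shear1 (t : R) (H : R * R -> \bar R) :
  measurable_fun setT H -> (forall z, 0 <= H z)%E ->
  (\int[leb2]_z H z = \int[leb2]_z H ((z.1 + t * z.2)%R, z.2))%E.
Proof.
move=> mH H0.
have mH' : measurable_fun setT (fun z : R * R => H (z.1 + t * z.2, z.2)).
  apply: (measurableT_comp mH) => /=.
  apply/measurable_fun_pairP; split => /=; last exact: measurable_snd.
  by apply: measurable_funD => //; apply: measurable_funM.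
rewrite (ge0_integral_leb2_swap mH H0) (ge0_integral_leb2_swap mH' (fun=> H0 _)).
apply: eq_integral => y _.
rewrite (@ge0_integral_affine _ 1 (t * y))//=.
- by rewrite normr1 mul1e; apply: eq_integral => x _; rewrite mul1r.
- exact: measurable_fun_pair1.
Qed.

Lemma ge0_integral_shear2 (t : R) (H : R * R -> \bar R) :
  measurable_fun setT H -> (forall z, 0 <= H z)%E ->
  (\int[leb2]_z H z = \int[leb2]_z H (z.1, (z.2 + t * z.1)%R))%E.
Proof.
move=> mH H0.
have mH' : measurable_fun setT (fun z : R * R => H (z.1, z.2 + t * z.1)).
  apply: (measurableT_comp mH) => /=.
  apply/measurable_fun_pairP; split => /=; first exact: measurable_fst.
  by apply: measurable_funD => //; apply: measurable_funM.
rewrite (ge0_integral_leb2 mH H0) (ge0_integral_leb2 mH' (fun=> H0 _)).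
apply: eq_integral => x _.
rewrite (@ge0_integral_affine _ 1 (t * x))//=.
- by rewrite normr1 mul1e; apply: eq_integral => y _; rewrite mul1r.
- exact: measurable_fun_pair2.
Qed.

(* A rotation with [c >= 0] is a product of three shears. *)
Lemma ge0_integral_rotation (c s : R) (H : R * R -> \bar R) :
  0 <= c -> c ^+ 2 + s ^+ 2 = 1 ->
  measurable_fun setT H -> (forall z, 0 <= H z)%E ->
  (\int[leb2]_z H z =
   \int[leb2]_z H ((c * z.1 - s * z.2)%R, (s * z.1 + c * z.2)%R))%E.
Proof.
move=> c0 cs1 mH H0.
have c1 : 1 + c != 0 by rewrite gt_eqF// ltr_pwDl.
(* For a rotation by theta this is -tan(theta/2): the rotation is the shear by [t], then by [s] in
   the other direction, then by [t] again. The sign condition on [c] keeps [1 + c] away from 0. *)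
pose t := - (s / (1 + c)).
have mH1 : measurable_fun setT (fun z : R * R => H (z.1 + t * z.2, z.2)).
  apply: (measurableT_comp mH) => /=.
  apply/measurable_fun_pairP; split => /=; last exact: measurable_snd.
  by apply: measurable_funD => //; apply: measurable_funM.
have mH2 : measurable_fun setT (fun z : R * R => H (z.1 + t * (z.2 + s * z.1), z.2 + s * z.1)).
  apply: (measurableT_comp mH) => /=.
  apply/measurable_fun_pairP; split => /=.
    apply: measurable_funD => //; apply: measurable_funM => //.
    by apply: measurable_funD => //; apply: measurable_funM.
  by apply: measurable_funD => //; apply: measurable_funM.
rewrite (ge0_integral_shear1 t)// (@ge0_integral_shear2 s)//=.
rewrite (@ge0_integral_shear1 t)//=.
have ct : 1 + s * t = c.
  have s2 : s ^+ 2 = (1 - c) * (1 + c) by move: cs1; lra.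
  by rewrite /t mulrN mulrA -expr2 s2 mulfK//; ring.
have st : s = - t * (1 + c) by rewrite /t opprK divfK.
apply: eq_integral => -[x y] _ /=; congr (H (_, _)).
  by rewrite [X in _ = _ - X * _]st -ct; ring.
by rewrite -ct; ring.
Qed.

(** This is cos(arctan u), the cosine of the direction of slope [u] in the right half-plane. *)
Definition slope_cos (u : R) : R := (Num.sqrt (1 + u ^+ 2))^-1.

Lemma slope_cos_gt0 u : 0 < slope_cos u.
Proof. by rewrite invr_gt0 sqrtr_gt0 ltr_pwDl ?sqr_ge0. Qed.

Lemma slope_cosE u : slope_cos u ^+ 2 = (1 + u ^+ 2)^-1.
Proof. by rewrite exprVn sqr_sqrtr// addr_ge0 ?sqr_ge0. Qed.

Lemma measurable_slope_cos : measurable_fun setT slope_cos.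
Proof.
apply: continuous_measurable_fun => u; apply: cvgV.
  by rewrite gt_eqF// sqrtr_gt0 ltr_pwDl ?sqr_ge0.
apply: (@continuous_comp _ _ _ (fun u : R => 1 + u ^+ 2) Num.sqrt); last exact: sqrt_continuous.
by apply: cvgD; [exact: cvg_cst|exact: exprn_continuous].
Qed.

(* Polar coordinates with the slope [u] as angular variable: substitute [y = x u],
   exchange the integrals, then [x = r cos(arctan u)]; a negative [r] covers the left
   half-plane. *)
Lemma ge0_integral_polar (H : R * R -> \bar R) :
  measurable_fun setT H -> (forall z, 0 <= H z)%E ->
  (\int[leb2]_z H z = \int[mu]_r \int[mu]_u
     ((`|r| / (1 + u ^+ 2))%:E * H ((r * slope_cos u)%R, (r * slope_cos u * u)%R)))%E.
Proof.
move=> mH H0.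
have mH1 : measurable_fun setT (fun z : R * R => H (z.1, (z.1 * z.2)%R)).
  apply: (measurableT_comp mH) => /=.
  apply/measurable_fun_pairP; split => /=; first exact: measurable_fst.
  exact: measurable_funM.
have mH2 : measurable_fun setT (fun z : R * R => (`|z.1|%:E * H (z.1, (z.1 * z.2)%R))%E).
  apply: emeasurable_funM => //.
  by apply/measurable_EFinP; apply: measurableT_comp.
have mH3 : measurable_fun setT (fun z : R * R => ((`|z.1| / (1 + z.2 ^+ 2))%:E *
    H ((z.1 * slope_cos z.2)%R, (z.1 * slope_cos z.2 * z.2)%R))%E).
  have mc : measurable_fun setT (fun z : R * R => slope_cos z.2).
    by apply: measurableT_comp => //; exact: measurable_slope_cos.
  apply: emeasurable_funM.
    apply/measurable_EFinP; apply: measurable_funM => //.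
      exact: measurableT_comp.
    rewrite (_ : (fun _ => _) = (fun z : R * R => slope_cos z.2 ^+ 2)).
      exact: measurable_funX.
    by apply/funext => z; rewrite slope_cosE.
  apply: (measurableT_comp mH) => /=.
  apply/measurable_fun_pairP; split => /=; first exact: measurable_funM.
  apply: measurable_funM => //; exact: measurable_funM.
have H20 z : (0 <= `|z.1|%:E * H (z.1, (z.1 * z.2)%R))%E.
  by rewrite mule_ge0// lee_fin.
have H30 z : (0 <= (`|z.1| / (1 + z.2 ^+ 2))%:E *
    H ((z.1 * slope_cos z.2)%R, (z.1 * slope_cos z.2 * z.2)%R))%E.
  by rewrite mule_ge0// lee_fin divr_ge0// addr_ge0 ?sqr_ge0.
transitivity (\int[leb2]_z (`|z.1|%:E * H (z.1, (z.1 * z.2)%R)))%E.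
  rewrite (ge0_integral_leb2 mH H0) (ge0_integral_leb2 mH2 H20).
  apply: ge0_ae_eq_integral => //.
  - exact: (measurable_fun_fubini_tonelli_F (m2 := mu) _ mH H0).
  - exact: (measurable_fun_fubini_tonelli_F (m2 := mu) _ mH2 H20).
  - by move=> x _; exact: integral_ge0.
  - by move=> x _; exact: integral_ge0.
  (* The substitution y = x u degenerates on the vertical axis x = 0, which is a null set. *)
  exists [set 0]; split; [exact: measurable_set1|exact: lebesgue_measure_set1|].
  move=> x /=; apply: contraPP => /eqP x0; apply => _.
  rewrite (@ge0_integral_affine _ x 0)//=; last exact: measurable_fun_pair2.
  rewrite ge0_integralZl_EFin//=.
    by under eq_integral do rewrite addr0.
  exact: (measurable_fun_pair2 x mH1).
rewrite (ge0_integral_leb2_swap mH2 H20) -(ge0_integral_leb2 mH3 H30).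
rewrite (ge0_integral_leb2_swap mH3 H30).
apply: eq_integral => u _.
have c0 := slope_cos_gt0 u.
have cn0 : slope_cos u != 0 by rewrite gt_eqF.
have mHu : measurable_fun setT (fun x : R => (`|x|%:E * H (x, (x * u)%R))%E).
  exact: (measurable_fun_pair1 u mH2).
(* One factor [slope_cos u] comes from this substitution and another from |x|; their product is the
   weight 1 / (1 + u^2). *)
rewrite (ge0_integral_affine 0 cn0 mHu (fun x => H20 (x, u))).
rewrite -ge0_integralZl_EFin//=; last 2 first.
- by move=> x _; exact: (H20 (_, u)).
- exact: (measurableT_comp mHu (measurable_affine (slope_cos u) 0)).
apply: eq_integral => r _; rewrite addr0 muleA -EFinM; congr (_%:E * H (_, _))%E.
- by rewrite normrM (gtr0_norm c0) mulrA -expr2 slope_cosE mulrC.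
- by rewrite mulrC.
- by rewrite (mulrC _ r).
Qed.

End plane.

(** * Angular integrals *)

Section derivatives.
Context {R : realType}.
Implicit Types (f g : R -> R) (x df dg : R).

Lemma is_derive_addf f g x df dg : is_derive x 1 f df -> is_derive x 1 g dg ->
  is_derive x 1 (fun y => f y + g y) (df + dg).
Proof. by move=> hf hg; apply: is_deriveD. Qed.

Lemma is_derive_subf f g x df dg : is_derive x 1 f df -> is_derive x 1 g dg ->
  is_derive x 1 (fun y => f y - g y) (df - dg).
Proof. by move=> hf hg; apply: is_deriveB. Qed.

Lemma is_derive_oppf f x df : is_derive x 1 f df ->
  is_derive x 1 (fun y => - f y) (- df).
Proof. by move=> hf; apply: is_deriveN. Qed.

Lemma is_derive_mulf f g x df dg : is_derive x 1 f df -> is_derive x 1 g dg ->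
  is_derive x 1 (fun y => f y * g y) (df * g x + f x * dg).
Proof.
move=> hf hg; rewrite addrC (mulrC df).
exact: (@is_deriveM _ _ f g x 1 df dg).
Qed.

Lemma is_derive_expf f x df n : is_derive x 1 f df ->
  is_derive x 1 (fun y => f y ^+ n) (n%:R * f x ^+ n.-1 * df).
Proof. by move=> hf; rewrite -exprfctE; exact: (@is_deriveX _ _ f n x 1 df). Qed.

Lemma is_derive_idf x : is_derive x 1 (fun y : R => y) 1.
Proof. exact: is_derive_id. Qed.

Lemma is_derive_cstf (a x : R) : is_derive x 1 (fun=> a) 0.
Proof. exact: is_derive_cst. Qed.

Lemma is_derive_invf f x df : f x != 0 -> is_derive x 1 f df ->
  is_derive x 1 (fun y => (f y)^-1) (- df / f x ^+ 2).
Proof.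
move=> fx0 hf.
apply: (@is_derive_eq _ _ _ _ _ _ _ _ (is_deriveV fx0 hf)).
by rewrite /GRing.scale/= mulNr mulrC -mulNr.
Qed.

Lemma is_derive_compf f g x df dg : is_derive (g x) 1 f df -> is_derive x 1 g dg ->
  is_derive x 1 (fun y => f (g y)) (df * dg).
Proof. by move=> hf hg; exact: (@is_derive1_comp _ f g x df dg). Qed.

Lemma is_derive_atanf f x df : is_derive x 1 f df ->
  is_derive x 1 (fun y => atan (f y)) (df / (1 + f x ^+ 2)).
Proof.
by move=> hf; rewrite mulrC; apply: is_derive_compf.
Qed.

Lemma is_derive_lnf f x df : 0 < f x -> is_derive x 1 f df ->
  is_derive x 1 (fun y => ln (f y)) (df / f x).
Proof.
by move=> fx0 hf; rewrite mulrC; apply: is_derive_compf; exact: is_derive1_ln.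
Qed.

Lemma is_derive_sqrtf f x df : 0 < f x -> is_derive x 1 f df ->
  is_derive x 1 (fun y => Num.sqrt (f y)) (df / (2 * Num.sqrt (f x))).
Proof.
move=> fx0 hf; rewrite mulrC; apply: is_derive_compf.
exact: is_derive1_sqrt.
Qed.

Lemma is_derive_cvg f x df : is_derive x 1 f df -> f y @[y --> x] --> f x.
Proof.
move=> hf; apply: differentiable_continuous; apply/derivable1_diffP.
exact: ex_derive.
Qed.

End derivatives.

(** The derivative is an existential variable filled in by the syntax of the function; [deriv] then
    leaves the equality with the expected derivative. Trying [eassumption] first lets a derivative
    already in the context, or a positivity hypothesis, take precedence over unfolding. *)
Ltac deriv_step := first
  [ eassumption
  | simple notypeclasses refine (is_derive_cstf _ _)
  | simple notypeclasses refine (is_derive_idf _)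
  | simple notypeclasses refine (is_derive_addf _ _)
  | simple notypeclasses refine (is_derive_subf _ _)
  | simple notypeclasses refine (is_derive_oppf _)
  | simple notypeclasses refine (is_derive_mulf _ _)
  | simple notypeclasses refine (is_derive_expf _ _)
  | simple notypeclasses refine (is_derive_atanf _)
  | simple notypeclasses refine (is_derive_invf _ _)
  | simple notypeclasses refine (is_derive_lnf _ _)
  | simple notypeclasses refine (is_derive_sqrtf _ _) ]; shelve_unifiable.

Ltac deriv := simple notypeclasses refine (is_derive_eq _ _); shelve_unifiable;
  [repeat deriv_step | cbv beta; rewrite ?subn1 /=].

Section angular.
Context {R : realType}.
Local Notation mu := (@lebesgue_measure R).

Lemma ge0_even_integral_FTC (h Psi : R -> R) (l : R) :
  (forall u, 0 <= h u) -> continuous h -> (forall u, h (- u) = h u) ->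
  (forall u : R, is_derive u 1 Psi (h u)) -> Psi 0 = 0 ->
  Psi u @[u --> +oo] --> l ->
  (\int[mu]_u (h u)%:E = (2 * l)%:E)%E.
Proof.
move=> h0 ch evh dPsi Psi0 Psil.
rewrite ge0_symfun_integralT//; last by move=> u /=; rewrite evh.
rewrite (_ : [set x | 0 <= x] = `[0, +oo[%classic); last first.
  by apply/seteqP; split => x/=; rewrite in_itv/= andbT.
rewrite (@ge0_continuous_FTC2y _ h Psi 0 l)//.
- by rewrite Psi0 sube0 -EFinM.
- exact: continuous_subspaceT.
- by apply: cvg_at_right_filter; exact: is_derive_cvg.
- by move=> u _; rewrite derive1E; exact: derive_val.
Qed.

Lemma cvgy_affine (a b : R) : 0 < a -> a * u + b @[u --> +oo] --> +oo.
Proof.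
move=> a0; apply/cvgryPge => A; near=> u.
rewrite -lerBlDr mulrC -ler_pdivrMr//.
Unshelve. all: by end_near. Qed.

Lemma integral_quadratic_angle (B S : R) : 0 < B -> 0 < S ->
  (\int[mu]_u (2 * B / (B ^+ 2 * u ^+ 2 + S ^+ 2))%:E = (2 * pi / S)%:E)%E.
Proof.
move=> B0 S0.
have pos u : 0 < B ^+ 2 * u ^+ 2 + S ^+ 2.
  by rewrite ltr_wpDl ?exprn_gt0// mulr_ge0// sqr_ge0.
(* The [+ 0] gives the argument of [atan] the shape required by [cvgy_affine]. *)
have dP (u : R) : is_derive u 1 (fun u => 2 / S * atan (B / S * u + 0))
    (2 * B / (B ^+ 2 * u ^+ 2 + S ^+ 2)).
  deriv.
  have Sn0 : S != 0 by rewrite gt_eqF.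
  by field; rewrite Sn0 andbT/= exprMn gt_eqF.
rewrite (@ge0_even_integral_FTC _ (fun u => 2 / S * atan (B / S * u + 0)) (2 / S * (pi / 2))).
- by congr EFin; field; rewrite gt_eqF.
- by move=> u; rewrite divr_ge0 ?mulr_ge0// ltW.
- move=> u; apply: cvgM; first exact: cvg_cst.
  apply: cvgV; first by rewrite gt_eqF.
  apply: is_derive_cvg.
- by move=> u; rewrite sqrrN.
- by rewrite mulr0 addr0 atan0 mulr0.
- apply: cvgM; first exact: cvg_cst.
  apply: (cvg_comp (fun u => B / S * u + 0) atan); last exact: cvgy_atan.
  by apply: cvgy_affine; rewrite divr_gt0.
Qed.

(** Partial fractions over two quadratics of common discriminant [- tau ^+ 2]. The primitive
    combines two arctangents, with weight [c1], and the logarithm of the quotient of the quadratics,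
    with weight [c2]; the logarithm vanishes at 0 and at infinity, so only the arctangents
    contribute. The weight [c2] divides by [e], hence [0 < e]. *)
Lemma integral_quartic_angle (E W D e tau : R) :
  0 < E -> 0 < W -> 0 <= D -> 0 < e -> 0 < tau -> tau ^+ 2 + e ^+ 2 = 4 * E * W ->
  (\int[mu]_u (2 * (E * u ^+ 2 + D) /
     ((E * u ^+ 2 - e * u + W) * (E * u ^+ 2 + e * u + W)))%:E =
   (2 * pi * (W + D) / (W * tau))%:E)%E.
Proof.
move=> E0 W0 D0 e0 t0 te.
have qE u : E * u ^+ 2 + e * u + W = ((2 * E * u + e) ^+ 2 + tau ^+ 2) / (4 * E).
  by rewrite (_ : tau ^+ 2 = 4 * E * W - e ^+ 2);
    [field; rewrite gt_eqF|rewrite -te; ring].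
have pos1 u : 0 < E * u ^+ 2 + e * u + W.
  by rewrite qE divr_gt0 ?mulr_gt0// ltr_wpDl ?exprn_gt0// sqr_ge0.
have pos2 u : 0 < E * u ^+ 2 - e * u + W.
  by have := pos1 (- u); rewrite sqrrN mulrN.
have [En0 Wn0 en0 tn0] : [/\ E != 0, W != 0, e != 0 & tau != 0].
  by split; rewrite gt_eqF.
pose c1 := (W + D) / (W * tau).
pose c2 := (W - D) / (2 * e * W).
pose Psi u := c1 * (atan (2 * E / tau * u + e / tau) + atan (2 * E / tau * u - e / tau)) +
  c2 * ln ((E * u ^+ 2 - e * u + W) / (E * u ^+ 2 + e * u + W)).
have cPsi : Psi u @[u --> +oo] --> c1 * (pi / 2 + pi / 2) + c2 * 0.
  have Et : 0 < 2 * E / tau by rewrite divr_gt0 ?mulr_gt0.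
  apply: cvgD; apply: cvgM; [exact: cvg_cst| |exact: cvg_cst|].
    apply: cvgD.
      apply: (cvg_comp (fun u => 2 * E / tau * u + e / tau) atan); last exact: cvgy_atan.
      exact: cvgy_affine.
    apply: (cvg_comp (fun u => 2 * E / tau * u - e / tau) atan); last exact: cvgy_atan.
    exact: cvgy_affine.
  rewrite -ln1.
  apply: (cvg_comp (fun u => (E * u ^+ 2 - e * u + W) / (E * u ^+ 2 + e * u + W)) (@ln R));
    last exact: continuous_ln.
  rewrite (_ : (fun u => _) =
    (fun u => 1 - 2 * e * u / (E * u ^+ 2 + e * u + W))); last first.
    by apply/funext => u; field; rewrite gt_eqF.
  suff : 1 - 2 * e * u / (E * u ^+ 2 + e * u + W) @[u --> +oo] --> (1 - 0 : R) by rewrite subr0.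
  apply: cvgB; first exact: cvg_cst.
  apply: (@squeeze_cvgr _ _ _ _ (cst 0) (fun u => 2 * e / E * u^-1)).
  - near=> u; have u0 : 0 < u by [].
    rewrite divr_ge0//=; last 2 first.
    + by rewrite !mulr_ge0// ltW.
    + exact: ltW.
    rewrite ler_pdivrMr// -subr_ge0.
    rewrite (_ : _ - _ = 2 * e / E * (u^-1 * W + e)); last first.
      by field; rewrite En0 gt_eqF.
    by rewrite mulr_ge0 ?divr_ge0 ?mulr_ge0 ?ltW// addr_gt0// mulr_gt0 ?invr_gt0.
  - exact: cvg_cst.
  - rewrite -(mulr0 (2 * e / E)); apply: cvgM; first exact: cvg_cst.
    by apply/gtr0_cvgV0; [exact: nbhs_pinfty_gt|exact: cvg_id].
have dPsi (u : R) : is_derive u 1 Psi (2 * (E * u ^+ 2 + D) /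
     ((E * u ^+ 2 - e * u + W) * (E * u ^+ 2 + e * u + W))).
  have p1n0 : E * u ^+ 2 + e * u + W != 0 by rewrite gt_eqF.
  have p2n0 : E * u ^+ 2 - e * u + W != 0 by rewrite gt_eqF.
  rewrite /Psi; deriv => //; first by rewrite divr_gt0.
  have a1 : 1 + (2 * E / tau * u + e / tau) ^+ 2 =
      4 * E * (E * u ^+ 2 + e * u + W) / tau ^+ 2.
    by rewrite qE; field; rewrite En0 tn0.
  have a2 : 1 + (2 * E / tau * u - e / tau) ^+ 2 =
      4 * E * (E * u ^+ 2 - e * u + W) / tau ^+ 2.
    by have := qE (- u); rewrite sqrrN !mulrN => ->; field; rewrite En0 tn0.
  rewrite a1 a2 /c1 /c2.
  by field; rewrite ?En0 ?Wn0 ?en0 ?tn0 ?p1n0 ?p2n0.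
rewrite (ge0_even_integral_FTC _ _ _ dPsi _ cPsi).
- by congr EFin; rewrite /c1; field; rewrite Wn0 tn0.
- move=> u; rewrite divr_ge0//; last by rewrite mulr_ge0// ltW.
  by rewrite mulr_ge0// addr_ge0// mulr_ge0 ?sqr_ge0// ltW.
- move=> u; apply: cvgM; first exact: is_derive_cvg.
  apply: cvgV; first by rewrite mulf_neq0// gt_eqF.
  exact: is_derive_cvg.
- by move=> u; rewrite sqrrN !mulrN opprK (mulrC (_ + _ + _)).
- rewrite /Psi !mulr0 expr0n/= !mulr0 !addr0 !add0r oppr0 add0r divff// ln1 mulr0 addr0.
  by rewrite atanN subrr mulr0.
Unshelve. all: by end_near. Qed.

End angular.

(** * Reduction of the plane integral to a radial one *)

Section radial.
Context {R : realType}.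
Local Notation mu := (@lebesgue_measure R).

Lemma ge0_integral_fold (G : R -> \bar R) :
  measurable_fun setT G -> (forall r, 0 <= G r)%E ->
  (\int[mu]_r G r = \int[mu]_(r in `[0%R, +oo[) (G r + G (- r)%R))%E.
Proof.
move=> mG G0.
have mGN : measurable_fun setT (fun r : R => G (- r)).
  by apply: (measurableT_comp mG).
rewrite ge0_integralD//=; last 2 first.
- exact: measurable_funTS.
- exact: measurable_funTS.
rewrite (@ge0_integration_by_substitution0 _ (fun r => G (- r)))//.
under [X in (_ + X)%E]eq_integral do rewrite opprK.
rewrite -(integral_itv_bndo_bndc _ (f := G))//; last exact: measurable_funTS.
rewrite addeC -ge0_integral_setU//=.
- congr (integral _ _ _); apply/esym/seteqP; split => // r _ /=.
  by rewrite !in_itv/= andbT; case: (ltP r 0) => ?; [left|right].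
- exact: measurable_funTS.
- by apply/disj_setPLR => r /=; rewrite !in_itv/= andbT leNgt => ->.
Qed.

Variables (k F : R -> R) (y : R * R).
Hypothesis mk : measurable_fun setT k.
Hypothesis k0 : forall D, 0 <= k D.
Hypothesis mF : measurable_fun setT (fun r : R => F `|r|).
Hypothesis F0 : forall r, 0 <= r -> 0 <= F r.
Let rho := dist2 y origin2.
Hypothesis rho0 : 0 < rho.

Lemma dist2_ge0 (x z : R * R) : 0 <= dist2 x z.
Proof. exact: sqrtr_ge0. Qed.

Lemma dist2_sqr (x z : R * R) :
  dist2 x z ^+ 2 = (x.1 - z.1) ^+ 2 + (x.2 - z.2) ^+ 2.
Proof. by rewrite sqr_sqrtr// addr_ge0 ?sqr_ge0. Qed.

Lemma measurable_dist2 (z : R * R) : measurable_fun setT (fun x : R * R => dist2 x z).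
Proof.
have msqrt : measurable_fun setT (@Num.sqrt R).
  by apply: continuous_measurable_fun; exact: sqrt_continuous.
apply: (measurableT_comp msqrt).
by apply: measurable_funD; apply: measurable_funX; apply: measurable_funB.
Qed.

(** After a rotation that brings [y] onto the first axis, the squared distance is given by the law
    of cosines. The two values of [k] are those at opposite points of the circle, that is at [r] and
    [- r] in [ge0_integral_polar]. *)
Lemma ge0_integral_radial_kernel :
  (\int[leb2]_z (F (dist2 z origin2) * k (dist2 z y ^+ 2))%:E =
   \int[mu]_(r in `[0%R, +oo[) \int[mu]_u
     (r * F r * (k (r ^+ 2 + rho ^+ 2 - 2 * r * rho * slope_cos u) +
        k (r ^+ 2 + rho ^+ 2 + 2 * r * rho * slope_cos u)) / (1 + u ^+ 2))%:E)%E.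
Proof.
(* The rotation lemma wants a nonnegative cosine, so [y] is sent to whichever half of the first axis
   makes the angle at most a right angle; [sg] records which half. *)
have [sg [sg2 sgy]] : exists sg : R, sg ^+ 2 = 1 /\ 0 <= sg * y.1.
  have [y10|y10] := leP 0 y.1.
    by exists 1; rewrite expr1n mul1r.
  by exists (-1); rewrite sqrrN expr1n mulN1r oppr_ge0 ltW.
have rho2 : rho ^+ 2 = y.1 ^+ 2 + y.2 ^+ 2 by rewrite dist2_sqr/= !subr0.
(* The rotation with this cosine and sine takes the point (sg rho, 0) to [y]. *)
pose c := sg * y.1 / rho; pose s := sg * y.2 / rho.
have c0 : 0 <= c by rewrite divr_ge0// ltW.
have cs1 : c ^+ 2 + s ^+ 2 = 1.
  rewrite /c /s !exprMn sg2 !mul1r -mulrDl -rho2 -exprMn divff ?expr1n//.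
  by rewrite gt_eqF.
have mH : measurable_fun setT
    (fun z : R * R => (F (dist2 z origin2) * k (dist2 z y ^+ 2))%:E).
  apply/measurable_EFinP; apply: measurable_funM.
    rewrite (_ : (fun _ => _) = (fun r => F `|r|) \o (fun z : R * R => dist2 z origin2)).
      by apply: measurableT_comp => //; exact: measurable_dist2.
    by apply/funext => z /=; rewrite ger0_norm// dist2_ge0.
  apply: measurableT_comp => //; apply: measurable_funX; exact: measurable_dist2.
have H0 z : (0 <= (F (dist2 z origin2) * k (dist2 z y ^+ 2))%:E)%E.
  by rewrite lee_fin mulr_ge0// F0// dist2_ge0.
rewrite (ge0_integral_rotation c0 cs1 mH H0).
pose H' (z : R * R) : \bar R :=
  (F (Num.sqrt (z.1 ^+ 2 + z.2 ^+ 2)) *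
   k (z.1 ^+ 2 + z.2 ^+ 2 + rho ^+ 2 - 2 * sg * rho * z.1))%:E.
transitivity (\int[leb2]_z H' z)%E.
  apply: eq_integral => z _; rewrite /H'; congr (_ * _)%:E.
    congr (F (Num.sqrt _)); rewrite /= !subr0 -[RHS]mul1r -cs1; ring.
  rewrite dist2_sqr/=; congr k.
  have y1E : y.1 = sg * rho * c.
    by rewrite -[LHS]mul1r -sg2 /c; field; rewrite gt_eqF.
  have y2E : y.2 = sg * rho * s.
    by rewrite -[LHS]mul1r -sg2 /s; field; rewrite gt_eqF.
  transitivity ((c ^+ 2 + s ^+ 2) *
    (z.1 ^+ 2 + z.2 ^+ 2 + sg ^+ 2 * rho ^+ 2 - 2 * sg * rho * z.1)).
    by rewrite y1E y2E; ring.
  by rewrite cs1 sg2 !mul1r.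
have mH' : measurable_fun setT H'.
  apply/measurable_EFinP; apply: measurable_funM.
    rewrite (_ : (fun _ => _) = (fun r => F `|r|) \o (fun z : R * R => dist2 z origin2)).
      by apply: measurableT_comp => //; exact: measurable_dist2.
    apply/funext => z /=; rewrite ger0_norm ?dist2_ge0//; congr (F (Num.sqrt _)).
    by rewrite /= !subr0.
  apply: measurableT_comp => //; apply: measurable_funB.
    apply: measurable_funD => //.
    by apply: measurable_funD; exact: measurable_funX.
  exact: measurable_funM.
have H'0 z : (0 <= H' z)%E by rewrite lee_fin mulr_ge0// F0// sqrtr_ge0.
rewrite (ge0_integral_polar mH' H'0).
pose G (r u : R) := `|r| / (1 + u ^+ 2) * (F `|r| *
  k (r ^+ 2 + rho ^+ 2 - 2 * sg * r * rho * slope_cos u)).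
have G0 r u : 0 <= G r u.
  by rewrite mulr_ge0// ?mulr_ge0 ?F0// invr_ge0 addr_ge0 ?sqr_ge0.
have mG : measurable_fun setT (fun z : R * R => (G z.1 z.2)%:E).
  have mc : measurable_fun setT (fun z : R * R => slope_cos z.2).
    by apply: measurableT_comp => //; exact: measurable_slope_cos.
  apply/measurable_EFinP; apply: measurable_funM.
    apply: measurable_funM; first exact: measurableT_comp.
    rewrite (_ : (fun _ => _) = (fun z : R * R => slope_cos z.2 ^+ 2)).
      exact: measurable_funX.
    by apply/funext => z; rewrite slope_cosE.
  apply: measurable_funM.
    exact: (measurableT_comp mF (measurable_fst)).
  apply: (measurableT_comp mk); apply: measurable_funB.
    by apply: measurable_funD => //; exact: measurable_funX.
  by apply: measurable_funM => //; apply: measurable_funM => //; apply: measurable_funM.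
transitivity (\int[mu]_r \int[mu]_u (G r u)%:E)%E.
  apply: eq_integral => r _; apply: eq_integral => u _.
  have hc : (r * slope_cos u) ^+ 2 + (r * slope_cos u * u) ^+ 2 = r ^+ 2.
    by rewrite !exprMn slope_cosE; field; rewrite gt_eqF// ltr_pwDl// sqr_ge0.
  rewrite /G /H' /= hc sqrtr_sqr [in RHS]EFinM; congr (_ * (_ * k _)%:E)%E.
  by ring.
have mGr r : measurable_fun setT (fun u : R => (G r u)%:E).
  exact: (measurable_fun_pair2 r mG).
rewrite (@ge0_integral_fold (fun r => \int[mu]_u (G r u)%:E)%E); last 2 first.
- by apply: (measurable_fun_fubini_tonelli_F (m2 := mu) _ mG) => z; rewrite lee_fin.
- by move=> r; apply: integral_ge0 => u _; rewrite lee_fin.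
apply: eq_integral => r; rewrite inE/= in_itv/= andbT => r0.
rewrite -ge0_integralD//=; last 4 first.
- by move=> u _; rewrite lee_fin.
- exact: mGr.
- by move=> u _; rewrite lee_fin.
- exact: mGr.
apply: eq_integral => u _; rewrite -EFinD /G normrN ger0_norm// sqrrN; congr EFin.
(* Changing the sign [sg] only exchanges the two summands. *)
have : sg = 1 \/ sg = -1.
  by have /eqP := sg2; rewrite sqrf_eq1 => /orP[]/eqP ->; [left|right].
by case=> ->; rewrite !(mulrN, mulNr, mulr1, opprK); ring.
Qed.

End radial.

Section kappa.
Context {R : realType}.
Implicit Types b rho r : R.

(* [density2] and [density4] are the integrals of [(b + |x - y|^alpha)^-1] over the circle
   [|x| = r], where [|y| = rho].  The complex number under the square root in [kappa] has
   modulus [kappaW], and [kappaRe], [kappaIm] are the real and imaginary parts of its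
   principal square root. *)
Definition density2 (b rho r : R) : R :=
  2 * pi * r / Num.sqrt ((b + r ^+ 2 + rho ^+ 2) ^+ 2 - 4 * r ^+ 2 * rho ^+ 2).

Definition kappaW (b rho r : R) : R :=
  Num.sqrt (((r ^+ 2 - rho ^+ 2) ^+ 2 + b) ^+ 2 + 16 * b * r ^+ 2 * rho ^+ 2).

Definition kappaRe (b rho r : R) : R :=
  Num.sqrt ((kappaW b rho r + (b - (r ^+ 2 - rho ^+ 2) ^+ 2)) / 2).

Definition density4 (b rho r : R) : R :=
  2 * pi / Num.sqrt b * (r * kappaRe b rho r / kappaW b rho r).

Variables b rho : R.
Hypothesis b0 : 0 < b.

Lemma kappaW_gt0 r : 0 < kappaW b rho r.
Proof.
rewrite sqrtr_gt0 ltr_pwDl ?exprn_gt0 ?ltr_wpDl ?sqr_ge0//.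
by rewrite mulr_ge0 ?sqr_ge0// mulr_ge0 ?sqr_ge0// mulr_ge0// ltW.
Qed.

Lemma kappaW_sqr r : kappaW b rho r ^+ 2 =
  ((r ^+ 2 - rho ^+ 2) ^+ 2 + b) ^+ 2 + 16 * b * r ^+ 2 * rho ^+ 2.
Proof.
rewrite sqr_sqrtr// addr_ge0 ?sqr_ge0//.
by rewrite mulr_ge0 ?sqr_ge0// mulr_ge0 ?sqr_ge0// mulr_ge0// ltW.
Qed.

Lemma kappaW_ge r : (r ^+ 2 - rho ^+ 2) ^+ 2 + b <= kappaW b rho r.
Proof.
rewrite -(@ler_pXn2r _ 2) ?nnegrE ?addr_ge0 ?sqr_ge0 ?(ltW b0) ?(ltW (kappaW_gt0 r))//.
rewrite kappaW_sqr lerDl.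
by rewrite mulr_ge0 ?sqr_ge0// mulr_ge0 ?sqr_ge0// mulr_ge0// ltW.
Qed.

Lemma kappaRe_rad_gt0 r : 0 < (kappaW b rho r + (b - (r ^+ 2 - rho ^+ 2) ^+ 2)) / 2.
Proof.
rewrite divr_gt0// (lt_le_trans (_ : 0 < b + b))//; first by rewrite addr_gt0.
by have := kappaW_ge r; lra.
Qed.

End kappa.

(** * Integrals of the kernel over circles *)

Section densities.
Context {R : realType}.
Local Notation mu := (@lebesgue_measure R).
Variables (F : R -> R) (y : R * R) (b : R).
Hypothesis mF : measurable_fun setT (fun r : R => F `|r|).
Hypothesis F0 : forall r, 0 <= r -> 0 <= F r.
Hypothesis b0 : 0 < b.
Let rho := dist2 y origin2.
Hypothesis rho0 : 0 < rho.

Lemma slope_cos_le1 (u : R) : slope_cos u <= 1.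
Proof.
rewrite invf_le1 ?sqrtr_gt0 ?ltr_pwDl ?sqr_ge0//.
by rewrite -[leLHS]sqrtr1 ler_sqrt ?lerDl ?sqr_ge0// addr_ge0 ?sqr_ge0.
Qed.

(** With x = 2 r rho cos, the values at opposite points add up to 2 B / (B^2 - x^2); the weight 1 /
    (1 + u^2) turns this into the integrand of [integral_quadratic_angle]. *)
Lemma ge0_integral_kernel2 :
  (\int[leb2]_z (F (dist2 z origin2) * (b + dist2 z y ^+ 2)^-1)%:E =
   \int[mu]_(r in `[0%R, +oo[) (F r * density2 b rho r)%:E)%E.
Proof.
(* The absolute value makes [k] positive and continuous on the whole line; it is invisible at a
   squared distance. *)
pose k (D : R) := (b + `|D|)^-1.
have kp D : 0 < b + `|D| by rewrite ltr_pwDl.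
have mk : measurable_fun setT k.
  apply: continuous_measurable_fun => D; apply: cvgV; first by rewrite gt_eqF.
  by apply: cvgD; [exact: cvg_cst|exact: norm_continuous].
have k0 D : 0 <= k D by rewrite invr_ge0 ltW.
transitivity (\int[leb2]_z (F (dist2 z origin2) * k (dist2 z y ^+ 2))%:E)%E.
  by apply: eq_integral => z _; rewrite /k ger0_norm// sqr_ge0.
rewrite (ge0_integral_radial_kernel mk k0 mF F0 rho0) -/rho.
apply: eq_integral => r; rewrite inE/= in_itv/= andbT => r0.
pose B := b + r ^+ 2 + rho ^+ 2.
pose S := Num.sqrt (B ^+ 2 - 4 * r ^+ 2 * rho ^+ 2).
have B0 : 0 < B by rewrite addr_gt0 ?exprn_gt0// ltr_wpDr ?sqr_ge0.
have S2 : 0 < B ^+ 2 - 4 * r ^+ 2 * rho ^+ 2.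
  rewrite (_ : _ - _ = (b + (r - rho) ^+ 2) * (b + (r + rho) ^+ 2)).
    by rewrite mulr_gt0// ltr_wpDr// sqr_ge0.
  by rewrite /B; ring.
have S0 : 0 < S by rewrite sqrtr_gt0.
have Qp (u : R) : 0 < B ^+ 2 * u ^+ 2 + S ^+ 2.
  by rewrite ltr_wpDl ?exprn_gt0// mulr_ge0// sqr_ge0.
have mQ : measurable_fun setT (fun u : R => 2 * B / (B ^+ 2 * u ^+ 2 + S ^+ 2)).
  apply: continuous_measurable_fun => u; apply: cvgM; first exact: cvg_cst.
  by apply: cvgV; [rewrite gt_eqF|exact: is_derive_cvg].
transitivity (\int[mu]_u ((r * F r)%:E * (2 * B / (B ^+ 2 * u ^+ 2 + S ^+ 2))%:E))%E.
  apply: eq_integral => u _; rewrite -EFinM; congr EFin.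
  have u1 : 0 < 1 + u ^+ 2 by rewrite ltr_pwDl ?sqr_ge0.
  have c2 := slope_cosE u; have c1 := slope_cos_le1 u; have c0 := slope_cos_gt0 u.
  have x0 : 0 <= 2 * r * rho * slope_cos u by rewrite !mulr_ge0// ltW.
  have x1 : 2 * r * rho * slope_cos u <= 2 * r * rho.
    by rewrite ler_piMr// !mulr_ge0// ltW.
  have D1 : 0 <= r ^+ 2 + rho ^+ 2 - 2 * r * rho * slope_cos u.
    rewrite subr_ge0 (le_trans x1)// -subr_ge0 (_ : _ - _ = (r - rho) ^+ 2) ?sqr_ge0//.
    ring.
  have D2 : 0 <= r ^+ 2 + rho ^+ 2 + 2 * r * rho * slope_cos u.
    by rewrite addr_ge0// addr_ge0 ?sqr_ge0.
  rewrite /k !ger0_norm//.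
  have Bm : 0 < B - 2 * r * rho * slope_cos u.
    by rewrite /B -addrA -addrA ltr_pwDl// addrA.
  have Bp : 0 < B + 2 * r * rho * slope_cos u by rewrite ltr_wpDr.
  have eS : B ^+ 2 * u ^+ 2 + S ^+ 2 =
      (1 + u ^+ 2) * ((B - 2 * r * rho * slope_cos u) * (B + 2 * r * rho * slope_cos u)).
    rewrite /S sqr_sqrtr ?(ltW S2)//.
    rewrite (_ : (B - _) * _ = B ^+ 2 - 4 * r ^+ 2 * rho ^+ 2 * slope_cos u ^+ 2); last by ring.
    by rewrite c2; field; rewrite gt_eqF.
  rewrite eS (_ : b + (_ - _) = B - 2 * r * rho * slope_cos u); last by rewrite /B; ring.
  rewrite (_ : b + (_ + _) = B + 2 * r * rho * slope_cos u); last by rewrite /B; ring.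
  field.
  by rewrite !gt_eqF.
rewrite ge0_integralZl_EFin//=; last 3 first.
- move=> u _; rewrite lee_fin divr_ge0//; first by rewrite mulr_ge0// ltW.
  exact: ltW (Qp u).
- exact/measurable_EFinP.
- by rewrite mulr_ge0// F0.
rewrite integral_quadratic_angle// -EFinM; congr EFin.
by rewrite /density2 -/B -/S; ring.
Qed.

(** The two opposite values add up to a fraction whose denominator, expressed in [u], is a
    biquadratic polynomial. It is split into the factors E u^2 - e u + W and E u^2 + e u + W so that
    [integral_quartic_angle] applies. *)
Lemma ge0_integral_kernel4 :
  (\int[leb2]_z (F (dist2 z origin2) * (b + dist2 z y ^+ 4)^-1)%:E =
   \int[mu]_(r in `[0%R, +oo[) (F r * density4 b rho r)%:E)%E.
Proof.
pose k (D : R) := (b + D ^+ 2)^-1.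
have kp (D : R) : 0 < b + D ^+ 2 by rewrite ltr_pwDl ?sqr_ge0.
have mk : measurable_fun setT k.
  apply: continuous_measurable_fun => D; apply: cvgV; first by rewrite gt_eqF.
  exact: is_derive_cvg.
have k0 D : 0 <= k D by rewrite invr_ge0 ltW.
transitivity (\int[leb2]_z (F (dist2 z origin2) * k (dist2 z y ^+ 2))%:E)%E.
  by apply: eq_integral => z _; rewrite /k -exprM.
rewrite (ge0_integral_radial_kernel mk k0 mF F0 rho0) -/rho.
(* At r = 0 the coefficient [e] below would vanish, which the quartic integral excludes; both sides
   are 0 there. *)
apply: eq_integral => r; rewrite inE/= in_itv/= andbT le_eqVlt => /predU1P[<-|r0].
  rewrite /density4 !(mul0r, mulr0); under eq_integral do rewrite !mul0r.
  by rewrite integral0.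
pose m := r ^+ 2 + rho ^+ 2; pose kap := 2 * r * rho.
pose E := b + m ^+ 2; pose W := kappaW b rho r.
pose a := E ^+ 2 + (b - m ^+ 2) * kap ^+ 2.
have m0 : 0 < m by rewrite addr_gt0 ?exprn_gt0.
have kap0 : 0 < kap by rewrite !mulr_gt0.
have E0 : 0 < E by rewrite addr_gt0 ?exprn_gt0.
have W0 : 0 < W by exact: kappaW_gt0.
have W2 : W ^+ 2 = E ^+ 2 + 2 * (b - m ^+ 2) * kap ^+ 2 + kap ^+ 4.
  by rewrite (kappaW_sqr rho b0) /E /kap /m; ring.
(* The biquadratic has leading coefficient E^2, middle coefficient 2 a and constant term W^2. This
   inequality says that it has no real root in u^2, and makes both radicands below positive. *)
have EWa : a ^+ 2 < (E * W) ^+ 2.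
  rewrite exprMn W2 -subr_gt0 (_ : _ - _ = 4 * b * m ^+ 2 * kap ^+ 4).
    by rewrite !mulr_gt0 ?exprn_gt0.
  by rewrite /a /E; ring.
have EW0 : 0 < E * W by rewrite mulr_gt0.
have /ltr_normlP[aEWn aEW] : `|a| < E * W.
  by rewrite -(@ltr_pXn2r _ 2) ?nnegrE ?(ltW EW0)// real_normK ?num_real.
(* Matching the middle coefficient, 2 E W - e^2 = 2 a, determines [e]; then [tau] is fixed by tau^2
   = 4 E W - e^2. *)
pose e := Num.sqrt (2 * (E * W - a)); pose tau := Num.sqrt (2 * (E * W + a)).
have e2 : 0 < 2 * (E * W - a) by rewrite mulr_gt0// subr_gt0.
have t2 : 0 < 2 * (E * W + a) by rewrite mulr_gt0//; lra.
have e0 : 0 < e by rewrite sqrtr_gt0.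
have t0 : 0 < tau by rewrite sqrtr_gt0.
have D0 : 0 <= E + kap ^+ 2 by rewrite addr_ge0 ?sqr_ge0 ?ltW.
have te : tau ^+ 2 + e ^+ 2 = 4 * E * W.
  by rewrite !sqr_sqrtr ?(ltW e2) ?(ltW t2)//; ring.
have main := integral_quartic_angle E0 W0 D0 e0 t0 te.
have QE u : (E * u ^+ 2 - e * u + W) * (E * u ^+ 2 + e * u + W) =
    (E * (1 + u ^+ 2)) ^+ 2 + 2 * (b - m ^+ 2) * kap ^+ 2 * (1 + u ^+ 2) + kap ^+ 4.
  rewrite (_ : _ * _ = E ^+ 2 * u ^+ 4 + (2 * E * W - e ^+ 2) * u ^+ 2 + W ^+ 2); last by ring.
  by rewrite W2 /e sqr_sqrtr ?(ltW e2)// /a; ring.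
have Qpos (u : R) : 0 < (E * u ^+ 2 - e * u + W) * (E * u ^+ 2 + e * u + W).
  have eE : e ^+ 2 = 4 * E * W - tau ^+ 2 by rewrite -te; ring.
  have E4 : 0 < 4 * E by rewrite mulr_gt0.
  rewrite mulr_gt0// -(pmulr_rgt0 _ E4).
    rewrite [ltRHS](_ : _ = (2 * E * u - e) ^+ 2 + (4 * E * W - e ^+ 2)); last by ring.
    by rewrite eE ltr_wpDl ?sqr_ge0// opprB addrC subrK exprn_gt0.
  rewrite [ltRHS](_ : _ = (2 * E * u + e) ^+ 2 + (4 * E * W - e ^+ 2)); last by ring.
  by rewrite eE ltr_wpDl ?sqr_ge0// opprB addrC subrK exprn_gt0.
have mQ : measurable_fun setT (fun u : R => 2 * (E * u ^+ 2 + (E + kap ^+ 2)) /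
    ((E * u ^+ 2 - e * u + W) * (E * u ^+ 2 + e * u + W))).
  apply: continuous_measurable_fun => u; apply: cvgM; first exact: is_derive_cvg.
  by apply: cvgV; [rewrite gt_eqF|exact: is_derive_cvg].
transitivity (\int[mu]_u ((r * F r)%:E * (2 * (E * u ^+ 2 + (E + kap ^+ 2)) /
     ((E * u ^+ 2 - e * u + W) * (E * u ^+ 2 + e * u + W)))%:E))%E.
  apply: eq_integral => u _; rewrite -EFinM; congr EFin.
  have u1 : 0 < 1 + u ^+ 2 by rewrite ltr_pwDl ?sqr_ge0.
  have c2 := slope_cosE u.
  rewrite -/m /k.
  pose C := kap * slope_cos u.
  rewrite -[2 * r * rho * _]/C.
  have C2 : C ^+ 2 = kap ^+ 2 / (1 + u ^+ 2) by rewrite /C exprMn c2.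
  have p1 := kp (m - C); have p2 := kp (m + C).
  rewrite QE.
  have -> : (E * (1 + u ^+ 2)) ^+ 2 + 2 * (b - m ^+ 2) * kap ^+ 2 * (1 + u ^+ 2) + kap ^+ 4 =
      (1 + u ^+ 2) ^+ 2 * ((b + (m - C) ^+ 2) * (b + (m + C) ^+ 2)).
    rewrite (_ : (b + _) * _ = (b + m ^+ 2) ^+ 2 + 2 * (b - m ^+ 2) * C ^+ 2 + (C ^+ 2) ^+ 2);
      last by ring.
    by rewrite C2 -/E; field; rewrite gt_eqF.
  have -> : 2 * (E * u ^+ 2 + (E + kap ^+ 2)) = 2 * (1 + u ^+ 2) * (b + m ^+ 2 + C ^+ 2).
    by rewrite C2 /E; field; rewrite gt_eqF.
  by field; rewrite !gt_eqF.
rewrite ge0_integralZl_EFin//=; last 3 first.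
- move=> u _; rewrite lee_fin divr_ge0 ?(ltW (Qpos u))//.
  by rewrite mulr_ge0// addr_ge0// mulr_ge0 ?sqr_ge0// ltW.
- exact/measurable_EFinP.
- by rewrite mulr_ge0 ?F0 ?(ltW r0).
rewrite main -EFinM; congr EFin.
(* The angular integral contains (W + D) / tau with D = E + kap^2. Comparing squares identifies this
   with [kappaRe / sqrt b], which is how the real part of the complex square root appears. *)
have key : Num.sqrt b * (W + (E + kap ^+ 2)) = kappaRe b rho r * tau.
  apply: (@pexpIrn _ 2) => //; rewrite ?nnegrE ?mulr_ge0 ?sqrtr_ge0 ?(addr_ge0 (ltW W0) D0)//.
  have kr2 : kappaRe b rho r ^+ 2 = (W + (b - (r ^+ 2 - rho ^+ 2) ^+ 2)) / 2.
    exact: (sqr_sqrtr (ltW (kappaRe_rad_gt0 rho b0 r))).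
  rewrite exprMn [RHS]exprMn kr2 (sqr_sqrtr (ltW b0)) (sqr_sqrtr (ltW t2)).
  rewrite [LHS](_ : _ = b * (W ^+ 2 + 2 * W * (E + kap ^+ 2) + (E + kap ^+ 2) ^+ 2)); last by ring.
  rewrite [RHS](_ : _ = E * W ^+ 2 + (a + E * (b - (r ^+ 2 - rho ^+ 2) ^+ 2)) * W
     + a * (b - (r ^+ 2 - rho ^+ 2) ^+ 2)); last by field.
  by rewrite W2 /a /E /kap /m; ring.
have sb : Num.sqrt b != 0 by rewrite gt_eqF// sqrtr_gt0.
have -> : W + (E + kap ^+ 2) = kappaRe b rho r * tau / Num.sqrt b.
  by rewrite -key mulrAC divff// mul1r.
rewrite /density4 -/W; field.
by rewrite sb !gt_eqF.
Qed.

End densities.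

(** * Integration by parts on a half-line and the closed forms *)

Section improper_parts.
Context {R : realType}.
Local Notation mu := (@lebesgue_measure R).

(** The limit in a real variable is tested along sequences, where dominated convergence applies with
    dominating function |h|. *)
Lemma cvgy_integral_itv0c (h : R -> \bar R) :
  mu.-integrable `[0, +oo[ h ->
  (\int[mu]_(x in `[0%R, t]) h x)%E @[t --> +oo%R] -->
  (\int[mu]_(x in `[0%R, +oo[) h x)%E.
Proof.
move=> ih; apply/cvge_pinftyP => u uy.
have mh := measurable_int _ ih.
have uE n : (\int[mu]_(x in `[0%R, u n]) h x = \int[mu]_(x in `[0%R, +oo[) (h \_ `[0%R, u n]) x)%E.
  rewrite -integral_mkcondr; congr (integral _ _ _).
  by rewrite setIC; apply/esym/setIidPl; exact: subset_itvl.
under eq_fun do rewrite uE.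
have [] := @dominated_convergence _ _ _ mu `[0%R, +oo[%classic (measurable_itv _)
  (fun n => h \_ `[0%R, u n]) h (fun x => `|h x|%E) => //.
- move=> n; apply/measurable_restrict => //.
  by apply: measurable_funS mh => //; exact: subIsetl.
- apply: aeW => x /=; rewrite in_itv/= andbT => x0.
  apply: (cvg_near_cst (h x)).
  have : \forall n \near \oo, x <= u n by exact: (cvgryPge u).1.
  apply: filterS => n xn; rewrite patchE ifT//.
  by rewrite inE/= in_itv/= x0.
- exact: integrable_abse.
- apply: aeW => x n _ /=; rewrite patchE; case: ifPn => // _.
  by rewrite abse0.
Qed.

Variables (F f Gam psi : R -> R).
Hypothesis dF : forall r : R, 0 < r -> is_derive r 1 F (f r).
Hypothesis F0r : F r @[r --> 0^'+] --> F 0.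
Hypothesis cf : {within `[0, +oo[, continuous f}.
Hypothesis dG : forall r : R, 0 < r -> is_derive r 1 Gam (psi r).
Hypothesis G0r : Gam r @[r --> 0^'+] --> Gam 0.
Hypothesis cpsi : {within `[0, +oo[, continuous psi}.
Hypothesis ge0 : forall r, 0 <= r -> 0 <= F r * psi r.
Hypothesis ifG : mu.-integrable `[0, +oo[ (fun r => (f r * Gam r)%:E).

Lemma integration_by_parts_0c t : 0 < t ->
  (\int[mu]_(r in `[0%R, t]) (F r * psi r)%:E =
   (F t * Gam t - F 0%R * Gam 0%R)%:E - \int[mu]_(r in `[0%R, t]) (f r * Gam r)%:E)%E.
Proof.
move=> t0.
have sub : [set` `[0, t]] `<=` [set` `[(0:R), +oo[] by apply: subset_itvl.
apply: integration_by_parts => //.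
- exact: continuous_subspaceW cf.
- split => //.
  + by move=> x; rewrite in_itv/= => /andP[/dF[]].
  + by apply: cvg_at_left_filter; exact: is_derive_cvg (dF t0).
- by move=> x; rewrite in_itv/= derive1E => /andP[/dF[_]].
- exact: continuous_subspaceW cpsi.
- split => //.
  + by move=> x; rewrite in_itv/= => /andP[/dG[]].
  + by apply: cvg_at_left_filter; exact: is_derive_cvg (dG t0).
- by move=> x; rewrite in_itv/= derive1E => /andP[/dG[_]].
Qed.

(** The boundary term is assumed bounded above near infinity, not convergent. Since [F * psi] is
    nonnegative, the bound makes its integral finite; once both integrals converge, so does the
    boundary term, and its limit is forced. *)
Lemma improper_integration_by_parts (M : R) :
  (\forall t \near +oo, F t * Gam t <= M) ->
  exists2 J : R, (\int[mu]_(r in `[0%R, +oo[) (F r * psi r)%:E = J%:E)%E &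
    F t * Gam t @[t --> +oo] -->
    F 0 * Gam 0 + J + fine (\int[mu]_(r in `[0%R, +oo[) (f r * Gam r)%:E).
Proof.
move=> FM.
set I := (\int[mu]_(r in `[0%R, +oo[) (f r * Gam r)%:E)%E.
have Ifin : I \is a fin_num by exact: integrable_fin_num.
have cI := cvgy_integral_itv0c ifG.
have cF : {within `[0, +oo[, continuous F}.
  apply/continuous_within_itvcyP; split => // r; rewrite in_itv/= andbT => /dF.
  exact: is_derive_cvg.
have mFpsi : measurable_fun [set` `[(0:R), +oo[] (fun r : R => F r * psi r).
  apply: measurable_funM; apply: subspace_continuous_measurable_fun => //.
have FpsiE n : (0 < n)%N -> (\int[mu]_(r in `[0%R, n%:R]) (F r * psi r)%:E =
   (F n%:R * Gam n%:R - F 0%R * Gam 0%R)%:E -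
   \int[mu]_(r in `[0%R, n%:R]) (f r * Gam r)%:E)%E.
  by move=> n0; apply: integration_by_parts_0c; rewrite ltr0n.
have c1 : (\int[mu]_(r in `[0%R, n%:R]) (F r * psi r)%:E)%E @[n --> \oo] -->
    (\int[mu]_(r in `[0%R, +oo[) (F r * psi r)%:E)%E.
  rewrite itv_bndy_bigcup_BRight.
  under eq_fun do rewrite -[X in `[_, X]]add0r.
  apply: ge0_nondecreasing_set_cvg_integral => //.
  - move=> m n mn; apply/subsetPset; apply: subset_itvl.
    by rewrite bnd_simp !add0r ler_nat.
  - move=> n; apply/measurable_EFinP; apply: measurable_funS mFpsi => //.
    exact: subset_itvl.
  - by move=> n x /=; rewrite in_itv/= lee_fin => /andP[/ge0].
have iabs := integrable_abse ifG.
(* Up to n the integral is the boundary term minus an integral of [f * Gam], hence at most M - F 0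
   Gam 0 plus the L1 norm of [f * Gam]. *)
have bnd : (\int[mu]_(r in `[0%R, +oo[) (F r * psi r)%:E <=
    (M - F 0%R * Gam 0%R)%:E + \int[mu]_(r in `[0%R, +oo[) `|(f r * Gam r)%:E|)%E.
  rewrite -(cvg_lim _ c1)//; apply: lime_le; first by apply/cvg_ex; eexists; exact: c1.
  have Mn : \forall n \near \oo, F n%:R * Gam n%:R <= M.
    exact: (cvgr_idn FM).
  near=> n.
  rewrite FpsiE; last by near: n; exact: nbhs_infty_gt.
  apply: leeD; first by rewrite lee_fin lerD2r; near: n.
  apply: (@le_trans _ _ (\int[mu]_(r in `[0%R, n%:R]) `|(f r * Gam r)%:E|)%E).
    rewrite (le_trans (lee_abs _))// abseN le_abse_integral//.
    by apply: measurable_funS (measurable_int _ ifG) => //; exact: subset_itvl.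
  apply: ge0_subset_integral => //; last exact: subset_itvl.
  exact: (measurable_int _ iabs).
have intFpsi : mu.-integrable `[0, +oo[ (fun r => (F r * psi r)%:E).
  apply/integrableP; split; first exact/measurable_EFinP.
  apply: le_lt_trans (_ : _ <= \int[mu]_(r in `[0%R, +oo[) (F r * psi r)%:E)%E _.
    apply: ge0_le_integral => //.
    - exact/measurableT_comp/measurable_EFinP.
    - exact/measurable_EFinP.
    - by move=> r /=; rewrite in_itv/= andbT => /ge0 ?; rewrite ger0_norm.
  apply: le_lt_trans bnd _; rewrite lte_add_pinfty ?ltry//.
  by case/integrableP : ifG.
have J1 : (\int[mu]_(r in `[0%R, +oo[) (F r * psi r)%:E)%E \is a fin_num.
  exact: integrable_fin_num.
exists (fine (\int[mu]_(r in `[0%R, +oo[) (F r * psi r)%:E)); first by rewrite fineK.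
have c2 : fine (\int[mu]_(r in `[0%R, t]) (F r * psi r)%:E)%E @[t --> +oo%R] -->
    fine (\int[mu]_(r in `[0%R, +oo[) (F r * psi r)%:E)%E.
  by apply: fine_cvg; rewrite fineK//; exact: cvgy_integral_itv0c.
have c3 : fine (\int[mu]_(r in `[0%R, t]) (f r * Gam r)%:E)%E @[t --> +oo%R] --> fine I.
  by apply: fine_cvg; rewrite fineK//; exact: cvgy_integral_itv0c.
apply: cvg_trans (cvgD (cvgD (cvg_cst (F 0 * Gam 0)) c2) c3).
apply: near_eq_cvg; near=> t.
have t0 : 0 < t by [].
have f1 : (\int[mu]_(r in `[0%R, t]) (f r * Gam r)%:E)%E \is a fin_num.
  apply: integrable_fin_num => //; apply: integrableS ifG => //.
  exact: subset_itvl.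
change (F 0 * Gam 0 + fine (\int[mu]_(r in `[0%R, t]) (F r * psi r)%:E)%E +
  fine (\int[mu]_(r in `[0%R, t]) (f r * Gam r)%:E)%E = F t * Gam t).
rewrite integration_by_parts_0c//= fineB//=.
by rewrite -addrA subrK addrC subrK.
Unshelve. all: by end_near. Qed.

End improper_parts.

(** Continuity is read off differentiability: some derivative is computed and then forgotten. *)
Ltac deriv_cvg := simple notypeclasses refine (is_derive_cvg _); shelve_unifiable;
  repeat deriv_step.

(** * Derivative and growth of arcsinh *)

Section arcsinh.
Context {R : realType}.
Implicit Types x : R.

Lemma sqrt_sqrDl1_gt x : `|x| < Num.sqrt (x ^+ 2 + 1).
Proof. by rewrite -sqrtr_sqr ltr_sqrt ?ltr_pwDr ?sqr_ge0// ltrDl. Qed.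

Lemma sqrt_sqrDl1_le x : Num.sqrt (x ^+ 2 + 1) <= 1 + `|x|.
Proof.
rewrite -[leRHS]ger0_norm ?addr_ge0// -sqrtr_sqr ler_sqrt ?sqr_ge0//.
by rewrite sqrrD real_normK ?num_real// expr1n addrC lerD2r mul1r lerDl mulrn_wge0.
Qed.

Lemma arcsinh_arg_gt0 x : 0 < x + Num.sqrt (x ^+ 2 + 1).
Proof. by have := sqrt_sqrDl1_gt x; rewrite ltr_norml => /andP[? ?]; lra. Qed.

Lemma is_derive_arcsinhf (f : R -> R) x (df : R) : is_derive x 1 f df ->
  is_derive x 1 (fun y => arcsinh (f y)) (df / Num.sqrt (f x ^+ 2 + 1)).
Proof.
move=> hf; rewrite /arcsinh.
have s0 : 0 < Num.sqrt (f x ^+ 2 + 1) by rewrite sqrtr_gt0 ltr_pwDr ?sqr_ge0.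
have a0 := arcsinh_arg_gt0 (f x).
deriv; first by rewrite -sqrtr_gt0.
by field; rewrite !gt_eqF.
Qed.

Lemma arcsinh_le0 x : x <= 0 -> arcsinh x <= 0.
Proof.
move=> x0; apply: ln_le0.
by have := sqrt_sqrDl1_le x; rewrite ler0_norm//; lra.
Qed.

(** Growth at minus infinity is logarithmic: the inverse of x + sqrt(x^2 + 1) is its conjugate
    sqrt(x^2 + 1) - x. *)
Lemma arcsinhN_le x : x <= 0 -> - arcsinh x <= ln (1 + 2 * `|x|).
Proof.
move=> x0; have a0 := arcsinh_arg_gt0 x.
have p0 : 0 < 1 + 2 * `|x| by rewrite ltr_pwDl ?mulr_ge0.
have -> : - arcsinh x = ln (x + Num.sqrt (x ^+ 2 + 1))^-1 by rewrite lnV ?posrE.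
rewrite ler_ln ?posrE ?invr_gt0//.
have s2 : Num.sqrt (x ^+ 2 + 1) ^+ 2 = x ^+ 2 + 1.
  by rewrite sqr_sqrtr// addr_ge0 ?sqr_ge0.
have -> : (x + Num.sqrt (x ^+ 2 + 1))^-1 = Num.sqrt (x ^+ 2 + 1) - x.
  apply: (mulfI (lt0r_neq0 a0)); rewrite divff ?(lt0r_neq0 a0)//.
  by transitivity (Num.sqrt (x ^+ 2 + 1) ^+ 2 - x ^+ 2); [rewrite s2; ring|ring].
by have := sqrt_sqrDl1_le x; rewrite ler0_norm//; lra.
Qed.

Lemma cvgy_ln : ln x @[x --> +oo] --> (+oo : set_system R).
Proof.
apply/cvgryPge => A; near=> x.
rewrite -(expRK A) ler_ln ?posrE ?expR_gt0//.
Unshelve. all: by end_near. Qed.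

(** With t = nu ln x, the power is exp(t/2)^2, hence at least (t/2)^2: quadratic in ln x against an
    affine numerator. *)
Lemma cvg_ln_powR0 (c nu : R) : 0 < nu ->
  (c + 2 * ln x) / x `^ nu @[x --> +oo] --> (0 : R).
Proof.
move=> nu0.
(* The numerator is at most 3 ln x as soon as |c| <= ln x, and the denominator is at least (nu ln
   x)^2 / 4, whence 12 = 3 * 4. *)
have c3 : 12 / nu ^+ 2 * (ln x)^-1 @[x --> +oo] --> (0 : R).
  rewrite -(mulr0 (12 / nu ^+ 2)); apply: cvgM; first exact: cvg_cst.
  apply/gtr0_cvgV0; last exact: cvgy_ln.
  exact: (cvgryPgt _).1 cvgy_ln 0.
apply: (@squeeze_cvgr _ _ _ _ (fun x => - (12 / nu ^+ 2 * (ln x)^-1))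
  (fun x => 12 / nu ^+ 2 * (ln x)^-1)) => //; last first.
  by rewrite -oppr0; exact: cvgN.
near=> x.
have x0 : 0 < x by [].
have s0 : 0 < ln x by near: x; exact: (cvgryPgt _).1 cvgy_ln 0.
have sc : `|c| <= ln x by near: x; exact: (cvgryPge _).1 cvgy_ln `|c|.
have p0 : 0 < x `^ nu by rewrite powR_gt0.
rewrite -ler_norml normrM normfV (gtr0_norm p0).
rewrite ler_pdivrMr//.
have pE : (nu * ln x) ^+ 2 / 4 <= x `^ nu.
  rewrite /powR gt_eqF//.
  have -> : nu * ln x = nu * ln x / 2 + nu * ln x / 2 by field.
  rewrite expRD -expr2.
  have h : nu * ln x / 2 <= expR (nu * ln x / 2).
    by apply: le_trans (expR_ge1Dx _); rewrite lerDr.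
  apply: le_trans (_ : (nu * ln x / 2) ^+ 2 <= _).
    by rewrite le_eqVlt; apply/orP; left; apply/eqP; field.
  have h0 : 0 <= nu * ln x / 2 by rewrite divr_ge0// mulr_ge0// ltW.
  by rewrite lerXn2r ?nnegrE ?expR_ge0.
apply: (@le_trans _ _ (3 * ln x)).
  apply: le_trans (ler_normD _ _) _.
  by rewrite normrM (gtr0_norm s0) ger0_norm//; lra.
apply: le_trans (_ : 12 / nu ^+ 2 * (ln x)^-1 * ((nu * ln x) ^+ 2 / 4) <= _).
  rewrite le_eqVlt; apply/orP; left; apply/eqP; field.
  by rewrite !gt_eqF.
rewrite ler_wpM2l// mulr_ge0//; first by rewrite divr_ge0// sqr_ge0.
by rewrite invr_ge0 ltW.
Unshelve. all: by end_near. Qed.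

End arcsinh.

(** * Closed form for alpha = 2 *)

Section closed_forms.
Context {R : realType}.
Local Notation mu := (@lebesgue_measure R).
Variables (F f : R -> R) (rho b : R).
Hypothesis FP : F_standing F f.
Hypothesis rho0 : 0 < rho.
Hypothesis b0 : 0 < b.

Lemma F_standing_cvg0 : F r @[r --> 0^'+] --> F 0.
Proof.
case: FP => _ [_ [_ [dq _]]].
have : F 0 + h * ((F h - F 0) / h) @[h --> 0^'+] --> F 0 + 0 * f 0.
  apply: cvgD; first exact: cvg_cst.
  by apply: cvgM => //; apply: cvg_at_right_filter; exact: cvg_id.
rewrite mul0r addr0; apply: cvg_trans; apply: near_eq_cvg; near=> h.
have h0 : h != 0 by rewrite gt_eqF.
by rewrite mulrCA divff// mulr1 addrC subrK.
Unshelve. all: by end_near. Qed.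

(** Nothing is known of [F] on the negative reals, so measurability on the whole line is stated for
    [F] composed with the absolute value. *)
Lemma F_standing_measurable : measurable_fun setT (fun r : R => F `|r|).
Proof.
case: FP => _ [_ [dF _]].
have cF : {within `[0, +oo[, continuous F}.
  apply/continuous_within_itvcyP; split; last exact: F_standing_cvg0.
  by move=> r; rewrite in_itv/= andbT => /dF; exact: is_derive_cvg.
have mF := subspace_continuous_measurable_fun (measurable_itv _) cF.
have mG : measurable_fun setT (F \_ [set` `[(0:R), +oo[]).
  exact/(measurable_restrictT _ _).1.
rewrite (_ : (fun r => F `|r|) = (F \_ [set` `[(0:R), +oo[]) \o (fun r : R => `|r|)).
  by apply: measurableT_comp.
by apply/funext => r /=; rewrite patchE ifT// inE/= in_itv/= andbT.
Qed.

Let x2 (r : R) := (rho ^+ 2 - r ^+ 2 - b) / (2 * rho * Num.sqrt b).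

Lemma arcsinh_density2 (r : R) : is_derive r 1 (fun r => - pi * arcsinh (x2 r)) (density2 b rho r).
Proof.
have sb : 0 < Num.sqrt b by rewrite sqrtr_gt0.
have d0 : 0 < 2 * rho * Num.sqrt b by rewrite !mulr_gt0.
have rad : 0 < (b + r ^+ 2 + rho ^+ 2) ^+ 2 - 4 * r ^+ 2 * rho ^+ 2.
  rewrite (_ : _ - _ = (b + (r - rho) ^+ 2) * (b + (r + rho) ^+ 2)); last by ring.
  by rewrite mulr_gt0// ltr_wpDr// sqr_ge0.
have dx : is_derive r 1 x2 (- (2 * r) / (2 * rho * Num.sqrt b)).
  by rewrite /x2; deriv; field; rewrite !gt_eqF.
(* (rho^2 - r^2 - b)^2 + 4 rho^2 b is exactly the radicand of [density2]. *)
have sE : Num.sqrt (x2 r ^+ 2 + 1) =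
    Num.sqrt ((b + r ^+ 2 + rho ^+ 2) ^+ 2 - 4 * r ^+ 2 * rho ^+ 2) / (2 * rho * Num.sqrt b).
  rewrite -[X in _ / X](ger0_norm (ltW d0)) -(sqrtr_sqr (2 * rho * Num.sqrt b)).
  rewrite -sqrtrV ?sqr_ge0// -sqrtrM ?(ltW rad)//; congr Num.sqrt.
  have sb2 : Num.sqrt b ^+ 2 = b by rewrite sqr_sqrtr// ltW.
  rewrite /x2 expr_div_n; rewrite (_ : (2 * rho * Num.sqrt b) ^+ 2 = 4 * rho ^+ 2 * b).
    by field; rewrite !gt_eqF.
  by rewrite !exprMn sb2; ring.
have := is_derive_arcsinhf dx; rewrite sE => da.
have s0 : 0 < Num.sqrt ((b + r ^+ 2 + rho ^+ 2) ^+ 2 - 4 * r ^+ 2 * rho ^+ 2).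
  by rewrite sqrtr_gt0.
by deriv; rewrite /density2; field; rewrite !gt_eqF.
Qed.

Lemma density2_continuous : continuous (density2 b rho).
Proof.
move=> r; rewrite /density2.
have rad : 0 < (b + r ^+ 2 + rho ^+ 2) ^+ 2 - 4 * r ^+ 2 * rho ^+ 2.
  rewrite (_ : _ - _ = (b + (r - rho) ^+ 2) * (b + (r + rho) ^+ 2)); last by ring.
  by rewrite mulr_gt0// ltr_wpDr// sqr_ge0.
have s0 : 0 < Num.sqrt ((b + r ^+ 2 + rho ^+ 2) ^+ 2 - 4 * r ^+ 2 * rho ^+ 2).
  by rewrite sqrtr_gt0.
by deriv_cvg; rewrite ?gt_eqF.
Qed.

Lemma density2_ge0 r : 0 <= r -> 0 <= density2 b rho r.
Proof. by move=> r0; rewrite divr_ge0 ?sqrtr_ge0// !mulr_ge0// pi_ge0. Qed.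

Hypothesis h2 : hyp_A2 F f rho b.

(** The power decay of [F] beats the logarithmic growth of arcsinh. Beyond r = rho the argument
    [x2 r] is negative, so the expression is nonnegative and is squeezed from above only. *)
Lemma cvg_F_arcsinh : F r * (- pi * arcsinh (x2 r)) @[r --> +oo] --> (0 : R).
Proof.
have [[nu [nu0 [M FM]]] _] := h2.
have [F01 _] := FP.
have sb : 0 < Num.sqrt b by rewrite sqrtr_gt0.
have d0 : 0 < 2 * rho * Num.sqrt b by rewrite !mulr_gt0.
(* For r >= 1 this constant satisfies 1 + 2 |x2 r| <= K r^2. *)
pose K := 1 + 2 * ((rho ^+ 2 + 1 + b) / (2 * rho * Num.sqrt b)).
have q0 : 0 <= (rho ^+ 2 + 1 + b) / (2 * rho * Num.sqrt b).
  by rewrite divr_ge0 ?(ltW d0)// !addr_ge0 ?sqr_ge0// ltW.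
have K1 : 1 <= K by rewrite /K lerDl mulr_ge0.
apply: (@squeeze_cvgr _ _ _ _ (cst 0) (fun r => pi * M * ((ln K + 2 * ln r) / r `^ nu))).
- near=> r.
  have r1 : 1 <= r by near: r; exact: nbhs_pinfty_ge.
  have r0 : 0 < r by rewrite (lt_le_trans _ r1).
  have rr : rho <= r by near: r; exact: nbhs_pinfty_ge (num_real _).
  have FMr : F r * r `^ nu <= M by near: r.
  have [Fr0 _] := andP (F01 _ (ltW r0)).
  have r21 : 1 <= r ^+ 2 by rewrite expr_ge1// ltW.
  have rr2 : rho ^+ 2 <= r ^+ 2 by rewrite lerXn2r ?nnegrE// ltW.
  have xle0 : x2 r <= 0.
    by apply: mulr_le0_ge0; [move: rr2 b0; lra|rewrite invr_ge0 ltW].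
  have xb : `|x2 r| <= (rho ^+ 2 + 1 + b) / (2 * rho * Num.sqrt b) * r ^+ 2.
    rewrite ler0_norm// /x2 -mulNr [leRHS]mulrAC ler_pM2r ?invr_gt0//.
    have := sqr_ge0 rho; have : 0 <= b * (r ^+ 2 - 1) by rewrite mulr_ge0 ?subr_ge0// ltW.
    have : 0 <= rho ^+ 2 * (r ^+ 2 - 1) by rewrite mulr_ge0 ?subr_ge0// sqr_ge0.
    by lra.
  have a0 := arcsinh_le0 xle0.
  have a1 : - arcsinh (x2 r) <= ln K + 2 * ln r.
    apply: le_trans (arcsinhN_le xle0) _.
    have -> : 2 * ln r = ln (r ^+ 2) by rewrite lnXn// mulr_natl.
    rewrite -lnM ?posrE ?exprn_gt0 ?(lt_le_trans _ K1)//.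
    rewrite ler_ln ?posrE ?ltr_pwDl ?mulr_ge0 ?mulr_gt0 ?exprn_gt0 ?(lt_le_trans _ K1)//.
    by rewrite /K mulrDl mul1r; lra.
  have p0 : 0 < r `^ nu by rewrite powR_gt0.
  apply/andP; split.
    by rewrite mulr_ge0// mulNr -mulrN mulr_ge0 ?pi_ge0// oppr_ge0.
  have -> : F r * (- pi * arcsinh (x2 r)) =
      pi * (F r * r `^ nu) * (- arcsinh (x2 r) / r `^ nu).
    by field; rewrite gt_eqF.
  apply: ler_pM; rewrite ?mulr_ge0 ?invr_ge0 ?pi_ge0 ?oppr_ge0 ?(ltW p0)//.
    by rewrite ler_wpM2l ?pi_ge0.
  by rewrite ler_pM2r ?invr_gt0.
- exact: cvg_cst.
- rewrite -(mulr0 (pi * M)); apply: cvgM; first exact: cvg_cst.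
  exact: cvg_ln_powR0.
Unshelve. all: by end_near. Qed.

Lemma integral_density2 :
  (\int[mu]_(r in `[0%R, +oo[) (F r * density2 b rho r)%:E = (A2 F f rho b)%:E)%E.
Proof.
have [F01 [_ [dF [_ cf]]]] := FP; have [_ ih] := h2.
have i2 : mu.-integrable `[0, +oo[ (fun r => (f r * (- pi * arcsinh (x2 r)))%:E).
  have -> : (fun r => (f r * (- pi * arcsinh (x2 r)))%:E) =
      (fun r => (- pi)%:E * (f r * arcsinh (x2 r))%:E)%E.
    by apply/funext => r; rewrite -EFinM mulrCA.
  exact: integrableZl.
have FL := cvg_F_arcsinh.
(* Any positive bound would do, the boundary term tending to 0. *)
have ub : \forall r \near +oo, F r * (- pi * arcsinh (x2 r)) <= 1.
  near=> r; apply: ltW; near: r.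
  by apply: (cvgr_lt _ FL); exact: ltr01.
have [J -> JL] := improper_integration_by_parts dF F_standing_cvg0 cf
  (fun r _ => arcsinh_density2 r)
  (cvg_at_right_filter (is_derive_cvg (arcsinh_density2 0)))
  (continuous_subspaceT density2_continuous)
  (fun r r0 => mulr_ge0 (proj1 (andP (F01 r r0))) (density2_ge0 r0)) i2 ub.
have E0 : 0 = F 0 * (- pi * arcsinh (x2 0)) + J +
    fine (\int[mu]_(r in `[0%R, +oo[) (f r * (- pi * arcsinh (x2 r)))%:E)%E.
  exact: cvg_unique FL JL.
congr EFin.
have IE : fine (\int[mu]_(r in `[0%R, +oo[) (f r * (- pi * arcsinh (x2 r)))%:E)%E =
  - pi * fine (\int[mu]_(r in `[0%R, +oo[) (f r * arcsinh (x2 r))%:E)%E.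
  rewrite -[RHS]/(fine (- pi)%:E * _) -fineM//; last first.
    exact: integrable_fin_num.
  congr fine; rewrite -integralZl//=.
  by apply: eq_integral => r _; rewrite -EFinM mulrCA.
rewrite /A2; rewrite IE in E0.
have x20 : x2 0 = (rho ^+ 2 - b) / (2 * rho * Num.sqrt b).
  by rewrite /x2 expr0n/= subr0.
rewrite -x20 mulrDr.
rewrite -[X in fine X]/(\int[mu]_(r in `[0%R, +oo[) (f r * arcsinh (x2 r))%:E)%E.
move: E0; set I := fine _ => E0.
by move: E0; lra.
Unshelve. all: by end_near. Qed.

End closed_forms.

(** * Closed form for alpha = 4 *)

Section closed_form4.
Context {R : realType}.
Local Notation mu := (@lebesgue_measure R).
Variables (F f : R -> R) (rho b : R).
Hypothesis rho0 : 0 < rho.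
Hypothesis b0 : 0 < b.

Definition kappaIm (b rho r : R) : R :=
  Num.sqrt ((kappaW b rho r - (b - (r ^+ 2 - rho ^+ 2) ^+ 2)) / 2).

Local Notation W := (kappaW b rho).
Local Notation q := (kappaRe b rho).
Local Notation p := (kappaIm b rho).
Local Notation beta := (Num.sqrt b).
Let n (r : R) := r ^+ 2 - rho ^+ 2.
(** With q + j p the square root in [kappa], whose squared modulus is W, one has Re kappa = Y / W
    and 1 - |kappa|^2 = V / W. Hence Theta is the arctangent of 2 Y / V. *)
Let Y r := n r * q r - beta * p r.
Let V r := W r - (n r ^+ 2 + b).

Let beta0 : 0 < beta. Proof. by rewrite sqrtr_gt0. Qed.
Let beta2 : beta ^+ 2 = b. Proof. by rewrite sqr_sqrtr// ltW. Qed.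
Let W0 r : 0 < W r. Proof. exact: kappaW_gt0. Qed.
Let W2 r : W r ^+ 2 = (n r ^+ 2 + b) ^+ 2 + 16 * b * r ^+ 2 * rho ^+ 2.
Proof. exact: kappaW_sqr. Qed.

Let q_rad r : 0 < (W r + (b - n r ^+ 2)) / 2.
Proof. exact: kappaRe_rad_gt0. Qed.

Let p_rad r : 0 < (W r - (b - n r ^+ 2)) / 2.
Proof.
have m0 : 0 < b * (r ^+ 2 + rho ^+ 2) ^+ 2.
  by rewrite mulr_gt0// exprn_gt0// ltr_wpDl ?sqr_ge0 ?exprn_gt0.
rewrite -(pmulr_lgt0 _ (q_rad r)).
rewrite [ltRHS](_ : _ = (W r ^+ 2 - (b - n r ^+ 2) ^+ 2) / 4); last by field.
by rewrite W2 (_ : _ / 4 = b * (r ^+ 2 + rho ^+ 2) ^+ 2)// /n; field.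
Qed.

Let q0 r : 0 < q r. Proof. by rewrite sqrtr_gt0; exact: q_rad. Qed.
Let p0 r : 0 < p r. Proof. by rewrite sqrtr_gt0; exact: p_rad. Qed.
Let q2 r : q r ^+ 2 = (W r + (b - n r ^+ 2)) / 2.
Proof. exact: (sqr_sqrtr (ltW (q_rad r))). Qed.
Let p2 r : p r ^+ 2 = (W r - (b - n r ^+ 2)) / 2.
Proof. exact: (sqr_sqrtr (ltW (p_rad r))). Qed.
(** Twice this is the imaginary part of the number under the square root. *)
Let pq r : p r * q r = beta * (r ^+ 2 + rho ^+ 2).
Proof.
have m0 : 0 <= beta * (r ^+ 2 + rho ^+ 2) by rewrite mulr_ge0 ?addr_ge0 ?sqr_ge0 ?ltW.
apply: (@pexpIrn _ 2) => //; rewrite ?nnegrE// ?(ltW (mulr_gt0 (p0 r) (q0 r)))//.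
rewrite exprMn p2 q2 exprMn beta2.
rewrite [LHS](_ : _ = (W r ^+ 2 - (b - n r ^+ 2) ^+ 2) / 4); last by field.
by rewrite W2 /n; field.
Qed.

(** W^2 exceeds (n^2 + b)^2 by 16 b r^2 rho^2, which vanishes at r = 0: there V is 0 and the
    quotient 2 Y / V is singular. *)
Let V0 r : 0 < r -> 0 < V r.
Proof.
move=> r0; rewrite subr_gt0.
have M0 : 0 <= n r ^+ 2 + b by rewrite addr_ge0 ?sqr_ge0// ltW.
rewrite -(@ltr_pXn2r _ 2) ?nnegrE ?(ltW (W0 r))// W2 ltrDl.
by rewrite !mulr_gt0 ?exprn_gt0.
Qed.

Lemma ThetaE r : 0 < r -> Theta b rho r = atan (2 * Y r / V r).
Proof.
move=> r0; rewrite /Theta; congr atan.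
have W1 : W r != 0 by rewrite gt_eqF.
have V1 : V r != 0 by rewrite gt_eqF// V0.
(* Real and imaginary parts of the number under the square root; the imaginary part is positive,
   which selects the sign in [csqrt]. *)
pose w1 := b - n r ^+ 2; pose w2 := 2 * beta * (r ^+ 2 + rho ^+ 2).
have w20 : 0 < w2 by rewrite !mulr_gt0// ltr_wpDl ?sqr_ge0 ?exprn_gt0.
have cs : csqrt (w1, w2) = (q r, p r).
  rewrite /csqrt/= (_ : Num.sqrt (cnorm2 (w1, w2)) = W r).
    by rewrite gt_eqF// gtr0_sg// mul1r.
  rewrite /cnorm2/= -[RHS]ger0_norm ?(ltW (W0 r))// -sqrtr_sqr W2; congr Num.sqrt.
  rewrite /w1 /w2 !exprMn beta2 /n; ring.
pose u := (beta, r ^+ 2 + rho ^+ 2).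
have w1E : (cmul u u).1 + 4 * r ^+ 2 * rho ^+ 2 = w1.
  by rewrite /= /w1 -[in RHS]beta2 /n; ring.
have w2E : (cmul u u).2 = w2 by rewrite /= /w2; ring.
have kE : kappa r b rho = cdiv (n r, - beta) (q r, p r).
  by unfold kappa; cbv zeta; rewrite -/u w1E w2E cs.
rewrite kE /cdiv /cmul /cinv /cnorm2 /=.
have -> : q r ^+ 2 + p r ^+ 2 = W r by rewrite q2 p2; field.
have -> : 1 - ((n r * (q r / W r) - - beta * (- p r / W r)) ^+ 2 +
    (n r * (- p r / W r) + - beta * (q r / W r)) ^+ 2) = V r / W r.
  rewrite [X in 1 - X](_ : _ = (n r ^+ 2 + beta ^+ 2) * (q r ^+ 2 + p r ^+ 2) / W r ^+ 2);
    last by field.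
  have -> : q r ^+ 2 + p r ^+ 2 = W r by rewrite q2 p2; field.
  by rewrite beta2 /V; field.
rewrite /Y; field.
by rewrite W1 V1.
Qed.

Let dW (r : R) : is_derive r 1 W ((4 * (n r ^+ 2 + b) * n r * r + 16 * b * rho ^+ 2 * r) / W r).
Proof.
have rad : 0 < ((r ^+ 2 - rho ^+ 2) ^+ 2 + b) ^+ 2 + 16 * b * r ^+ 2 * rho ^+ 2.
  by rewrite -/(n r) -W2 exprn_gt0.
rewrite /kappaW; deriv; rewrite -/(kappaW b rho r) -/(n r).
by field; rewrite gt_eqF.
Qed.

(** The numerator of W' is put in the form that makes the derivatives of q, Y and V short. *)
Let WE r : 4 * (n r ^+ 2 + b) * n r * r + 16 * b * rho ^+ 2 * r =
  4 * n r * r * W r - 8 * r * q r * Y r.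
Proof.
rewrite (_ : 8 * r * q r * Y r = 8 * r * (n r * q r ^+ 2 - beta * (p r * q r))); last by rewrite /Y; ring.
rewrite q2 pq (_ : beta * (beta * _) = beta ^+ 2 * (r ^+ 2 + rho ^+ 2)); last by ring.
rewrite beta2 (_ : r ^+ 2 + rho ^+ 2 = n r + 2 * rho ^+ 2); last by rewrite /n; ring.
by field.
Qed.

Let dq (r : R) : is_derive r 1 q (- (2 * r * Y r) / W r).
Proof.
have dWr := dW r; rewrite WE in dWr.
have rad := q_rad r; rewrite /n in rad.
have W1 : W r != 0 by rewrite gt_eqF.
have q1 : q r != 0 by rewrite gt_eqF.
rewrite /kappaRe; deriv; rewrite -/(kappaRe b rho r) -/(n r).
by field; rewrite W1 q1.
Qed.

Let dp (r : R) : is_derive r 1 p (2 * r * (n r * p r + beta * q r) / W r).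
Proof.
have dWr := dW r.
have rad := p_rad r; rewrite /n in rad.
have W1 : W r != 0 by rewrite gt_eqF.
have p1 : p r != 0 by rewrite gt_eqF.
have WE' : 4 * (n r ^+ 2 + b) * n r * r + 16 * b * rho ^+ 2 * r =
  - 4 * n r * r * W r + 8 * r * p r * (n r * p r + beta * q r).
  rewrite (_ : 8 * r * p r * _ = 8 * r * (n r * p r ^+ 2 + beta * (p r * q r))); last by ring.
  rewrite p2 pq (_ : beta * (beta * _) = beta ^+ 2 * (r ^+ 2 + rho ^+ 2)); last by ring.
  rewrite beta2 (_ : r ^+ 2 + rho ^+ 2 = n r + 2 * rho ^+ 2); last by rewrite /n; ring.
  by field.
rewrite WE' in dWr.
rewrite /kappaIm; deriv; rewrite -/(kappaIm b rho r) -/(n r).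
by field; rewrite W1 p1.
Qed.

Let dY (r : R) : is_derive r 1 Y (2 * r * q r * V r / W r).
Proof.
have dqr := dq r; have dpr := dp r.
have W1 : W r != 0 by rewrite gt_eqF.
rewrite (_ : V r = W r - (n r ^+ 2 + beta ^+ 2)); last by rewrite beta2.
rewrite /Y /n; deriv; rewrite -/(n r) /Y.
by field; rewrite W1.
Qed.

Let dV (r : R) : is_derive r 1 V (- (8 * r * q r * Y r) / W r).
Proof.
have dWr := dW r; rewrite WE in dWr.
have W1 : W r != 0 by rewrite gt_eqF.
rewrite /V /n; deriv; rewrite -/(n r).
by field; rewrite W1.
Qed.

Let VY r : V r ^+ 2 + 4 * Y r ^+ 2 = 16 * b * rho ^+ 4.
Proof.
have -> : Y r ^+ 2 = n r ^+ 2 * q r ^+ 2 + beta ^+ 2 * p r ^+ 2 - 2 * n r * beta * (p r * q r).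
  by rewrite /Y; ring.
rewrite pq q2 p2 beta2 /V.
rewrite [LHS](_ : _ = W r ^+ 2 - (n r ^+ 2 + b) ^+ 2 + 8 * n r ^+ 2 * b -
  8 * n r * beta ^+ 2 * (r ^+ 2 + rho ^+ 2)); last by field.
rewrite W2 beta2 /n; ring.
Qed.

(** By [dY] and [dV] the point (2 Y, V) turns at angular speed 4 r q / W on the circle given by
    [VY], and the arctangent of 2 Y / V is its angle. *)
Let dTheta (r : R) : 0 < r -> is_derive r 1 (fun r => atan (2 * Y r / V r)) (4 * (r * q r / W r)).
Proof.
move=> r0; have dYr := dY r; have dVr := dV r.
have W1 : W r != 0 by rewrite gt_eqF.
have V1 : V r != 0 by rewrite gt_eqF// V0.
have c0 : 16 * b * rho ^+ 4 != 0 by rewrite gt_eqF// !mulr_gt0 ?exprn_gt0.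
deriv => //.
have -> : 1 + (2 * Y r / V r) ^+ 2 = 16 * b * rho ^+ 4 / V r ^+ 2.
  by rewrite -(VY r); field.
rewrite [LHS](_ : _ = (4 * (r * q r / W r)) * (V r ^+ 2 + 4 * Y r ^+ 2) / (16 * b * rho ^+ 4)).
  by rewrite VY mulfK.
by field; rewrite ?W1 ?V1 ?gt_eqF ?exprn_gt0.
Qed.

(** At 0 the denominator V vanishes from above while Y is negative, so the argument of the
    arctangent tends to minus infinity. *)
Lemma cvg_Theta0 : Theta b rho r @[r --> 0^'+] --> - (pi / 2).
Proof.
have M0 : n 0 ^+ 2 + b = rho ^+ 4 + b by rewrite /n; ring.
have W00 : W 0 = rho ^+ 4 + b.
  apply: (@pexpIrn _ 2) => //; rewrite ?nnegrE ?(ltW (W0 0))//.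
    by rewrite addr_ge0 ?exprn_ge0 ?ltW.
  by rewrite W2 M0; ring.
have V00 : V 0 = 0 by rewrite /V W00 M0 subrr.
have Y00 : Y 0 < 0.
  have n0 : n 0 < 0 by rewrite /n expr0n/= sub0r oppr_lt0 exprn_gt0.
  rewrite /Y subr_lt0 (@lt_trans _ _ 0)//; first by rewrite nmulr_rlt0.
  by rewrite mulr_gt0.
have cV : V r @[r --> 0^'+] --> 0.
  have : V r @[r --> 0^'+] --> V 0.
    by apply: cvg_at_right_filter; exact: is_derive_cvg (dV 0).
  by rewrite V00.
have cVi : (V r)^-1 @[r --> 0^'+] --> +oo.
  by apply/cvgrVy => //; near=> r; exact: V0.
have cYV : - (2 * Y r) * (V r)^-1 @[r --> 0^'+] --> +oo.
  have YN : \forall r \near 0^'+, - Y 0 <= - (2 * Y r).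
    have cY : - (2 * Y r) @[r --> 0^'+] --> - (2 * Y 0).
      apply: cvgN; apply: cvgM; first exact: cvg_cst.
      by apply: cvg_at_right_filter; exact: is_derive_cvg (dY 0).
    by near=> r; apply: ltW; near: r; apply: (cvgr_gt _ cY); lra.
  apply: (@ger_cvgy _ _ _ _ (fun r => - Y 0 * (V r)^-1)); last first.
    by apply: gt0_cvgMry => //; rewrite oppr_gt0.
  near=> r; rewrite ler_pM2r//; first by near: r.
  by rewrite invr_gt0 V0.
have : - atan (- (2 * Y r) * (V r)^-1) @[r --> 0^'+] --> - (pi / 2).
  by apply: cvgN; apply: (cvg_comp _ atan cYV); exact: cvgy_atan.
apply: cvg_trans; apply: near_eq_cvg; near=> r.
by rewrite ThetaE// -atanN mulNr opprK.
Unshelve. all: by end_near. Qed.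

(** At r = 0 the quotient in Theta has a zero denominator, and its conventional value breaks
    continuity. The one-sided limit is substituted there, and the factor makes the derivative equal
    to [density4]. *)
Definition Theta_primitive (b rho r : R) : R :=
  pi / (2 * Num.sqrt b) * (if r <= 0 then - (pi / 2) else Theta b rho r).

Local Notation Gam := (Theta_primitive b rho).

Lemma is_derive_Theta_primitive (r : R) : 0 < r -> is_derive r 1 Gam (density4 b rho r).
Proof.
move=> r0.
have dT := dTheta r0.
apply: (@near_eq_is_derive _ _ _ (fun r => pi / (2 * beta) * atan (2 * Y r / V r))).
- near=> s; have s0 : 0 < s by near: s; exact: lt_nbhsr.
  by rewrite /Theta_primitive leNgt s0/= ThetaE.
- deriv; rewrite /density4; field.
  by rewrite !gt_eqF.
Unshelve. all: by end_near. Qed.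

Lemma cvg_Theta_primitive0 : Gam r @[r --> 0^'+] --> Gam 0.
Proof.
rewrite /Theta_primitive lexx; apply: cvgM; first exact: cvg_cst.
apply: cvg_trans cvg_Theta0; apply: near_eq_cvg; near=> r.
by rewrite leNgt (_ : 0 < r).
Unshelve. all: by end_near. Qed.

Lemma density4_continuous : continuous (density4 b rho).
Proof.
move=> r; have dWr := dW r; have dqr := dq r.
have W1 : W r != 0 by rewrite gt_eqF.
by rewrite /density4; deriv_cvg.
Qed.

Lemma density4_ge0 r : 0 <= r -> 0 <= density4 b rho r.
Proof.
move=> r0; rewrite /density4 mulr_ge0//.
  by rewrite divr_ge0 ?sqrtr_ge0// mulr_ge0// pi_ge0.
by rewrite divr_ge0 ?(ltW (W0 r))// mulr_ge0// ltW.
Qed.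

Lemma Theta_primitive_bounded r : `|Gam r| <= pi / (2 * beta) * (pi / 2).
Proof.
have c0 : 0 <= pi / (2 * beta) by rewrite divr_ge0 ?pi_ge0// mulr_ge0// ltW.
have pi0 : 0 <= pi / 2 :> R by rewrite divr_ge0 ?pi_ge0.
rewrite normrM ger0_norm// ler_wpM2l//.
case: ifPn => _; first by rewrite normrN ger0_norm.
by rewrite /Theta ler_norml (ltW (atan_gtNpi2 _)) (ltW (atan_ltpi2 _)).
Qed.

Hypothesis FP : F_standing F f.
Hypothesis h4 : hyp_A4 f.

(** Here the boundary term need not vanish at infinity. It is bounded because F <= 1 and the
    arctangent is bounded, and its convergence is a conclusion of the integration by parts. *)
Lemma integral_density4 :
  (\int[mu]_(r in `[0%R, +oo[) (F r * density4 b rho r)%:E = (A4 F f rho b)%:E)%E.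
Proof.
have [F01 [_ [dF [_ cf]]]] := FP.
have c0 : 0 < pi / (2 * beta) by rewrite divr_gt0 ?pi_gt0// mulr_gt0.
have cn0 : pi / (2 * beta) != 0 by rewrite gt_eqF.
have cG : {within `[0, +oo[, continuous Gam}.
  apply/continuous_within_itvcyP; split; last exact: cvg_Theta_primitive0.
  move=> r; rewrite in_itv/= andbT => r0.
  exact: is_derive_cvg (is_derive_Theta_primitive r0).
have mG : measurable_fun [set` `[(0:R), +oo[] Gam.
  exact: subspace_continuous_measurable_fun.
have i4 : mu.-integrable `[0, +oo[ (fun r => (f r * Gam r)%:E).
  have -> : (fun r => (f r * Gam r)%:E) = ((EFin \o f) \* (EFin \o Gam))%E.
    by apply/funext => r; rewrite /= EFinM.
  apply: integrableMl => //.
  exists (pi / (2 * beta) * (pi / 2)); split; first exact: num_real.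
  move=> x Mx r _ /=; apply: le_trans (ltW Mx); exact: Theta_primitive_bounded.
have ub : \forall r \near +oo, F r * Gam r <= pi / (2 * beta) * (pi / 2).
  near=> r.
  have /andP[Fr0 Fr1] : 0 <= F r <= 1 by apply: F01; exact: ltW.
  apply: le_trans (ler_norm _) _; rewrite normrM -[leRHS]mul1r.
  by rewrite (ger0_norm Fr0) ler_pM// Theta_primitive_bounded.
have [J -> JL] := improper_integration_by_parts dF (F_standing_cvg0 FP) cf
  is_derive_Theta_primitive cvg_Theta_primitive0
  (continuous_subspaceT density4_continuous)
  (fun r r0 => mulr_ge0 (proj1 (andP (F01 r r0))) (density4_ge0 r0)) i4 ub.
congr EFin; rewrite /A4.
have -> : lim (Theta b rho @ 0^'+) = - (pi / 2) by apply/cvg_lim => //; exact: cvg_Theta0.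
(* [JL] supplies the existence of the limit that occurs in [A4]; [lim] by itself asserts none. *)
set L := F 0 * _ + J + _ in JL.
have -> : lim ((fun r => F r * Theta b rho r) @ +oo) = L / (pi / (2 * beta)).
  apply/cvg_lim => //.
  have JL' : F r * Gam r * (pi / (2 * beta))^-1 @[r --> +oo] --> L * (pi / (2 * beta))^-1.
    exact: cvgM JL (cvg_cst _).
  apply: cvg_trans JL'; apply: near_eq_cvg; near=> r.
  have r0 : 0 < r by [].
  by rewrite /Theta_primitive leNgt r0/= mulrCA mulrAC mulfV// mul1r.
have IE : fine (\int[mu]_(r in `[0%R, +oo[) (f r * Gam r)%:E)%E =
  pi / (2 * beta) * fine (\int[mu]_(r in `]0%R, +oo[) (f r * Theta b rho r)%:E)%E.
  have i4' : mu.-integrable `]0, +oo[ (fun r => (f r * Gam r)%:E).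
    apply: (integrableS _ _ _ i4) => // x /=.
    by rewrite !in_itv/= !andbT => /ltW.
  have iT : mu.-integrable `]0, +oo[ (fun r => (f r * Theta b rho r)%:E).
    have : mu.-integrable `]0, +oo[ (fun r => ((pi / (2 * beta))^-1)%:E * (f r * Gam r)%:E)%E.
      exact: integrableZl.
    apply: eq_integrable => // r; rewrite inE/= in_itv/= andbT => r0.
    by rewrite -EFinM /Theta_primitive leNgt r0/= [f r * _]mulrCA mulKf.
  (* The integral in [A4] omits the point 0, where [Theta] and the primitive disagree. *)
  rewrite -integral_itv_obnd_cbnd; last exact: (measurable_int mu i4').
  rewrite -[RHS]/(fine (pi / (2 * beta))%:E * _) -fineM//; last first.
    exact: integrable_fin_num.
  congr fine; rewrite -integralZl//=; apply: eq_integral => r.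
  rewrite inE/= in_itv/= andbT => r0.
  by rewrite -EFinM /Theta_primitive leNgt r0/= mulrCA.
rewrite /L IE /Theta_primitive lexx.
set I := fine _; move: cn0; set c := pi / (2 * beta) => cn0.
by field.
Unshelve. all: by end_near. Qed.

End closed_form4.

(** * Exponential marks *)

Section cdf_unique.
Context {R : realType}.

(** Half-open intervals form a generating pi-system and are differences of half-lines, whose
    measures may be subtracted because they are finite. *)
Lemma finite_measure_cdf_unique (m1 m2 : {measure set R -> \bar R}) :
  (m1 setT < +oo)%E -> (forall t, m1 `]-oo, t]%classic = m2 `]-oo, t]%classic) ->
  forall A, measurable A -> m1 A = m2 A.
Proof.
move=> m1oo m12.
have fin1 A : measurable A -> (m1 A < +oo)%E.
  by move=> mA; apply: le_lt_trans m1oo; apply: le_measure; rewrite ?inE.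
have ioc (m : {measure set R -> \bar R}) (a b : R) : (m `]-oo, b]%classic < +oo)%E -> a <= b ->
    m `]a, b]%classic = (m `]-oo, b]%classic - m `]-oo, a]%classic)%E.
  move=> moo ab.
  have -> : `]a, b]%classic = `]-oo, b]%classic `\` `]-oo, a]%classic.
    apply/seteqP; split => x /=; rewrite !in_itv/=.
      by move=> /andP[ax xb]; split => //; apply/negP; rewrite -ltNge.
    by move=> [xb /negP]; rewrite -ltNge => ->.
  rewrite measureD//; congr (_ - m _)%E.
  by apply/setIidPr => x /=; rewrite !in_itv/= => /le_trans; apply.
move=> A mA.
apply: (@measure_unique _ R R (@ocitv R) (fun n => `](- n%:R), n%:R]%classic)) => //.
- by move=> X Y oX oY; exact: (@measurableI _ (ocitv_type R)).
- by move=> n; exists (- n%:R, n%:R).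
- exact: bigcup_itvT.
- move=> _ [[a b]] _ <-; have [ab|ba] := leP a b; last first.
    by rewrite set_itv_ge ?measure0// bnd_simp -leNgt ltW.
  by rewrite !ioc// ?m12// -m12 fin1.
- by move=> n; rewrite fin1.
Qed.

End cdf_unique.

(** * Integrating out an independent variable *)

Section freezing.
Local Open Scope ereal_scope.
Context d d2 (Omega : measurableType d) (T2 : measurableType d2) (R : realType).
Variable P : probability Omega R.
Variables (g : Omega -> T2) (G : set (set Omega)).
Hypothesis mg : measurable_fun setT g.
Hypothesis mG : G `<=` measurable.
Hypothesis GI : setI_closed G.
Hypothesis GT : G setT.
Hypothesis indep : forall C B, G C -> measurable B ->
  P (C `&` g @^-1` B) = P C * P (g @^-1` B).

(** The space Omega with only the sigma-algebra generated by [G]; the law of the identity into it is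
    the restriction of [P]. *)
Let S : measurableType _ := g_sigma_algebraType G.
Let toS : Omega -> S := id.

Lemma g_sigma_sub : <<s G >> `<=` (@measurable _ Omega).
Proof. by apply: smallest_sub => //; exact: sigma_algebra_measurable. Qed.

Let mtoS : measurable_fun setT toS.
Proof. by move=> _ B mB; rewrite setTI; exact: g_sigma_sub. Qed.

Let toS' : {mfun Omega >-> S} := HB.pack toS (isMeasurableFun.Build _ _ _ _ toS mtoS).
Let g' : {mfun Omega >-> T2} := HB.pack g (isMeasurableFun.Build _ _ _ _ g mg).

Let pair (w : Omega) : S * T2 := (toS w, g w).
Let mpair : measurable_fun setT pair.
Proof. by apply/measurable_fun_pairP; split. Qed.
Let pair' : {mfun Omega >-> (S * T2)%type} :=
  HB.pack pair (isMeasurableFun.Build _ _ _ _ pair mpair).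

(** For fixed [B] both sides are finite measures in [A] that agree on the pi-system [G]. *)
Let indepS (A : set Omega) (B : set T2) : <<s G >> A -> measurable B ->
  P (A `&` g @^-1` B) = P A * P (g @^-1` B).
Proof.
move=> sA mB.
have mgB : measurable (g @^-1` B) by rewrite -[X in measurable X]setTI; exact: mg.
have c0 : (0 <= fine (P (g @^-1` B)))%R by rewrite fine_ge0.
have Pfin : P (g @^-1` B) \is a fin_num by rewrite fin_num_measure.
have := @g_sigma_algebra_measure_unique _ R Omega G mG (fun=> setT) _ _
   (mrestr P mgB) (mscale (NngNum c0) P).
move=> /(_ (fun=> GT) _ GI _ _ A sA).
move=> uniq.
have u1 : \bigcup_(i : nat) [set: Omega] = setT by rewrite bigcup_const//; exists 0%N.
have u2 C : G C -> P (C `&` g @^-1` B) = (fine (P (g @^-1` B)))%:E * P C.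
  by move=> GC; rewrite indep// fineK// muleC.
have u3 (i : nat) : P (setT `&` g @^-1` B) < +oo.
  by apply: le_lt_trans (ltry 1); apply: probability_le1; rewrite setTI.
have EE : P (A `&` g @^-1` B) = (fine (P (g @^-1` B)))%:E * P A := uniq u1 u2 u3.
by rewrite EE fineK// muleC.
Qed.

(* [phi] may only depend on [w] through the sigma-algebra generated by [G], of which [g] is
   independent. *)
Lemma ge0_integral_freeze (phi : g_sigma_algebraType G * T2 -> \bar R) :
  measurable_fun setT phi -> (forall z, 0 <= phi z) ->
  \int[P]_w phi (w, g w) = \int[P]_w \int[P]_v phi (w, g v).
Proof.
move=> mphi phi0.
transitivity (\int[distribution P pair']_z phi z).
  by rewrite ge0_integral_distribution.
(* Independence says that the joint law of the identity and [g] is a product; Tonelli then separates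
   the two variables. *)
transitivity (\int[distribution P toS' \x distribution P g']_z phi z).
  apply: eq_measure_integral => X mX _; apply/esym.
  by apply: product_measure_unique => // A B mA mB; exact: indepS.
rewrite fubini_tonelli1//.
rewrite (@ge0_integral_distribution _ _ _ _ _ P toS')//=; last 2 first.
- exact: measurable_fun_fubini_tonelli_F.
- by move=> w; exact: integral_ge0.
apply: eq_integral => w _ /=; rewrite /fubini_F.
rewrite (@ge0_integral_distribution _ _ _ _ _ P g')//=.
exact: measurable_fun_pair2.
Qed.

End freezing.

Section extended_exponential.
Context {R : realType}.
Local Open Scope ereal_scope.

(** Convergence is not assumed: where the lower and upper limits differ, [limn] takes its default
    value, so the function is measurable by cases. *)
Lemma measurable_limn d (T : measurableType d) (u : (T -> \bar R)^nat) :
  (forall n, measurable_fun setT (u n)) ->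
  measurable_fun setT (fun x => limn (u ^~ x)).
Proof.
move=> mu.
have msup : measurable_fun setT (fun x => limn_esup (u ^~ x)).
  exact: measurable_fun_limn_esup.
have minf : measurable_fun setT (fun x => limn_einf (u ^~ x)).
  rewrite /limn_einf; apply: measurableT_comp => //.
  apply: (@measurable_fun_limn_esup _ _ _ setT (fun n x => - u n x)).
  by move=> n; exact: measurableT_comp.
rewrite (_ : (fun x => limn (u ^~ x)) = (fun x =>
    if limn_einf (u ^~ x) == limn_esup (u ^~ x) then limn_esup (u ^~ x) else point)).
  by apply: measurable_fun_ifT => //; exact: measurable_fun_eqe.
apply/funext => x; case: eqP => [e|e].
  apply/cvg_lim => //.
  apply: (@squeeze_cvge _ _ _ _ (einfs (u ^~ x)) (u ^~ x) (esups (u ^~ x))).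
  - apply: nearW => n; apply/andP; split.
      by apply: ereal_inf_lbound; exists n => /=.
    by apply: ereal_sup_ubound; exists n => /=.
  - by rewrite -e limn_einf_lim; exact: is_cvg_einfs.
  - by rewrite limn_esup_lim; exact: is_cvg_esups.
have [/cvg_ex[l ul]|/dvgP//] := pselect (cvgn (u ^~ x)).
by case: e; rewrite !(cvg_limn_einf_sup ul).
Qed.

Lemma measurable_expeR : measurable_fun setT (@expeR R).
Proof.
rewrite (_ : @expeR R = fun x => if x == +oo then +oo else if x == -oo then 0
    else (expR (fine x))%:E); last by apply/funext => -[].
apply: measurable_fun_ifT => //; first exact: measurable_fun_eqe.
apply: measurable_fun_ifT => //; first exact: measurable_fun_eqe.
apply/measurable_EFinP; apply: measurableT_comp => //.
Qed.

Lemma expeR_le1 (x : \bar R) : x <= 0 -> expeR x <= 1.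
Proof. by move=> x0; rewrite -expeR0 lee_expeR. Qed.

(** The case of an infinite limit matters, since the series of interest may diverge; the
    exponentials then tend to 0. *)
Lemma cvg_expeRN (u : (\bar R)^nat) (l : \bar R) : (forall n, 0 <= u n) ->
  u n @[n --> \oo] --> l -> expeR (- u n) @[n --> \oo] --> expeR (- l).
Proof.
move=> u0 ul.
have l0 : 0 <= l by rewrite -(cvg_lim (@ereal_hausdorff _) ul); apply: lime_ge; [exact: cvgP ul|exact: nearW].
case: l ul l0 => [r| |] // ul _.
- have ufin : \forall n \near \oo, u n \is a fin_num.
    by case/fine_cvgP : ul.
  apply/fine_cvgP; split.
    by apply: filterS ufin => n; case: (u n).
  case/fine_cvgP : ul => _ ul.
  apply: (@cvg_trans _ ((expR \o (fun n => - fine (u n)))%R @ \oo)).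
    by apply: near_eq_cvg; apply: filterS ufin => n /=; case: (u n).
  apply: continuous_cvg; first exact: continuous_expR.
  exact: cvgN.
- rewrite [expeR _]/=.
  have ubound (e : R) : (0 < e)%R -> \forall n \near \oo, expeR (- u n) <= e%:E.
    move=> e0; move/cvgeyPge : ul => /(_ (- ln e)%R); apply: filterS => n.
    move=> un; rewrite -[leRHS]/((e)%:E) -(lnK e0) -[leRHS]/(expeR (ln e)%:E).
    by rewrite lee_expeR leeNl.
  apply/fine_cvgP; split.
    have := ubound 1%R ltr01; apply: filterS => n.
    by have := expeR_ge0 (- u n); case: (expeR _).
  apply/cvgr0Pnorm_le => e e0; have := ubound e e0; apply: filterS => n /=.
  by have := expeR_ge0 (- u n); case: (expeR _) => //= r; rewrite !lee_fin => /ger0_norm ->.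
Qed.

End extended_exponential.

(** * Exponential variables known by their distribution function *)

Section exponential_variable.
Context {R : realType}.
Local Open Scope ereal_scope.

Lemma exponential_pdf_tail (theta y : R) : (0 < theta)%R -> (0 <= y)%R ->
  \int[lebesgue_measure]_(t in `[y, +oo[) (exponential_pdf theta t)%:E =
  (expR (- (theta * y)))%:E.
Proof.
move=> th0 y0.
have cexpNM : continuous (fun z : R^o => expR (- theta * z)%R).
  move=> z; apply: continuous_comp; last exact: continuous_expR.
  by apply: continuousM => //; apply: (@continuousN _ R^o); exact: cst_continuous.
rewrite (@ge0_continuous_FTC2y _ _ (fun x => - (expR (- theta * x)))%R _ 0%R)//.
- by rewrite EFinN oppeK add0e mulNr.
- by move=> x _; apply: exponential_pdf_ge0; exact: ltW.
- apply: (@continuous_subspaceW R^o _ _ [set` `[0%R, +oo[%R]).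
    by move=> x /=; rewrite !in_itv/= !andbT; exact: le_trans.
  exact: within_continuous_exponential_pdf.
- rewrite -oppr0; apply: cvgN.
  rewrite (_ : (fun x => expR (- theta * x)%R) =
               (fun z => expR (- z)%R) \o (fun z => theta * z)%R); last first.
    by apply: eq_fun => x; rewrite mulNr.
  apply: (@cvg_comp _ _ _ _ _ _ (pinfty_nbhs R)); last exact: cvgr_expR.
  exact: gt0_cvgMry.
- by apply: cvgN; apply/cvg_at_right_filter; exact: cexpNM.
- move=> z; rewrite in_itv/= andbT => yz; apply: derive1_exponential_pdf.
  by rewrite in_itv/= andbT (le_lt_trans y0).
Qed.

Context d (Omega : measurableType d) (P : probability Omega R) (g : Omega -> R).
Hypothesis mg : measurable_fun setT g.
Hypothesis gcdf : forall t : R, P [set w | (g w <= t)%R] = (exp1_cdf t)%:E.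

Let mle (t : R) : measurable [set w | (g w <= t)%R].
Proof.
rewrite -[X in measurable X]setTI; apply: measurable_fun_le => //.
Qed.

Lemma exp1_gt0_ae : {ae P, forall w, (0 < g w)%R}.
Proof.
exists [set w | (g w <= 0)%R]; split => //.
  by have := gcdf 0%R; rewrite /exp1_cdf ltxx oppr0 expR0 subrr.
by move=> w /=; rewrite leNgt => /negP.
Qed.

Lemma exp1_cdf_lt (t : R) : (0 <= t)%R ->
  P [set w | (g w < t)%R] = (1 - expR (- t))%:E.
Proof.
move=> t0.
have mlt : measurable [set w | (g w < t)%R].
  have -> : [set w | (g w < t)%R] = [set: Omega] `&` g @^-1` `]-oo, t[%classic.
    by rewrite setTI; apply/seteqP; split => w /=; rewrite in_itv.
  exact: mg.
apply/eqP; rewrite eq_le; apply/andP; split.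
  apply: (@le_trans _ _ (exp1_cdf t)%:E); last by rewrite /exp1_cdf ltNge t0.
  by rewrite -gcdf; apply: le_measure; rewrite ?inE// => w /=; exact: ltW.
apply/lee_addgt0Pr => e e0.
(* Moving the threshold down by ln(1 + e) multiplies exp(-t) by 1 + e, so the distribution function
   drops by at most [e]: the law has no atom. *)
apply: (@le_trans _ _ ((1 - expR (- (t - ln (1 + e))))%:E + e%:E)).
  rewrite -EFinD lee_fin lerBlDr -addrA -[leLHS]addr0 -addrA lerD2l.
  rewrite opprB expRD lnK ?posrE ?addr_gt0// mulrDl mul1r opprD.
  have : (e * expR (- t) <= e)%R.
    by rewrite -[leRHS]mulr1 ler_pM2l// -expR0 ler_expR oppr_le0.
  by lra.
apply: leeD => //.
apply: (@le_trans _ _ (exp1_cdf (t - ln (1 + e)))%:E).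
  by rewrite lee_fin /exp1_cdf; case: ltP => // te; rewrite subr_le0 -[leLHS]expR0 ler_expR oppr_ge0 ltW.
rewrite -gcdf; apply: le_measure; rewrite ?inE//.
by move=> w /= /le_lt_trans; apply; rewrite ltrBlDr ltrDl ln_gt0// ltrDl.
Qed.

(** Only the distribution function of [g] is given, so exp(-theta g) is written as the exponential
    tail beyond [g]; Tonelli then makes the probabilities of g <= t appear under the integral. *)
Lemma exp1_laplace (theta : R) : (0 <= theta)%R ->
  \int[P]_w (expR (- (theta * g w)))%:E = ((1 + theta)^-1)%:E.
Proof.
rewrite le_eqVlt => /predU1P[<-|th0].
  under eq_integral do rewrite mul0r oppr0 expR0.
  by rewrite integral_cst// mul1e addr0 invr1; exact: probability_setT.
have th1 : (0 < 1 + theta)%R by rewrite addr_gt0.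
have pdf0 (t : R) : (0 <= exponential_pdf theta t)%R by apply: exponential_pdf_ge0; exact: ltW.
have mpdf : measurable_fun setT (exponential_pdf theta) by exact: measurable_exponential_pdf.
have mH : measurable_fun [set: Omega * R]
    (fun z => (exponential_pdf theta z.2 * (g z.1 <= z.2)%R%:R)%:E).
  apply/measurable_EFinP; apply: measurable_funM.
    exact: (measurableT_comp mpdf).
  rewrite (_ : (fun z => _) = (fun z : Omega * R => if (g z.1 <= z.2)%R then 1 else 0)%R).
    apply: measurable_fun_ifT => //; apply: measurable_fun_ler => //.
    exact: (measurableT_comp mg).
  by apply/funext => z; case: ifP.
transitivity (\int[P]_w \int[lebesgue_measure]_t
    (exponential_pdf theta t * (g w <= t)%R%:R)%:E).
  apply: ae_eq_integral => //.
  - apply/measurable_EFinP; apply: measurableT_comp => //.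
    by apply: measurableT_comp => //; apply: measurable_funM.
  - apply: (measurable_fun_fubini_tonelli_F (m2 := lebesgue_measure) _ mH).
    by move=> z; rewrite lee_fin mulr_ge0.
  - apply: filterS exp1_gt0_ae => w g0 _.
    rewrite -exponential_pdf_tail ?ltW// [LHS]integral_mkcond; apply: eq_integral => t _.
    rewrite patchE mem_setE in_itv/= andbT.
    by case: (g w <= t)%R; rewrite ?mulr1 ?mulr0.
rewrite (@fubini_tonelli _ _ _ _ _ P lebesgue_measure
  (fun z => (exponential_pdf theta z.2 * (g z.1 <= z.2)%R%:R)%:E))//=; last first.
  by move=> z; rewrite lee_fin mulr_ge0.
(* Multiplying the density of rate theta by 1 - exp(-t) gives a difference of multiples of two
   exponential densities, each of total mass 1. *)
transitivity (\int[lebesgue_measure]_t ((exponential_pdf theta t)%:E -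
   (theta / (1 + theta) * exponential_pdf (1 + theta) t)%:E)).
  apply: eq_integral => t _.
  transitivity ((exponential_pdf theta t)%:E * P [set w | (g w <= t)%R]).
    rewrite -[in RHS](setIT [set w | (g w <= t)%R]) -integral_indic//.
    rewrite -ge0_integralZl ?lee_fin//; last first.
      by apply/measurable_EFinP; exact: measurable_indic.
    apply: eq_integral => w _; rewrite -EFinM indicE; congr (_ * _%:R)%:E.
    by congr nat_of_bool; apply/idP/idP => [/mem_set|/set_mem].
  rewrite gcdf /exp1_cdf.
  have [t0|t0] := ltP t 0%R.
    by rewrite !lt0_exponential_pdf// mulr0 mul0e subee.
  rewrite !exponential_pdfE// -EFinM -EFinB; congr _%:E.
  rewrite mulrA divfK ?gt_eqF// mulrBr mulr1; congr (_ - _)%R.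
  by rewrite -mulrA -expRD; congr (_ * expR _)%R; rewrite !mulNr mulrDl mul1r opprD addrC.
rewrite integralB//=; last 2 first.
- exact: integrable_exponential_pdf.
- under eq_fun do rewrite EFinM.
  by apply: integrableZl => //; exact: integrable_exponential_pdf.
rewrite integral_exponential_pdf//.
under eq_integral do rewrite EFinM.
rewrite integralZl//; last exact: integrable_exponential_pdf.
rewrite integral_exponential_pdf// mule1 -EFinB; congr _%:E.
by field; rewrite gt_eqF.
Qed.

End exponential_variable.

Section exponential_threshold.
Context {R : realType} d (Omega : measurableType d) (P : probability Omega R).
Variable g : Omega -> R.
Local Open Scope ereal_scope.
Hypothesis mg : measurable_fun setT g.
Hypothesis gcdf : forall t : R, P [set w | (g w <= t)%R] = (exp1_cdf t)%:E.

(** Freezing [Y] leaves the probability that [g] is below a constant, which is 1 - exp(-Y), also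
    when Y = +oo. *)
Let ge0_exp1_threshold (Y : Omega -> \bar R) : measurable_fun setT Y -> (forall w, 0 <= Y w) ->
  (forall (A : set R) (B : set (\bar R)), measurable A -> measurable B ->
    P (g @^-1` A `&` Y @^-1` B) = P (g @^-1` A) * P (Y @^-1` B)) ->
  P [set w | (g w)%:E < Y w] = 1 - \int[P]_w expeR (- Y w).
Proof.
move=> mY Y0 indep.
pose G : set (set Omega) := [set A | exists2 B, measurable B & A = Y @^-1` B].
have mGG A : G A -> measurable A.
  by move=> [B mB ->]; rewrite -[X in measurable X]setTI; exact: mY.
pose phi (z : g_sigma_algebraType G * R) : \bar R := if (z.2)%:E < Y z.1 then 1 else 0.
have mYG : measurable_fun setT (Y : g_sigma_algebraType G -> \bar R).
  by move=> _ B mB; rewrite setTI; apply: sub_gen_smallest; exists B.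
have mphi : measurable_fun setT phi.
  apply: measurable_fun_ifT => //; apply: measurable_fun_lte.
    by apply/measurable_EFinP; exact: measurable_snd.
  exact: (measurableT_comp mYG).
have phi0 z : 0 <= phi z by rewrite /phi; case: ifP.
have mlt : measurable [set w | (g w)%:E < Y w].
  rewrite -[X in measurable X]setTI; apply: measurable_lte => //.
  exact/measurable_EFinP.
have -> : P [set w | (g w)%:E < Y w] = \int[P]_w phi (w, g w).
  rewrite -[in LHS](setIT [set w | _]) -integral_indic//; apply: eq_integral => w _.
  rewrite indicE /phi/=; case: ifPn => h; first by rewrite mem_set.
  by rewrite memNset//; exact/negP.
rewrite (@ge0_integral_freeze _ _ _ _ _ P g G)//; last first.
- by move=> C B [C' mC' ->] mB; rewrite setIC muleC; exact: indep.
- by exists setT => //; rewrite preimage_setT.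
- move=> A1 A2 [B1 mB1 ->] [B2 mB2 ->]; exists (B1 `&` B2); first exact: measurableI.
  by rewrite preimage_setI.
have mexp : measurable_fun setT (fun w => expeR (- Y w)).
  apply: (measurableT_comp measurable_expeR); exact: measurableT_comp.
have exp1 w : expeR (- Y w) <= 1 by apply: expeR_le1; rewrite oppe_le0.
transitivity (\int[P]_w (1 - expeR (- Y w))).
  apply: eq_integral => w _.
  transitivity (P [set v | (g v)%:E < Y w]).
    rewrite -[in RHS](setIT [set v | _]) -integral_indic//; last first.
      rewrite -[X in measurable X]setTI; apply: measurable_lte => //.
      exact/measurable_EFinP.
    apply: eq_integral => v _.
    rewrite indicE /phi/=; case: ifPn => h; first by rewrite mem_set.
    by rewrite memNset//; exact/negP.
  have := Y0 w; case: (Y w) => [y| |] // y0.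
    by rewrite (@exp1_cdf_lt _ _ _ P g).
  rewrite [expeR _]/= sube0 -(@probability_setT _ _ _ P); congr (P _).
  by apply/seteqP; split => v //= _; exact: ltry.
rewrite integralB//.
- by rewrite integral_cst// mul1e; congr (_ - _); exact: probability_setT.
- exact: finite_measure_integrable_cst.
- apply: (@le_integrable _ _ _ _ _ _ _ (cst 1)) => //.
    by move=> w _; rewrite gee0_abs ?expeR_ge0//= normr1; exact: exp1.
  exact: finite_measure_integrable_cst.
Qed.

(** Y is nonnegative only almost surely. Its absolute value is nonnegative everywhere, almost surely
    equal to it, and still independent of [g] as a measurable function of Y. *)
Lemma exp1_threshold (Y : Omega -> \bar R) : measurable_fun setT Y ->
  {ae P, forall w, 0 <= Y w} ->
  (forall (A : set R) (B : set (\bar R)), measurable A -> measurable B ->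
    P (g @^-1` A `&` Y @^-1` B) = P (g @^-1` A) * P (Y @^-1` B)) ->
  P [set w | (g w)%:E < Y w] = 1 - \int[P]_w expeR (- Y w).
Proof.
move=> mY Y0 indep.
have mabs : measurable_fun setT (fun w => `|Y w|) by exact: measurableT_comp.
have mg' : measurable_fun setT (EFin \o g) by exact/measurable_EFinP.
have mlt (Z : Omega -> \bar R) : measurable_fun setT Z ->
    measurable [set w | (g w)%:E < Z w].
  by move=> mZ; rewrite -[X in measurable X]setTI; exact: measurable_lte.
have mexp (Z : Omega -> \bar R) : measurable_fun setT Z ->
    measurable_fun setT (fun w => expeR (- Z w)).
  by move=> mZ; apply: (measurableT_comp measurable_expeR); exact: measurableT_comp.
transitivity (P [set w | (g w)%:E < `|Y w|]).
  have Plt (Z : Omega -> \bar R) : measurable_fun setT Z ->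
      P [set w | (g w)%:E < Z w] = \int[P]_w (\1_([set v | (g v)%:E < Z v]%E) w)%:E.
    by move=> mZ; rewrite integral_indic ?setIT//; exact: mlt.
  rewrite !Plt//; apply: ae_eq_integral => //.
  - by apply/measurable_EFinP/measurable_indic; exact: mlt.
  - by apply/measurable_EFinP/measurable_indic; exact: mlt.
  - apply: filterS Y0 => w Yw _; rewrite !indicE; congr (_%:R%:E); congr nat_of_bool.
    by apply/idP/idP => /set_mem /= gY; apply/mem_set => /=; move: gY; rewrite gee0_abs.
rewrite ge0_exp1_threshold//.
  congr (1 - _); apply: ae_eq_integral => //; [exact: mexp|exact: mexp|].
  by apply: filterS Y0 => w Yw _; rewrite gee0_abs.
move=> A B mA mB; apply: (indep A (abse @^-1` B)) => //.
have mabse : measurable_fun setT (@abse R) by [].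
by rewrite -[X in measurable X]setTI; exact: mabse.
Qed.

End exponential_threshold.

Section bounded_convergence.
Context {R : realType} d (Omega : measurableType d) (P : probability Omega R).
Local Open Scope ereal_scope.

Lemma cvg_integral_expeRN (u : (Omega -> \bar R)^nat) (l : Omega -> \bar R) :
  (forall n, measurable_fun setT (u n)) -> measurable_fun setT l ->
  {ae P, forall w, (forall n, 0 <= u n w) /\ u n w @[n --> \oo] --> l w} ->
  \int[P]_w expeR (- u n w) @[n --> \oo] --> \int[P]_w expeR (- l w).
Proof.
move=> mu ml ul.
have mexp (Z : Omega -> \bar R) : measurable_fun setT Z ->
    measurable_fun setT (fun w => expeR (- Z w)).
  by move=> mZ; apply: (measurableT_comp measurable_expeR); exact: measurableT_comp.
have [//|||_ _] := @dominated_convergence _ _ _ P setT measurableT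
  (fun n w => expeR (- u n w)) (fun w => expeR (- l w)) (cst 1)
  (fun n => mexp _ (mu n)) (mexp _ ml); last exact.
- by apply: filterS ul => w [u0 uw] _; exact: cvg_expeRN.
- exact: finite_measure_integrable_cst.
- apply: filterS ul => w [u0 uw] n _.
  by rewrite gee0_abs ?expeR_ge0//; apply: expeR_le1; rewrite oppe_le0.
Qed.

End bounded_convergence.

Lemma measurable_invD {R : realType} d (T : measurableType d) (b : R) (f : T -> R) :
  (0 < b)%R -> (forall x, 0 <= f x)%R -> measurable_fun setT f ->
  measurable_fun setT (fun x => (b + f x)^-1)%R.
Proof.
move=> b0 f0 mf; have c : measurable_fun setT (fun t : R => (b + `|t|)^-1).
  apply: continuous_measurable_fun => t; apply: cvgV; first by rewrite gt_eqF// ltr_pwDl.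
  by apply: cvgD; [exact: cvg_cst|exact: norm_continuous].
rewrite (_ : (fun x => _) = (fun t : R => (b + `|t|)^-1) \o f); first exact: measurableT_comp.
by apply/funext => x /=; rewrite ger0_norm.
Qed.

(** * Averaging the marks *)

Section independent_marks.
Context {R : realType} d (Omega : measurableType d) (P : probability Omega R).
Variables (Gen : set (set Omega)) (g : nat -> Omega -> R).
Local Open Scope ereal_scope.
Hypothesis mGen : Gen `<=` measurable.
Hypothesis mg : forall i, measurable_fun setT (g i).
Hypothesis gindep : forall (J : seq nat) (t : nat -> R) (E : set Omega),
  uniq J -> <<s Gen>> E ->
  P (E `&` \bigcap_(j in [set j | j \in J]) [set w | (g j w <= t j)%R]) =
  P E * \prod_(j <- J) (exp1_cdf (t j))%:E.

Let mE E : <<s Gen>> E -> measurable E.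
Proof. by apply: smallest_sub => //; exact: sigma_algebra_measurable. Qed.

Let mle j (t : R) : measurable [set w | (g j w <= t)%R].
Proof. by rewrite -[X in measurable X]setTI; apply: measurable_fun_le. Qed.

Lemma mark_cdf j (t : R) : P [set w | (g j w <= t)%R] = (exp1_cdf t)%:E.
Proof.
have := @gindep [:: j] (fun=> t) setT isT (@measurableT _ (g_sigma_algebraType Gen)).
rewrite setTI probability_setT mul1e big_seq1 => <-; congr (P _).
apply/seteqP; split => w /=; first by move=> gw i /=; rewrite inE => /eqP ->.
by apply => /=; rewrite inE.
Qed.

(* A pi-system generating the sigma-algebra of the points and of all marks but the m-th. *)
Definition other_marks m : set (set Omega) :=
  [set C | exists J (t : nat -> R) E, [/\ uniq J, m \notin J, <<s Gen>> E &
    C = E `&` \bigcap_(j in [set j | j \in J]) [set w | (g j w <= t j)%R]]].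

Let m_other m : other_marks m `<=` measurable.
Proof.
move=> _ [J [t [E [_ _ sE ->]]]]; apply: measurableI; first exact: mE.
by apply: fin_bigcap_measurable => [|j _]; [exact: finite_seq|exact: mle].
Qed.

Let other_setT m : other_marks m setT.
Proof.
exists [::], (fun=> 0%R), setT; split => //; first exact: (@measurableT _ (g_sigma_algebraType Gen)).
by rewrite setTI; apply/seteqP; split => // w _ j.
Qed.

Let other_setI m : setI_closed (other_marks m).
Proof.
move=> _ _ [J1 [t1 [E1 [u1 m1 sE1 ->]]]] [J2 [t2 [E2 [u2 m2 sE2 ->]]]].
(* A label constrained on both sides receives the smaller threshold. *)
exists (undup (J1 ++ J2)), (fun j => if j \in J1 then
  if j \in J2 then Num.min (t1 j) (t2 j) else t1 j else t2 j), (E1 `&` E2); split.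
- exact: undup_uniq.
- by rewrite mem_undup mem_cat negb_or m1.
- exact: (@measurableI _ (g_sigma_algebraType Gen)).
- rewrite setIACA; congr (_ `&` _); apply/seteqP; split => w /=.
    move=> [w1 w2] j /=; rewrite mem_undup mem_cat.
    case: ifPn => j1; last by move=> /= /w2.
    by case: ifPn => j2 _; [rewrite le_min w1//= w2|exact: w1].
  move=> wJ; split => j jJ.
    by have /= := wJ j; rewrite mem_undup mem_cat jJ => /(_ isT); case: ifP; rewrite ?le_min => // _ /andP[].
  have /= := wJ j; rewrite mem_undup mem_cat jJ orbT => /(_ isT); case: ifP; rewrite ?le_min => //.
  by move=> _ /andP[].
Qed.

(** It suffices to take half-lines for [B]. Then the event on [g m] is one more factor in the
    product formula, since [m] is not among the labels of [C]. *)
Let other_indep m C (B : set R) : other_marks m C -> measurable B ->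
  P (C `&` g m @^-1` B) = P C * P (g m @^-1` B).
Proof.
move=> oC mB; have mC := m_other oC.
pose gm : {mfun Omega >-> R} := HB.pack (g m) (isMeasurableFun.Build _ _ _ _ (g m) (mg m)).
have c0 : (0 <= fine (P C))%R by rewrite fine_ge0.
pose m1 := pushforward (mrestr P mC) gm.
pose m2 := mscale (NngNum c0) (distribution P gm).
have e1 A : m1 A = P (C `&` g m @^-1` A) by rewrite /m1 /= /pushforward /mrestr setIC.
have e2 A : m2 A = P C * P (g m @^-1` A).
  by rewrite /m2 /= /mscale /= fineK// fin_num_measure.
have m12 : forall A, measurable A -> m1 A = m2 A.
  apply: finite_measure_cdf_unique.
    rewrite /= /pushforward /mrestr preimage_setT setTI.
    exact: le_lt_trans (probability_le1 P mC) (ltry 1).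
  move=> t; rewrite -[LHS]/(m1 _) -[RHS]/(m2 _) e1 e2.
  have -> : g m @^-1` `]-oo, t]%classic = [set w | (g m w <= t)%R].
    by apply/seteqP; split => w /=; rewrite in_itv.
  case: oC => J [t' [E [uJ mJ sE ->]]].
  rewrite gindep// mark_cdf -muleA [X in _ * X]muleC.
  rewrite -setIA [X in E `&` X](_ : _ = \bigcap_(j in [set j | j \in m :: J])
      [set w | (g j w <= if j == m then t else t' j)%R]).
    rewrite gindep//= ?mJ// big_cons eqxx; congr (_ * (_ * _)).
    by apply: eq_big_seq => j jJ; case: eqP => // jm; rewrite -jm jJ in mJ.
  apply/seteqP; split => w /=.
    move=> [wJ wm] j /=; rewrite inE => /predU1P[->|jJ]; first by rewrite eqxx.
    by case: eqP => [jm|_]; [rewrite -jm jJ in mJ|exact: wJ].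
  move=> wJ; split=> [j jJ|]; last by have := wJ m; rewrite /= inE eqxx; apply.
  have /= := wJ j; rewrite inE jJ orbT => /(_ isT).
  by case: eqP => // jm; rewrite -jm jJ in mJ.
by rewrite -e1 -e2; exact: m12.
Qed.

Let m_other_mark m j : j != m ->
  measurable_fun setT (g j : g_sigma_algebraType (other_marks m) -> R).
Proof.
move=> jm; apply: (measurability _ (RGenOInfty.measurableE R)) => // _ [_ [a ->] <-].
rewrite setTI.
have -> : g j @^-1` `]a, +oo[%classic = ~` [set w | (g j w <= a)%R].
  by apply/seteqP; split => w /=; rewrite in_itv/= andbT ltNge => /negP.
apply: measurableC; apply: sub_gen_smallest.
exists [:: j], (fun=> a), setT; split => //.
- by rewrite inE eq_sym.
- exact: (@measurableT _ (g_sigma_algebraType Gen)).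
- rewrite setTI; apply/seteqP; split => w /=; first by move=> gw i /=; rewrite inE => /eqP ->.
  by apply => /=; rewrite inE.
Qed.

Let m_other_param m (f : g_sigma_algebraType Gen -> R) : measurable_fun setT f ->
  measurable_fun setT (f : g_sigma_algebraType (other_marks m) -> R).
Proof.
move=> mf _ B mB; rewrite setTI; apply: sub_gen_smallest.
exists [::], (fun=> 0%R), (f @^-1` B); split => //.
  by rewrite -[X in smallest _ _ X]setTI; exact: mf.
by rewrite (_ : \bigcap_(j in _) _ = setT) ?setIT//; apply/seteqP; split => // w _ j.
Qed.

Let m_param (f : g_sigma_algebraType Gen -> R) : measurable_fun setT f ->
  measurable_fun setT (f : Omega -> R).
Proof. by move=> mf _ B mB; apply: mE; exact: mf. Qed.

Lemma integral_marks (theta : nat -> g_sigma_algebraType Gen -> R) n :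
  (forall i w, 0 <= theta i w)%R -> (forall i, measurable_fun setT (theta i)) ->
  \int[P]_w (\prod_(i < n) expR (- (theta i w * g i w)))%:E =
  \int[P]_w (\prod_(i < n) (1 + theta i w)^-1)%:E.
Proof.
move=> th0 mth.
(* Hybrid factors: those of index below m are already averaged. Passing from m to m + 1 integrates
   the mark [g m] while the points and the other marks are frozen. *)
pose F m i w := if (i < m)%N then ((1 + theta i w)^-1)%R else expR (- (theta i w * g i w)).
have F0 m i w : (0 <= F m i w)%R.
  by rewrite /F; case: ifP => _; rewrite ?expR_ge0// invr_ge0 addr_ge0.
have th1 i w : (1 + theta i w != 0)%R by rewrite gt_eqF// ltr_pwDl.
have mF m i : (i == m) = false -> 
    measurable_fun setT (F m i : g_sigma_algebraType (other_marks m) -> R).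
  move=> im; rewrite /F; case: (i < m)%N.
    by apply: measurable_invD => //; exact: m_other_param.
  apply: measurableT_comp => //; apply: measurableT_comp => //.
  by apply: measurable_funM; [exact: m_other_param|apply: m_other_mark; rewrite im].
have step m : \int[P]_w (\prod_(i < n) F m i w)%:E = \int[P]_w (\prod_(i < n) F m.+1 i w)%:E.
  have [mn|nm] := ltnP m n; last first.
    apply: eq_integral => w _; congr _%:E; apply: eq_bigr => i _; rewrite /F.
    by rewrite (leq_trans (ltn_ord i) nm) (leq_trans (ltn_ord i) (leqW nm)).
  pose m' := Ordinal mn.
  pose psi w := (\prod_(i < n | i != m') F m i w)%R.
  have psi0 w : (0 <= psi w)%R by apply: prodr_ge0.
  have mpsi : measurable_fun setT (psi : g_sigma_algebraType (other_marks m) -> R).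
    rewrite /psi; under eq_fun do rewrite big_mkcond.
    apply: measurable_prod => i _; case: (boolP (i != m')) => // im.
    by apply: mF; exact: negbTE.
  pose phi (z : g_sigma_algebraType (other_marks m) * R) :=
    (expR (- (theta m z.1 * z.2)) * psi z.1)%:E.
  transitivity (\int[P]_w phi (w, g m w)).
    apply: eq_integral => w _; congr _%:E; rewrite (bigD1 m')//=; congr (_ * _)%R.
    by rewrite /F ltnn.
  rewrite (@ge0_integral_freeze _ _ _ _ _ P (g m) (other_marks m))//; last 3 first.
  - exact: other_indep.
  - apply/measurable_EFinP; apply: measurable_funM; last exact: (measurableT_comp mpsi).
    apply: measurableT_comp => //; apply: measurableT_comp => //.
    apply: measurable_funM => //; apply: (measurableT_comp (m_other_param (mth m))).
    exact: measurable_fst.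
  - by move=> z; rewrite lee_fin mulr_ge0// expR_ge0.
  apply: eq_integral => w _; rewrite /phi/=.
  under eq_integral do rewrite EFinM muleC.
  rewrite ge0_integralZl//; last 2 first.
  - apply/measurable_EFinP; apply: measurableT_comp => //; apply: measurableT_comp => //.
    exact: measurable_funM.
  - by rewrite lee_fin.
  rewrite (@exp1_laplace _ _ _ _ (g m))//; last exact: mark_cdf.
  rewrite muleC -EFinM (bigD1 m')//=; congr (_ * _)%:E.
    by rewrite /F ltnSn.
  apply: eq_bigr => i; rewrite /F -(inj_eq val_inj)/= => im.
  by rewrite ltnS (leq_eqVlt i) (negbTE im).
have all m : \int[P]_w (\prod_(i < n) F 0%N i w)%:E = \int[P]_w (\prod_(i < n) F m i w)%:E.
  by elim: m => // m ->.
transitivity (\int[P]_w (\prod_(i < n) F 0%N i w)%:E); first by apply: eq_integral.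
rewrite (all n); apply: eq_integral => w _; congr _%:E; apply: eq_bigr => i _.
by rewrite /F ltn_ord.
Qed.

(** The averaged factors (1 + theta)^-1 are written exp(-ln(1 + theta)), so that both sides are
    limits of finite products and the right one is ready for the Laplace functional. *)
Lemma integral_expeRN_marks (theta : nat -> g_sigma_algebraType Gen -> R) :
  (forall i w, 0 <= theta i w)%R -> (forall i, measurable_fun setT (theta i)) ->
  \int[P]_w expeR (- \sum_(i <oo) (theta i w * g i w)%:E) =
  \int[P]_w expeR (- \sum_(i <oo) (ln (1 + theta i w))%:E).
Proof.
move=> th0 mth.
have cvg_sums (x : nat -> Omega -> R) : (forall i, measurable_fun setT (x i)) ->
    {ae P, forall w, forall i, (0 <= x i w)%R} ->
    \int[P]_w (\prod_(i < n) expR (- x i w))%:E @[n --> \oo] -->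
      \int[P]_w expeR (- \sum_(i <oo) (x i w)%:E).
  move=> mx x0.
  rewrite (_ : (fun n => _) = (fun n => \int[P]_w expeR (- \sum_(0 <= i < n) (x i w)%:E))).
    have msum n : measurable_fun setT (fun w => \sum_(0 <= i < n) (x i w)%:E).
      by apply: emeasurable_sum => i; exact/measurable_EFinP.
    apply: cvg_integral_expeRN => //; first exact: measurable_limn.
    apply: filterS x0 => w x0; split=> [n|]; last first.
      by apply: is_cvg_nneseries => i _ _; rewrite lee_fin.
    by apply: sume_ge0 => i _; rewrite lee_fin.
  apply/funext => n; apply: eq_integral => w _.
  rewrite sumEFin -EFinN /= big_mkord; congr _%:E.
  by rewrite -sumrN expR_sum.
rewrite -(cvg_lim (@ereal_hausdorff R) (cvg_sums (fun i w => theta i w * g i w)%R _ _)).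
- rewrite -(cvg_lim (@ereal_hausdorff R) (cvg_sums (fun i w => ln (1 + theta i w)) _ _)).
  + congr (limn _); apply/funext => n; rewrite integral_marks//.
    apply: eq_integral => w _; congr _%:E; apply: eq_bigr => i _.
    by rewrite expRN lnK// posrE ltr_pwDl.
  + move=> i; apply: measurableT_comp => //.
    by apply: measurable_funD => //; exact: m_param.
  + by apply/aeW => w i; apply: ln_ge0; rewrite lerDl.
- by move=> i; apply: measurable_funM => //; exact: m_param.
- apply: ae_foralln => i; apply: filterS (exp1_gt0_ae (mg i) (@mark_cdf i)) => w g0.
  by rewrite mulr_ge0// ltW.
Qed.

End independent_marks.

(** * Laplace functional of the Poisson process *)

Section poisson_vector.
Context {R : realType}.
Local Open Scope ereal_scope.

Lemma poisson_laplace (rate a : R) :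
  \sum_(i <oo) (expR (- (a * i%:R)) * poisson_pmf0 rate i)%:E =
  (expR (- ((1 - expR (- a)) * rate)))%:E.
Proof.
have -> : (expR (- ((1 - expR (- a)) * rate)) = expR (expR (- a) * rate) * expR (- rate))%R.
  by rewrite -expRD; congr expR; ring.
have /cvgP-cv := is_cvg_series_exp_coeff (expR (- a) * rate).
apply/cvg_lim => //.
rewrite (_ : (fun n => _) = EFin \o
    (fun n => series (exp_coeff (expR (- a) * rate)) n * expR (- rate))%R).
  apply: cvg_EFin; first exact: nearW.
  by apply: cvgM; [exact: is_cvg_series_exp_coeff|exact: cvg_cst].
apply/funext => n /=; rewrite sumEFin /series/= mulr_suml; congr _%:E.
apply: eq_bigr => i _; rewrite /poisson_pmf0 /exp_coeff /= exprMn -expRM_natr.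
by rewrite mulNr; ring.
Qed.

Lemma poisson_pmf0_ge0 (rate : R) i : (0 <= rate)%R -> (0 <= poisson_pmf0 rate i)%R.
Proof. by move=> r0; rewrite mulr_ge0 ?expR_ge0// divr_ge0// exprn_ge0. Qed.

Lemma expeRN_sum I (s : seq I) (x : I -> \bar R) : (forall i, 0 <= x i) ->
  expeR (- \sum_(i <- s) x i) = (\prod_(i <- s) fine (expeR (- x i)))%:E.
Proof.
move=> x0; elim: s => [|i s IH]; first by rewrite !big_nil oppe0 expeR0.
rewrite !big_cons EFinM -IH.
have : 0 <= \sum_(j <- s) x j by exact: sume_ge0.
have := x0 i; case: (x i) => [y| |]// _; case: (\sum_(j <- s) x j) => [z| |]// _ /=.
- by rewrite opprD expRD EFinM.
- by rewrite mule0.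
- by rewrite mul0e.
- by rewrite mul0e.
Qed.

Context d (Omega : measurableType d) (P : probability Omega R).
Variables (n : nat) (K : 'I_n -> Omega -> \bar R) (r a : 'I_n -> R).
Hypothesis mK : forall j, measurable_fun setT (K j).
Hypothesis K0 : forall j w, 0 <= K j w.
Hypothesis r0 : forall j, (0 <= r j)%R.
Hypothesis a0 : forall j, (0 <= a j)%R.
Hypothesis marginal : forall j i,
  P [set w | K j w = i%:R%:E] = (poisson_pmf0 (r j) i)%:E.
Hypothesis joint : forall k : 'I_n -> nat,
  P (\bigcap_(j in [set: 'I_n]) [set w | K j w = (k j)%:R%:E]) =
  \prod_(j < n) (poisson_pmf0 (r j) (k j))%:E.

Let mKi j i : measurable [set w | K j w = i%:R%:E].
Proof. by rewrite -[X in measurable X]setTI; exact: measurable_eqe. Qed.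

(** Counts are extended reals, but the Poisson masses of the natural numbers already sum to 1, by
    [poisson_laplace] at a = 0. *)
Let nat_valued j : {ae P, forall w, exists i, K j w = i%:R%:E}.
Proof.
have mU : measurable (\bigcup_i [set w | K j w = i%:R%:E]) by exact: bigcup_measurable.
exists (~` \bigcup_i [set w | K j w = i%:R%:E]); split => //.
- exact: measurableC.
- suff PU : P (\bigcup_i [set w | K j w = i%:R%:E]) = 1.
    by have := probability_setC P mU; rewrite PU subee.
  rewrite measure_bigcup//; last first.
    by apply/trivIsetP => i1 i2 _ _ /eqP i12; apply/seteqP; split => // w [/= ->] [] /eqP; rewrite eqr_nat => /eqP.
  have := poisson_laplace (r j) 0; rewrite oppr0 expR0 subrr mul0r oppr0 expR0 => <-.
  rewrite (@eq_eseriesl _ _ xpredT); last by move=> i; rewrite mem_set.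
  apply: eq_eseriesr => i _; rewrite mul0r oppr0 expR0 mul1r; exact: marginal.
- by move=> w /= h [i _ Ki]; apply: h; exists i.
Qed.

Let E j w : R := fine (expeR (- ((a j)%:E * K j w))).

Let aK0 j w : 0 <= (a j)%:E * K j w.
Proof. by rewrite mule_ge0// lee_fin. Qed.

Let E0 j w : (0 <= E j w)%R.
Proof. by rewrite fine_ge0// expeR_ge0. Qed.

Let mE j : measurable_fun setT (E j).
Proof.
apply: measurableT_comp => //; apply: (measurableT_comp measurable_expeR).
by apply: measurableT_comp => //; exact: measurable_funeM.
Qed.

Let E_series j : {ae P, forall w, (E j w)%:E =
  \sum_(i <oo) (expR (- (a j * i%:R)) * \1_[set w | K j w = i%:R%:E] w)%:E}.
Proof.
apply: filterS (nat_valued j) => w [i0 Ki0].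
rewrite (@nneseriesD1 _ _ i0)//.
rewrite eseries0 ?adde0.
  by rewrite /E Ki0 -EFinM -EFinN /= indicE mem_set ?mulr1.
move=> i _ /= /eqP ii0; rewrite indicE memNset ?mulr0//= Ki0 => -[] /eqP.
by rewrite eqr_nat => /eqP i0i; rewrite i0i in ii0.
Qed.

(** Only the probabilities of joint values are given. The product starts as the indicator of a joint
    value, and coordinates are turned into exponentials one at a time; [W] is the corresponding
    expectation. *)
Let V m (k : 'I_n -> nat) (j : 'I_n) w : R :=
  if (j < m)%N then E j w else \1_[set w | K j w = (k j)%:R%:E] w.
Let W m (k : 'I_n -> nat) (j : 'I_n) : R :=
  if (j < m)%N then expR (- ((1 - expR (- a j)) * r j)) else poisson_pmf0 (r j) (k j).

Let V0 m k j w : (0 <= V m k j w)%R.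
Proof. by rewrite /V; case: ifP. Qed.

Let mV m k j : measurable_fun setT (V m k j).
Proof.
rewrite /V; case: (j < m)%N; first exact: mE.
exact: measurable_indic.
Qed.

Let mprodV m k : measurable_fun setT (fun w => (\prod_(j < n) V m k j w)%:E).
Proof. by apply/measurable_EFinP; apply: measurable_prod. Qed.

Let integral_V m k : \int[P]_w (\prod_(j < n) V m k j w)%:E = (\prod_(j < n) W m k j)%:E.
Proof.
elim: m k => [k|m IH k].
  transitivity (\int[P]_w (\1_(\bigcap_(j in [set: 'I_n]) [set w | K j w = (k j)%:R%:E]) w)%:E).
    apply: eq_integral => w _; congr _%:E; rewrite indicE.
    have [h|h] := pselect ((\bigcap_(j in [set: 'I_n]) [set w | K j w = (k j)%:R%:E]) w).
      rewrite mem_set//; apply: big1 => j _; rewrite /V/= indicE mem_set//; exact: h.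
    rewrite memNset//; move/existsNP : h => [j jK].
    apply/eqP; rewrite prodf_seq_eq0; apply/hasP.
    exists j; rewrite ?mem_index_enum//= /V/= indicE memNset//.
  rewrite integral_indic// ?setIT; first by rewrite [LHS]joint prodEFin.
  by apply: fin_bigcap_measurable.
have [mn|nm] := ltnP m n; last first.
  transitivity (\int[P]_w (\prod_(j < n) V m k j w)%:E).
    apply: eq_integral => w _; congr _%:E; apply: eq_bigr => j _; rewrite /V.
    by rewrite (leq_trans (ltn_ord j) nm) (leq_trans (ltn_ord j) (leqW nm)).
  rewrite IH; congr _%:E; apply: eq_bigr => j _; rewrite /W.
  by rewrite (leq_trans (ltn_ord j) nm) (leq_trans (ltn_ord j) (leqW nm)).
pose m' := Ordinal mn.
pose upd i j := if j == m' then i else k j.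
have Vne i j w : j != m' -> V m.+1 k j w = V m (upd i) j w.
  move=> jm; rewrite /V /upd (negbTE jm) ltnS (leq_eqVlt j).
  by move: jm; rewrite -(inj_eq val_inj)/= => /negbTE ->.
have Wne i j : j != m' -> W m.+1 k j = W m (upd i) j.
  move=> jm; rewrite /W /upd (negbTE jm) ltnS (leq_eqVlt j).
  by move: jm; rewrite -(inj_eq val_inj)/= => /negbTE ->.
(* The exponential in coordinate m is expanded over the values i of its count; each term is a hybrid
   of rank m in which [upd i] prescribes that value. *)
transitivity (\int[P]_w \sum_(i <oo)
    (expR (- (a m' * i%:R)) * \prod_(j < n) V m (upd i) j w)%:E).
  apply: ae_eq_integral => //.
    apply: measurable_limn => N; apply: emeasurable_sum => i.
    by apply/measurable_EFinP; apply: measurable_funM => //; apply: measurable_prod.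
  apply: filterS (E_series m') => w Ew _.
  rewrite (bigD1 m')//= EFinM {1}/V ltnSn Ew muleC.
  rewrite -nneseriesZl; last by move=> i _; rewrite lee_fin mulr_ge0 ?expR_ge0.
  apply: eq_eseriesr => i _; rewrite -EFinM; congr _%:E.
  rewrite [in RHS](bigD1 m')//= {2}/V ltnn /upd eqxx mulrCA; congr (_ * _)%R.
  rewrite mulrC; congr (_ * _)%R.
  by apply: eq_bigr => j jm; exact: Vne.
rewrite integral_nneseries//; last 2 first.
- by move=> i; apply/measurable_EFinP; apply: measurable_funM => //; apply: measurable_prod.
- by move=> i w _; rewrite lee_fin mulr_ge0 ?expR_ge0// prodr_ge0.
transitivity (\sum_(i <oo) ((\prod_(j < n | j != m') W m.+1 k j)%:E *
    (expR (- (a m' * i%:R)) * poisson_pmf0 (r m') i)%:E)).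
  apply: eq_eseriesr => i _; under eq_integral do rewrite EFinM.
  rewrite ge0_integralZl//; last by move=> w _; rewrite lee_fin prodr_ge0.
  rewrite IH -!EFinM; congr _%:E.
  rewrite [in LHS](bigD1 m')//= {1}/W ltnn /upd eqxx mulrA mulrC; congr (_ * _)%R.
  by apply: eq_bigr => j jm; rewrite (Wne i).
rewrite nneseriesZl; last first.
  by move=> i _; rewrite lee_fin mulr_ge0 ?expR_ge0// poisson_pmf0_ge0.
rewrite poisson_laplace -EFinM; congr _%:E.
by rewrite [in RHS](bigD1 m')//= {2}/W ltnSn mulrC.
Qed.

Lemma integral_expeRN_poisson_vector :
  \int[P]_w expeR (- \sum_(j < n) (a j)%:E * K j w) =
  (expR (- \sum_(j < n) (1 - expR (- a j)) * r j))%:E.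
Proof.
transitivity (\int[P]_w (\prod_(j < n) V n (fun=> 0%N) j w)%:E).
  apply: eq_integral => w _; rewrite expeRN_sum//; congr _%:E; apply: eq_bigr => j _.
  by rewrite /V ltn_ord.
rewrite integral_V; congr _%:E; rewrite -sumrN expR_sum; apply: eq_bigr => j _.
by rewrite /W ltn_ord.
Qed.

End poisson_vector.

Section monotone_limits.
Context {R : realType}.
Local Open Scope ereal_scope.

Lemma cvg_ge0_integral d (T : measurableType d) (mu : {measure set T -> \bar R})
    (u : (T -> \bar R)^nat) (l : T -> \bar R) :
  (forall n, measurable_fun setT (u n)) -> (forall n x, 0 <= u n x) ->
  (forall x, nondecreasing_seq (u ^~ x)) -> (forall x, u ^~ x @ \oo --> l x) ->
  \int[mu]_x u n x @[n --> \oo] --> \int[mu]_x l x.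
Proof.
move=> mu_ u0 ndu ul.
have := @cvg_monotone_convergence _ _ _ mu setT measurableT u mu_
  (fun n x _ => u0 n x) (fun x _ => ndu x).
rewrite (_ : \int[mu]_x limn (u ^~ x) = \int[mu]_x l x) //.
by apply: eq_integral => x _; apply/cvg_lim.
Qed.

Lemma cvg_ge0_series (u : nat -> nat -> \bar R) (l : nat -> \bar R) :
  (forall n i, 0 <= u n i) -> (forall i, nondecreasing_seq (u ^~ i)) ->
  (forall i, u ^~ i @ \oo --> l i) ->
  \sum_(i <oo) u n i @[n --> \oo] --> \sum_(i <oo) l i.
Proof.
move=> u0 ndu ul.
have l0 i : 0 <= l i.
  by rewrite -(cvg_lim (@ereal_hausdorff R) (ul i)); apply: lime_ge; [exact: cvgP (ul i)|exact: nearW].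
rewrite -ge0_integral_count//; under eq_fun do rewrite -ge0_integral_count//.
by apply: cvg_ge0_integral.
Qed.

End monotone_limits.

(** * From step functions to nonnegative measurable functions *)

Section laplace_functional.
Context {R : realType} d (Omega : measurableType d) (P : probability Omega R).
Variables (X : nat -> Omega -> R * R) (alive : nat -> Omega -> bool).
Variables (lam : R) (F : R -> R).
Local Open Scope ereal_scope.
Import HBNNSimple.
Hypothesis mp : measurable_points X alive.
Hypothesis ppp : is_PPP P X alive lam F.
Hypothesis lam0 : (0 <= lam)%R.
Hypothesis F01 : forall r, (0 <= r)%R -> (0 <= F r <= 1)%R.
Hypothesis mF : measurable_fun setT (fun r : R => F `|r|%R).

Lemma measurable_alive i : measurable_fun setT (alive i).
Proof. by apply: (measurable_fun_bool true) => //; rewrite setTI; exact: (mp i).2. Qed.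

Lemma measurable_sum_alive (h : nat -> Omega -> \bar R) :
  (forall i, measurable_fun setT (h i)) ->
  measurable_fun setT (fun w => \sum_(i <oo | alive i w) h i w).
Proof.
move=> mh; under eq_fun do rewrite eseries_mkcond.
apply: measurable_limn => n; apply: emeasurable_sum => i.
by apply: measurable_fun_ifT => //; exact: measurable_alive.
Qed.

Let D (z : R * R) : R := (lam * F (dist2 z origin2))%R.

Let D0 z : (0 <= D z)%R.
Proof. by rewrite mulr_ge0//; have /andP[] := F01 (dist2_ge0 z origin2). Qed.

Let Dlam z : (D z <= lam)%R.
Proof. by rewrite ler_piMr//; have /andP[] := F01 (dist2_ge0 z origin2). Qed.

Let mD : measurable_fun setT D.
Proof.
apply: measurable_funM => //.
rewrite (_ : (fun z => _) = (fun r => F `|r|%R) \o (fun z => dist2 z origin2)).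
  by apply: measurableT_comp => //; exact: measurable_dist2.
by apply/funext => z /=; rewrite ger0_norm// dist2_ge0.
Qed.

Let mDE : measurable_fun setT (fun z : R * R => (lam * F (dist2 z origin2))%:E).
Proof. exact/measurable_EFinP. Qed.

Let mcount B : measurable B -> measurable_fun setT (fun w => Defs.count X alive w B).
Proof.
move=> mB; apply: measurable_sum_alive => i.
have -> : (fun w => (X i w \in B)%:R%:E) = (EFin \o \1_B) \o X i :> (Omega -> \bar R).
  by apply/funext => w /=; rewrite indicE.
apply: measurableT_comp; last exact: (mp i).1.
by apply/measurable_EFinP; exact: measurable_indic.
Qed.

Let count_ge0 w B : 0 <= Defs.count X alive w B.
Proof. by apply: nneseries_ge0 => i _ _; rewrite lee_fin. Qed.

Section step.
Variables (n : nat) (B : 'I_n -> set (R * R)) (a : 'I_n -> R).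
Hypothesis mB : forall j, measurable (B j).
Hypothesis Bfin : forall j, intensity lam F (B j) < +oo.
Hypothesis Bdisj : forall j1 j2, j1 != j2 -> B j1 `&` B j2 = set0.
Hypothesis a0 : forall j, (0 <= a j)%R.

Let phi (z : R * R) : R := (\sum_(j < n) a j * \1_(B j) z)%R.

Let intensity_ge0 j : 0 <= intensity lam F (B j).
Proof. by apply: integral_ge0 => z _; rewrite lee_fin; exact: D0. Qed.

(** At most one indicator is nonzero at [z], and 1 - exp(-t) vanishes at t = 0. *)
Let phi_exp z : (1 - expR (- phi z) = \sum_(j < n) (1 - expR (- a j)) * \1_(B j) z)%R.
Proof.
have [[j Bj]|nB] := pselect (exists j, B j z).
  have other i : i != j -> (\1_(B i) z = 0 :> R)%R.
    move=> ij; rewrite indicE memNset// => Bi.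
    by have := Bdisj ij; rewrite -subset0 => /(_ z); apply.
  rewrite /phi (bigD1 j)//= [in RHS](bigD1 j)//= !big1 => [|i ij|i ij].
  - by rewrite !addr0 indicE mem_set// !mulr1.
  - by rewrite other// mulr0.
  - by rewrite other// mulr0.
have out i : (\1_(B i) z = 0 :> R)%R by rewrite indicE memNset// => Bi; apply: nB; exists i.
by rewrite /phi !big1 => [|i _|i _]; rewrite ?out ?mulr0// oppr0 expR0 subrr.
Qed.

(** The sum of a step function over the points is a linear combination of counts of disjoint sets,
    which are independent Poisson variables. *)
Lemma integral_expeRN_step :
  \int[P]_w expeR (- \sum_(i <oo | alive i w) (phi (X i w))%:E) =
  expeR (- \int[leb2]_z ((1 - expR (- phi z)) * D z)%:E).
Proof.
have c0 j : (0 <= 1 - expR (- a j))%R by rewrite subr_ge0 -expR0 ler_expR oppr_le0.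
have mBD j : measurable_fun setT (fun z : R * R => (\1_(B j) z * D z)%:E).
  by apply/measurable_EFinP; apply: measurable_funM => //; exact: measurable_indic.
have mcD j : measurable_fun setT (fun z : R * R => ((1 - expR (- a j)) * \1_(B j) z * D z)%:E).
  apply/measurable_EFinP; apply: measurable_funM => //.
  by apply: measurable_funM => //; exact: measurable_indic.
transitivity (\int[P]_w expeR (- \sum_(j < n) (a j)%:E * Defs.count X alive w (B j))).
  apply: eq_integral => w _; congr (expeR (- _)).
  rewrite eseries_mkcond.
  transitivity (\sum_(i <oo) \sum_(j < n)
      if alive i w then (a j * \1_(B j) (X i w))%:E else 0).
    apply: eq_eseriesr => i _; case: ifPn => _; last by rewrite big1.
    by rewrite /phi -sumEFin.
  rewrite nneseries_sum; last first.
    by move=> j i _; case: ifP => // _; rewrite lee_fin mulr_ge0.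
  by apply: eq_bigr => j _; rewrite -eseries_mkcond -nneseriesZl.
rewrite (@integral_expeRN_poisson_vector _ _ _ P n _ (fun j => fine (intensity lam F (B j))))//.
- transitivity (expeR (- (\sum_(j < n) (1 - expR (- a j)) * fine (intensity lam F (B j)))%R%:E)) => //.
  congr (expeR (- _)).
  rewrite -sumEFin; under [RHS]eq_integral do rewrite phi_exp mulr_suml -sumEFin.
  rewrite ge0_integral_sum//; last first.
    by move=> j z _; rewrite lee_fin; apply: mulr_ge0; [apply: mulr_ge0|exact: D0].
  apply: eq_bigr => j _; rewrite EFinM fineK; last by rewrite ge0_fin_numE.
  under [RHS]eq_integral do rewrite -mulrA EFinM.
  rewrite ge0_integralZl//; last 3 first.
  - exact: mBD.
  - by move=> z _; rewrite lee_fin; apply: mulr_ge0; [|exact: D0].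
  - exact: c0.
  congr (_ * _); rewrite /intensity [LHS]integral_mkcond/=; apply: eq_integral => z _.
  by rewrite patchE indicE; case: ifP => _; rewrite ?mul1r ?mul0r.
- by move=> j; exact: mcount.
- by move=> j; rewrite fine_ge0.
- move=> j i; have := @ppp 1%N (fun=> B j) (fun=> i) (fun=> mB j) (fun=> Bfin j).
  rewrite big_ord1 => <-; last by move=> j1 j2; rewrite !ord1 eqxx.
  by congr (P _); apply/seteqP; split => w /=; [move=> Bi k _|by move=> h; have := h ord0 I].
- by move=> k; exact: ppp.
Qed.

End step.

Lemma integral_expeRN_nnsfun (f : {nnsfun (R * R)%type >-> R}) (A : set (R * R)) :
  measurable A -> intensity lam F A < +oo -> (forall z, ~ A z -> f z = 0%R) ->
  \int[P]_w expeR (- \sum_(i <oo | alive i w) (f (X i w))%:E) =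
  expeR (- \int[leb2]_z ((1 - expR (- f z)) * D z)%:E).
Proof.
move=> mA Afin fA.
(* The value 0 is discarded: its level set may have infinite intensity, where the Poisson law says
   nothing. The other level sets lie inside [A]. *)
pose s := [seq y <- finmap.enum_fset (fset_set (range f)) | y != 0%R].
pose a (j : 'I_(size s)) := s`_j.
pose B (j : 'I_(size s)) := f @^-1` [set a j].
have us : uniq s by rewrite filter_uniq// finmap.fset_uniq.
have a_s j : a j \in s by exact: mem_nth.
have a_neq0 j : a j != 0%R by have := a_s j; rewrite mem_filter => /andP[].
have fE z : f z = (\sum_(j < size s) a j * \1_(B j) z)%R.
  transitivity (\sum_(y <- s) y * (f z == y)%:R)%R; last first.
    rewrite (big_nth 0%R) big_mkord; apply: eq_bigr => j _; rewrite indicE.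
    congr (_ * _%:R)%R; congr nat_of_bool; apply/eqP/idP => [fz|/set_mem//].
    exact: mem_set.
  have [fz0|fz0] := eqVneq (f z) 0%R.
    rewrite fz0 big_seq big1// => y; rewrite mem_filter => /andP[y0 _].
    by rewrite eq_sym (negbTE y0) mulr0.
  rewrite (bigD1_seq (f z))//=.
    by rewrite eqxx mulr1 big1 ?addr0// => y; rewrite eq_sym => /negbTE ->; rewrite mulr0.
  by rewrite mem_filter fz0/= in_fset_set ?inE//; exact: imageP.
have -> : f = (fun z => \sum_(j < size s) a j * \1_(B j) z)%R :> (R * R -> R).
  exact/funext.
have mB j : measurable (B j) by exact: measurable_sfunP.
apply: integral_expeRN_step => //.
- move=> j; apply: le_lt_trans Afin; apply: ge0_subset_integral => //.
  + exact: mB.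
  + by apply: measurable_funTS; exact: mDE.
  + by move=> z _; rewrite lee_fin; exact: D0.
  + move=> z Bz; apply: contrapT => /fA fz0; have := a_neq0 j.
    by rewrite -(Bz : f z = a j) fz0 eqxx.
- move=> j1 j2 j12; apply/seteqP; split => // z [/= fz1].
  rewrite /B/= fz1 => /eqP.
  by rewrite nth_uniq// => /eqP/val_inj e; rewrite e eqxx in j12.
- move=> j; have := a_s j; rewrite mem_filter => /andP[_]; rewrite in_fset_set// inE => -[z _ <-] //.
Qed.

Let box (m : nat) : set (R * R) := `[(- m%:R)%R, m%:R%R]%classic `*` `[(- m%:R)%R, m%:R%R]%classic.

Let mbox m : measurable (box m).
Proof. exact: measurableX. Qed.

Let box_fin m : intensity lam F (box m) < +oo.
Proof.
have bfin : leb2 (box m) < +oo.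
  have itvfin : (@lebesgue_measure R) `[(- m%:R)%R, m%:R%R]%classic < +oo.
    by rewrite lebesgue_measure_itv /=; case: ifP => _; rewrite -?EFinD ltry.
  rewrite /leb2 /box product_measure1E//.
  by apply: lte_mul_pinfty; [exact: measure_ge0|rewrite ge0_fin_numE|].
apply: (@le_lt_trans _ _ (\int[leb2]_(z in box m) lam%:E)).
  apply: ge0_le_integral.
  - exact: mbox.
  - by move=> z _; rewrite lee_fin; exact: D0.
  - by apply: measurable_funTS; exact: mDE.
  - exact: measurable_cst.
  - by move=> z _; rewrite lee_fin; exact: Dlam.
by rewrite integral_cst; [rewrite lte_mul_pinfty|exact: mbox].
Qed.

Lemma integral_expeRN_sum_alive (h : R * R -> R) :
  measurable_fun setT h -> (forall z, 0 <= h z)%R ->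
  \int[P]_w expeR (- \sum_(i <oo | alive i w) (h (X i w))%:E) =
  expeR (- \int[leb2]_z ((1 - expR (- h z)) * D z)%:E).
Proof.
move=> mh h0.
have mhE : measurable_fun setT (EFin \o h) by exact/measurable_EFinP.
(* Truncation to [box m] gives the nonzero level sets finite intensity and keeps the sequence
   nondecreasing. *)
pose f m : {nnsfun (R * R)%type >-> R} :=
  proj_nnsfun (nnsfun_approx measurableT mhE m) (mbox m).
have fE m z : f m z = (nnsfun_approx measurableT mhE m z * \1_(box m) z)%R by [].
have f0 m z : (0 <= f m z)%R by [].
have ndf z : nondecreasing_seq (fun m => f m z).
  move=> m n mn; rewrite !fE ler_pM//.
    by have /lefP := nd_nnsfun_approx measurableT mhE mn; exact.
  rewrite !indicE ler_nat; have [bz|] := boolP (z \in box m) => //.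
  rewrite mem_set//; move: bz => /set_mem [] /=; rewrite !in_itv/= => /andP[a b] /andP[c e].
  have mn' : (m%:R <= n%:R :> R)%R by rewrite ler_nat.
  by split; rewrite /= in_itv/=; apply/andP; split; lra.
have cvgf z : (f m z)%:E @[m --> \oo] --> (h z)%:E.
  have := @cvg_nnsfun_approx _ _ _ setT measurableT _ mhE (fun z _ => h0 z) z I.
  apply: cvg_trans; apply: near_eq_cvg.
  near=> m; suff -> : f m z = nnsfun_approx measurableT mhE m z by [].
  rewrite fE indicE mem_set ?mulr1//.
  have z1m : (`|z.1| <= m%:R)%R by near: m; exact: nbhs_infty_ger.
  have z2m : (`|z.2| <= m%:R)%R by near: m; exact: nbhs_infty_ger.
  by split; rewrite /= in_itv/= -ler_norml.
have c0 (t : R) : (0 <= t)%R -> (0 <= 1 - expR (- t))%R.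
  by move=> t0; rewrite subr_ge0 -expR0 ler_expR oppr_le0.
have mfD m : measurable_fun setT
    (fun z : R * R => ((1 - expR (- f m z)) * (lam * F (dist2 z origin2)))%:E).
  apply/measurable_EFinP; apply: measurable_funM => //; apply: measurable_funB => //.
  by apply: measurableT_comp => //; exact: measurableT_comp.
have lhs : \int[P]_w expeR (- \sum_(i <oo | alive i w) (f m (X i w))%:E) @[m --> \oo] -->
    \int[P]_w expeR (- \sum_(i <oo | alive i w) (h (X i w))%:E).
  apply: cvg_integral_expeRN.
  - move=> m; apply: measurable_sum_alive => i; apply/measurable_EFinP.
    by apply: measurableT_comp => //; exact: (mp i).1.
  - apply: measurable_sum_alive => i; apply/measurable_EFinP.
    by apply: measurableT_comp => //; exact: (mp i).1.
  - apply/aeW => w; split=> [m|]; first by apply: nneseries_ge0 => i _ _; rewrite lee_fin.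
    rewrite eseries_mkcond; under eq_fun do rewrite eseries_mkcond.
    apply: cvg_ge0_series.
    + by move=> m i; case: ifP => // _; rewrite lee_fin.
    + by move=> i m n mn; case: ifP => // _; rewrite lee_fin; exact: ndf.
    + move=> i; case: ifP => // _; exact: cvg_cst.
have rhs : expeR (- \int[leb2]_z ((1 - expR (- f m z)) * D z)%:E) @[m --> \oo] -->
    expeR (- \int[leb2]_z ((1 - expR (- h z)) * D z)%:E).
  apply: cvg_expeRN.
    by move=> m; apply: integral_ge0 => z _; rewrite lee_fin mulr_ge0 ?c0//; exact: D0.
  apply: cvg_ge0_integral.
  - exact: mfD.
  - by move=> m z; rewrite lee_fin mulr_ge0 ?c0//; exact: D0.
  - move=> z m n mn; rewrite lee_fin; apply: ler_wpM2r; first exact: D0.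
    by rewrite lerB// ler_expR lerN2; exact: ndf.
  - move=> z; apply: cvg_EFin; first exact: nearW.
    have /fine_cvgP[_ fz] := cvgf z.
    apply: cvgM; last exact: cvg_cst.
    apply: cvgB; first exact: cvg_cst.
    by apply: continuous_cvg; [exact: continuous_expR|exact: cvgN].
rewrite -(cvg_lim (@ereal_hausdorff R) lhs) -(cvg_lim (@ereal_hausdorff R) rhs).
congr (limn _); apply/funext => m.
apply: (@integral_expeRN_nnsfun _ (box m)) => // z nz.
by rewrite fE indicE memNset// mulr0.
Unshelve. all: by end_near. Qed.

End laplace_functional.

(** * Outage probability *)

Section interference.
Context {R : realType} d (Omega : measurableType d) (P : probability Omega R).
Variables (X : nat -> Omega -> R * R) (alive : nat -> Omega -> bool).
Variables (g : nat -> Omega -> R) (c : R) (alpha : nat) (y0 : R * R).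
Local Open Scope ereal_scope.
Hypothesis c0 : (0 < c)%R.
Hypothesis mp : measurable_points X alive.
Hypothesis marks : iid_exp1_marks_indep P X alive g.

Let ell (z : R * R) : R := pathloss c alpha (dist2 z y0).
Let den (z : R * R) : (0 < c + dist2 z y0 ^+ alpha)%R.
Proof. by rewrite ltr_pwDl// exprn_ge0// dist2_ge0. Qed.

Let ell0 z : (0 <= ell z)%R.
Proof. by rewrite invr_ge0 ltW. Qed.

Let mell : measurable_fun setT ell.
Proof.
apply: measurable_invD => // [z|]; first by rewrite exprn_ge0// dist2_ge0.
by apply: measurable_funX; exact: measurable_dist2.
Qed.

Let mX i : measurable_fun setT (X i).
Proof. exact: (mp i).1. Qed.

Let I := interference c alpha X alive g y0.

Lemma measurable_interference : measurable_fun setT I.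
Proof.
apply: measurable_sum_alive => // i; apply/measurable_EFinP.
by apply: measurable_funM; [exact: marks.1|exact: (measurableT_comp mell)].
Qed.

Let gindep := marks.2.

Lemma marks_gt0_ae : {ae P, forall w i, (0 < g i w)%R}.
Proof.
apply: ae_foralln => i; apply: exp1_gt0_ae; first exact: marks.1.
exact: (mark_cdf gindep).
Qed.

Lemma interference_ge0_ae : {ae P, forall w, 0 <= I w}.
Proof.
apply: filterS marks_gt0_ae => w g0; apply: nneseries_ge0 => i _ _.
by rewrite lee_fin; apply: mulr_ge0; [exact: ltW|exact: ell0].
Qed.

Let Gen : set (set Omega) := [set A | exists i, A = [set w | alive i w] \/
  exists B, measurable B /\ A = X i @^-1` B].

Let mGen : Gen `<=` measurable.
Proof.
move=> _ [i [->|[B [mB ->]]]]; first exact: (mp i).2.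
by rewrite -[Y in measurable Y]setTI; exact: mX.
Qed.

Lemma laplace_interference_points (s : R) : (0 <= s)%R ->
  laplace P I s =
  \int[P]_w expeR (- \sum_(i <oo | alive i w) (ln (1 + s * ell (X i w)))%:E).
Proof.
move=> s0.
(* Dead labels get parameter 0, hence factor 1, which turns the sum over live labels into a sum over
   all labels. *)
pose theta i : g_sigma_algebraType Gen -> R :=
  fun w => if alive i w then (s * ell (X i w))%R else 0%R.
have th0 i w : (0 <= theta i w)%R by rewrite /theta; case: ifP => // _; exact: mulr_ge0.
have mth i : measurable_fun setT (theta i).
  apply: measurable_fun_ifT => //.
    apply: (measurable_fun_bool true) => //; rewrite setTI.
    by apply: sub_gen_smallest; exists i; left.
  apply: measurable_funM => //; apply: (measurableT_comp mell) => _ B mB.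
  by rewrite setTI; apply: sub_gen_smallest; exists i; right; exists B.
have mthO i : measurable_fun setT (theta i : Omega -> R).
  apply: measurable_fun_ifT => //; first exact: measurable_alive.
  by apply: measurable_funM => //; exact: (measurableT_comp mell).
transitivity (\int[P]_w expeR (- \sum_(i <oo) (theta i w * g i w)%:E)).
  (* The factor [s] may be moved inside the series where all marks are positive, that is almost
     surely. *)
  apply: ae_eq_integral => //.
  - apply: (measurableT_comp measurable_expeR); apply: measurableT_comp => //.
    by apply: measurable_funeM; exact: measurable_interference.
  - apply: (measurableT_comp measurable_expeR); apply: measurableT_comp => //.
    apply: measurable_limn => n; apply: emeasurable_sum => i; apply/measurable_EFinP.
    by apply: measurable_funM => //; exact: marks.1.
  - apply: filterS marks_gt0_ae => w g0 _; congr (expeR (- _)).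
    rewrite /I /interference -nneseriesZl; last first.
      by move=> i _; rewrite lee_fin; apply: mulr_ge0; [exact: ltW|exact: ell0].
    rewrite eseries_mkcond; apply: eq_eseriesr => i _; rewrite /theta.
    case: ifP => _; last by rewrite mul0r.
    by rewrite -EFinM mulrCA mulrC.
rewrite (integral_expeRN_marks mGen marks.1 gindep th0 mth).
apply: eq_integral => w _; congr (expeR (- _)).
rewrite [RHS]eseries_mkcond; apply: eq_eseriesr => i _; rewrite /theta.
by case: ifP => // _; rewrite addr0 ln1.
Qed.

Lemma laplace_interference (lam : R) (F : R -> R) (s : R) :
  is_PPP P X alive lam F -> (0 <= lam)%R -> (0 <= s)%R ->
  (forall r, (0 <= r)%R -> (0 <= F r <= 1)%R) ->
  measurable_fun setT (fun r : R => F `|r|%R) ->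
  laplace P I s = expeR (- ((lam * s)%:E *
    \int[leb2]_z (F (dist2 z origin2) / (s + c + dist2 z y0 ^+ alpha))%:E)).
Proof.
move=> ppp lam0 s0 F01 mF; rewrite laplace_interference_points//.
have h0 z : (0 <= ln (1 + s * ell z))%R by rewrite ln_ge0// lerDl mulr_ge0.
have mh : measurable_fun setT (fun z => ln (1 + s * ell z)).
  apply: measurableT_comp => //; apply: measurable_funD => //.
  exact: measurable_funM.
rewrite (integral_expeRN_sum_alive mp ppp lam0 F01 mF mh h0); congr (expeR (- _)).
have den2 z : (0 < s + c + dist2 z y0 ^+ alpha)%R by rewrite -addrA ltr_wpDl.
have mK : measurable_fun setT
    (fun z => (F (dist2 z origin2) / (s + c + dist2 z y0 ^+ alpha))%:E).
  apply/measurable_EFinP; apply: measurable_funM.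
    rewrite (_ : (fun z => _) = (fun r => F `|r|%R) \o (fun z => dist2 z origin2)).
      by apply: measurableT_comp => //; exact: measurable_dist2.
    by apply/funext => z /=; rewrite ger0_norm// dist2_ge0.
  apply: measurable_invD => [|z|]; first by rewrite ltr_wpDl.
    by rewrite exprn_ge0// dist2_ge0.
  by apply: measurable_funX; exact: measurable_dist2.
rewrite -ge0_integralZl; last 4 first.
- exact: measurableT.
- exact: mK.
- by move=> z _; rewrite lee_fin divr_ge0 ?(ltW (den2 _))//; have /andP[] := F01 _ (dist2_ge0 z origin2).
- by rewrite lee_fin mulr_ge0.
apply: eq_integral => z _; rewrite -EFinM; congr _%:E.
rewrite expRN lnK ?posrE ?ltr_pwDl ?mulr_ge0// /ell /pathloss.
have := den z; have := den2 z; move: (dist2 z y0 ^+ alpha)%R => D D1 D2.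
by field; rewrite !gt_eqF//= addrC.
Qed.

End interference.

Lemma dist2_origin_gt0 {R : realType} (y : R * R) : y != origin2 -> 0 < dist2 y origin2.
Proof.
move=> y0; rewrite sqrtr_gt0 /= !subr0 lt0r addr_ge0 ?sqr_ge0// andbT.
rewrite paddr_eq0 ?sqr_ge0// !sqrf_eq0; apply: contra y0.
by case: y => y1 y2 /= /andP[/eqP -> /eqP ->].
Qed.

Lemma integral_kernel_A_alpha {R : realType} (alpha : nat) (F f : R -> R) (b : R) (y : R * R) :
  alpha = 2%N \/ alpha = 4%N -> F_standing F f -> 0 < b -> y != origin2 ->
  (alpha = 2%N -> hyp_A2 F f (dist2 y origin2) b) -> (alpha = 4%N -> hyp_A4 f) ->
  (\int[leb2]_z (F (dist2 z origin2) / (b + dist2 z y ^+ alpha))%:E =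
   (A_alpha alpha F f (dist2 y origin2) b)%:E)%E.
Proof.
move=> alpha24 FP b0 /dist2_origin_gt0 rho0 h2 h4.
have mF := F_standing_measurable FP.
have F0 r : 0 <= r -> 0 <= F r by move=> /FP.1 /andP[].
rewrite /A_alpha; case: alpha24 => e; rewrite e /= in h2 h4 *.
  by rewrite ge0_integral_kernel2// (integral_density2 FP)//; exact: h2.
by rewrite ge0_integral_kernel4// (integral_density4 rho0 b0 FP)//; exact: h4.
Qed.

Unset Implicit Arguments.

Theorem theorem4 (R : realType) (dsp : measure_display) (Omega : measurableType dsp)
  (P : probability Omega R)
  (lam : R) (F f : R -> R) (alpha : nat) (c beta eta : R) (x0 y0 : R * R)
  (X : nat -> Omega -> R * R) (alive : nat -> Omega -> bool)
  (g : nat -> Omega -> R) (g0 : Omega -> R) :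
  0 < lam ->
  F_standing F f ->
  (alpha = 2%N \/ alpha = 4%N) ->
  0 < c ->
  y0 != origin2 ->
  0 < dist2 x0 y0 ->
  0 <= eta ->
  0 < beta ->
  let d := dist2 x0 y0 in
  let rho := dist2 y0 origin2 in
  let s := beta * (c + d ^+ alpha) in
  (alpha = 2%N -> hyp_A2 F f rho (s + c)) ->
  (alpha = 4%N -> hyp_A4 f) ->
  (* Phi_t : Poisson point process with intensity x |-> lam F(||x||) *)
  measurable_points X alive ->
  is_PPP P X alive lam F ->
  (* Rayleigh fading: i.i.d. Exp(1) marks, independent of Phi_t *)
  iid_exp1_marks_indep P X alive g ->
  (* the reference fading g_{x0 y0} ~ Exp(1), independent of I(y0) *)
  measurable_fun setT g0 ->
  (forall t : R, P [set w | g0 w <= t] = (exp1_cdf t)%:E) ->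
  (forall (A : set R) (B : set (\bar R)), measurable A -> measurable B ->
     P ([set w | A (g0 w)] `&` [set w | B (interference c alpha X alive g y0 w)]) =
     (P [set w | A (g0 w)] * P [set w | B (interference c alpha X alive g y0 w)])%E) ->
  let I := interference c alpha X alive g y0 in
  let q := P [set w | ((g0 w)%:E < beta%:E * (eta%:E + (c + d ^+ alpha)%:E * I w))%E] in
  q = (1 - laplace P I s * (expR (- (beta * eta)))%:E)%E /\
  q = (1 - expR (- (beta * eta) - lam * s * A_alpha alpha F f rho (s + c)))%:E.
Proof.
move=> lam0 FP alpha24 c0 y00 d0 eta0 beta0 d rho s h2 h4 mp ppp marks mg0 g0cdf g0indep I q.
have K0 : 0 < c + d ^+ alpha by rewrite ltr_pwDl// exprn_ge0// ltW.
have s0 : 0 < s by rewrite mulr_gt0.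
pose Y w := (beta%:E * (eta%:E + (c + d ^+ alpha)%:E * I w))%E.
have mI : measurable_fun setT I by exact: (measurable_interference alpha y0 c0 mp marks).
have mT : measurable_fun setT (fun x : \bar R => (beta%:E * (eta%:E + (c + d ^+ alpha)%:E * x))%E).
  apply: measurable_funeM; apply: emeasurable_funD => //.
  exact: measurable_funeM.
have mY : measurable_fun setT Y by exact: (measurableT_comp mT).
(* The identity is needed at every [w], including those of the null set where I may be -oo; both
   sides are then +oo. *)
have expY w : expeR (- Y w)%E = (expeR (- (s%:E * I w)) * (expR (- (beta * eta)))%:E)%E.
  rewrite /Y /s; case: (I w) => [x| |].
  - transitivity (expR (- (beta * (eta + (c + d ^+ alpha) * x))))%:E => //.
    transitivity (expR (- (beta * (c + d ^+ alpha) * x)) * expR (- (beta * eta)))%:E => //.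
    by rewrite -expRD; congr (expR _)%:E; ring.
  - by rewrite !gt0_muley ?lte_fin//= mul0e.
  - rewrite !gt0_muleNy ?lte_fin//=.
    by rewrite gt0_mulye// lte_fin expR_gt0.
have qE : q = (1 - laplace P I s * (expR (- (beta * eta)))%:E)%E.
  rewrite /q (exp1_threshold mg0 g0cdf mY).
  - congr (1 - _)%E; rewrite /laplace muleC -ge0_integralZl//.
    + by apply: eq_integral => w _; rewrite expY muleC.
    + apply: (measurableT_comp measurable_expeR); apply: measurableT_comp => //.
      exact: measurable_funeM.
    + by move=> w _; exact: expeR_ge0.
  - apply: filterS (interference_ge0_ae alpha y0 c0 marks) => w I0.
    rewrite mule_ge0 ?lee_fin ?(ltW beta0)// adde_ge0 ?lee_fin//.
    by rewrite mule_ge0// lee_fin ltW.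
  (* The threshold is a measurable function of I alone, so it inherits the independence from
     [g0]. *)
  - move=> A B mA mB; apply: (g0indep A ((fun x : \bar R =>
      (beta%:E * (eta%:E + (c + d ^+ alpha)%:E * x))%E) @^-1` B) mA).
    by rewrite -[Z in measurable Z]setTI; exact: mT.
split=> //; rewrite qE (laplace_interference alpha y0 c0 mp marks ppp (ltW lam0) (ltW s0) FP.1
  (F_standing_measurable FP)).
rewrite (integral_kernel_A_alpha alpha24 FP _ y00 h2 h4); last by rewrite addr_gt0.
transitivity (1 - expR (- (lam * s * A_alpha alpha F f rho (s + c))) *
  expR (- (beta * eta)))%:E => //.
by rewrite -expRD; congr (1 - expR _)%:E; ring.
Qed.
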